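(* Let $G=\mathrm{GL}_n$ or $G=\mathrm{GSp}_{2n}$ over $F$, with maximal split torus $A$ and Borel subgroup $B\supset A$ as described in the context, and let $\tilde K=G(O_L)$. Let $b\in G(L)$ with Newton point $\nu=\bar\nu(b)\in X_*(A)_{\mathbf Q,\mathrm{dom}}$, and let $\mu\in X_*(A)_{\mathrm{dom}}$ with $\nu\le\mu$. Then the $\sigma$-conjugacy class $\{g^{-1}b\sigma(g):g\in G(L)\}$ of $b$ meets $\tilde K\pi^\mu\tilde K$. Equivalently, there exists $h\in G(L)/\tilde K$ with $\mathrm{inv}(h,b\sigma(h))=\mu$.
   Context: $F$ is a finite extension of $\mathbf Q_p$ with uniformizer $\pi$, $L$ is the completion of the maximal unramified extension of $F$, $O_L$ its ring of integers, and $\sigma$ the relative Frobenius automorphism of $L/F$. For $G=\mathrm{GL}_n$, $A$ is the diagonal torus and $B$ the upper triangular Borel subgroup; $X_*(A)=\mathbf Z^n$. For $G=\mathrm{GSp}_{2n}$ (similitudes of a symplectic form on $F^{2n}$ for which the diagonal torus and upper triangular matrices give a maximal torus and Borel subgroup), $A$ is the diagonal torus of $G$ and $X_*(A)=\{\mu\in\mathbf Z^{2n}:\mu_i+\mu_{2n+1-i}\text{ independent of }i\}$. For $\mu\in X_*(A)$, $\pi^\mu\in A(F)$ is the image of $\pi$ under $\mu$. $X_*(A)_{\mathrm{dom}}$ (resp. $X_*(A)_{\mathbf Q,\mathrm{dom}}$) denotes the $B$-dominant elements of $X_*(A)$ (resp. $X_*(A)\otimes\mathbf Q$), i.e. those with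 non-increasing entries. For $\nu,\mu\in X_*(A)\otimes\mathbf Q$, $\nu\le\mu$ means that $\mu-\nu$ is a non-negative linear combination of positive coroots (for $\mathrm{GL}_n$ this is the usual dominance order: partial sums of $\nu$ are $\le$ those of $\mu$, with equal total sums; for $\mathrm{GSp}_{2n}$ it is the dominance order of $\mathrm{GL}_{2n}$). By the Cartan decomposition every $g^{-1}h$ ($g,h\in G(L)$) lies in $\tilde K\pi^\mu\tilde K$ for a unique dominant $\mu$, denoted $\mathrm{inv}(g\tilde K,h\tilde K)$. The Newton point $\bar\nu(b)$ of $b\in G(L)$ (Kottwitz) is, for $\mathrm{GL}_n$, the slope vector in $(\mathbf Q^n)_+$ of the isocrystal $(L^n,b\sigma)$ and, for $\mathrm{GSp}_{2n}$, the slope vector of $(L^{2n},b\sigma)$; slopes are normalized so that $\pi$ has valuation 1. *)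

(* Defs.v *)
From HB Require Import structures.
From mathcomp Require Import all_boot all_order all_algebra.
Set Implicit Arguments. Unset Strict Implicit. Unset Printing Implicit Defensive.
Import Order.TTheory GRing.Theory Num.Theory.
Local Open Scope ring_scope.

(* The p-adic setting (L = completion of the maximal
   unramified extension of F, F/Q_p finite, sigma = relative Frobenius) is
   axiomatised by [breve_setting]. *)

Section Valuation.
Variables (L : fieldType) (v : L -> int).

Definition close (x y : L) (N : int) : Prop := x = y \/ (N <= v (x - y)).

Definition intg (x : L) : Prop := x = 0 \/ (0 <= v x).

Definition intmx m (A : 'M[L]_m) : Prop := forall i j, intg (A i j).

Definition Kmx m (g : 'M[L]_m) : Prop :=
  g \in unitmx /\ intmx g /\ intmx (invmx g).
End Valuation.

(* Axioms characterising (L, v, sigma, pi): L complete discretely valued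
   field of char 0 with normalized valuation v (v pi = 1), residue field an
   algebraic closure of F_p, sigma a valuation-preserving automorphism
   inducing x |-> x^(p^f) on the residue field and fixing the uniformizer
   pi.  Then F := L^sigma is a finite extension of Q_p with residue field
   F_(p^f) and uniformizer pi, L is the completion of its maximal unramified
   extension, and sigma is the relative Frobenius. *)
Definition breve_setting (L : fieldType) (v : L -> int)
    (sigma : {rmorphism L -> L}) (p f : nat) (pi : L) : Prop :=
  [/\ (forall x y : L, x != 0 -> y != 0 -> v (x * y) = v x + v y),
      (forall x y : L, x != 0 -> y != 0 -> x + y != 0 ->
          Num.min (v x) (v y) <= v (x + y)),
      pi != 0 /\ v pi = 1,
      (forall k : nat, (0 < k)%N -> (k%:R : L) != 0) &
      prime p /\ close v (p%:R) 0 1] /\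
  [/\ (forall u : nat -> L,
         (forall N : int, exists M, forall k, (M <= k)%N -> close v (u k.+1) (u k) N) ->
         exists l, forall N : int, exists M, forall k, (M <= k)%N -> close v (u k) l N),
      (forall P : {poly L}, (1 < size P)%N -> lead_coef P = 1 ->
          (forall i, intg v P`_i) -> exists a, intg v a /\ close v P.[a] 0 1),
      (forall x, intg v x -> exists k, (0 < k)%N /\ close v (x ^+ (p ^ k)) x 1) &
      [/\ bijective sigma,
          (forall x, x != 0 -> v (sigma x) = v x),
          (0 < f)%N,
          (forall x, intg v x -> close v (sigma x) (x ^+ (p ^ f)) 1) &
          sigma pi = pi]].

Section Groups.
Variables (L : fieldType) (v : L -> int) (sigma : {rmorphism L -> L}) (pi : L).

Definition pimx m (mu : 'I_m -> int) : 'M[L]_m := diag_mx (\row_i (pi ^ (mu i))).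

(* matrix of (b sigma)^s :  b sigma(b) ... sigma^(s-1)(b) *)
Fixpoint sigma_norm m (s : nat) (b : 'M[L]_m) : 'M[L]_m :=
  match s with
  | 0 => 1%:M
  | s'.+1 => b *m map_mx sigma (sigma_norm s' b)
  end.

Definition dominant_rat m (nu : 'I_m -> rat) : Prop :=
  forall i j : 'I_m, (i <= j)%N -> nu j <= nu i.
Definition dominant_int m (mu : 'I_m -> int) : Prop :=
  forall i j : 'I_m, (i <= j)%N -> mu j <= mu i.

(* Slope vector (Newton point) of the isocrystal (L^m, b sigma), via the
   Dieudonne-Manin decomposition: nu is non-increasing, and in some basis
   (columns of P) the isocrystal splits as the direct sum over the slope
   classes {i | nu i = lam}; each such piece is (b sigma)-stable and the
   O_L-lattice spanned by its basis vectors M satisfies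
   (b sigma)^s M = pi^r M, where lam = r/s in lowest terms. *)
Definition newton_point m (b : 'M[L]_m) (nu : 'I_m -> rat) : Prop :=
  dominant_rat nu /\
  exists P : 'M[L]_m, P \in unitmx /\
    let b' := invmx P *m b *m map_mx sigma P in
    (forall i j, nu i != nu j -> b' i j = 0) /\
    (forall i0 : 'I_m,
       let lam := nu i0 in
       let s := absz (denq lam) in
       let r := numq lam in
       let N := sigma_norm s b' in
       Kmx v (\matrix_(i, j) if (nu i == lam) && (nu j == lam)
                             then pi ^ (- r) * N i j
                             else (i == j)%:R)).

Definition dom_le m (nu : 'I_m -> rat) (mu : 'I_m -> int) : Prop :=
  (forall k : nat, (k <= m)%N ->
     \sum_(i < m | (i < k)%N) nu i <= \sum_(i < m | (i < k)%N) (mu i)%:~R) /\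
  \sum_(i < m) nu i = \sum_(i < m) (mu i)%:~R.

Definition in_cartan m (inG : 'M[L]_m -> Prop) (x : 'M[L]_m) (mu : 'I_m -> int) : Prop :=
  exists k1 k2 : 'M[L]_m, inG k1 /\ Kmx v k1 /\ inG k2 /\ Kmx v k2 /\
    x = k1 *m pimx mu *m k2.

Definition inGL m (g : 'M[L]_m) : Prop := g \in unitmx.

(* symplectic form J with J_(i, 2n-1-i) = 1 for i < n, -1 for i >= n
   (0-indexed); diagonal matrices / upper triangular matrices of GSp_2n are
   then a maximal torus / Borel subgroup. *)
Definition Jsp n : 'M[L]_(n + n) :=
  \matrix_(i, j) if (i + j == (n + n).-1)%N then (if (i < n)%N then 1 else -1) else 0.

Definition inGSp n (g : 'M[L]_(n + n)) : Prop :=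
  g \in unitmx /\ exists c : L, c != 0 /\ g^T *m Jsp n *m g = c *: Jsp n.

End Groups.

Definition cochar_GSp n (mu : 'I_(n + n) -> int) : Prop :=
  forall i j : 'I_(n + n), mu i + mu (rev_ord i) = mu j + mu (rev_ord j).

(* Main.v *)
Require Import Defs.
From HB Require Import structures.
From mathcomp Require Import all_boot all_order all_algebra.
From mathcomp Require Import perm zify ring lra.
From Stdlib Require Import ClassicalEpsilon.
Set Implicit Arguments. Unset Strict Implicit. Unset Printing Implicit Defensive.
Import Order.TTheory GRing.Theory Num.Theory.
Local Open Scope ring_scope.

(** Write [F = L^sigma], [phi = b sigma] on [V = L^m], and let [r/s] in lowest
    terms be a slope.  By Lang's theorem for [GL_d(O_L)], [V] is spanned by
    vectors [y] with [phi^s y = pi^r y]; such a [y] generates a [phi]-stable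
    subspace of dimension exactly [s] (take determinants), so a greedy choice
    decomposes [V] into these simple pieces.  Twisting the generators by units
    ([1 + p] is not a root of unity) makes the annihilating polynomials
    [X^s - u^i pi^r] in [F[X]] pairwise coprime; the sum [x] of the generators is
    then a cyclic vector, killed by a polynomial [P] over [F] whose Newton polygon
    is [nu].

    For [GL_n], the basis [pi^(-mu_0-...-mu_(k-1)) phi^k x] turns [phi] into
    [k pi^mu] where [k] is a companion matrix; [k] is integral with unit
    determinant exactly because [nu <= mu].

    For [GSp_2n], normalise the form so that [<phi x, phi y> = pi^c sigma<x, y>].
    The decomposition can be made symplectic: hyperbolic pairs of simple pieces,
    plus at most one plane of slope [c/2].  The polynomial [P] is then self-dual,
    and a Coxeter-type matrix [B = u w pi^mu], with [u w] in [Sp(O_L)] and [u]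
    carrying [n] free parameters, has [P] as the polynomial of a cyclic vector.
    Decomposing that vector along the coprime factors of [P] and rescaling, one
    finds a vector of [V] killed by [P] with a proportional Gram matrix, which
    gives the required element of [GSp_2n(L)]. *)

(** Polynomials keep their coefficients in F because only these commute with the semilinear [phi]:
    so V becomes an F[X]-module and Bezout identities over F act on it. In the symplectic case equal
    annihilating polynomials do not suffice: the Gram matrices of the two orbits must agree up to
    one common scalar. On a hyperbolic pair the second generator can be chosen so that all pairings
    take prescribed values. On a plane the value <z, phi z> is taken as it comes and fixes the
    scalar. This is why two orthogonal planes are traded for a hyperbolic pair until at most one
    plane is left. Duality also dictates the twists: dual pieces receive opposite powers of 1 + p,
    so that their eigenvalues multiply to a pure power of pi, and the plane receives the eigenvalue
    -pi^c, since X^2 + pi^c is self-dual with the sign that the product requires. *)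

Section Valuation.
Variables (L : fieldType) (v : L -> int) (sigma : {rmorphism L -> L}).
Variables (p f : nat) (pi : L).
Hypothesis bs : breve_setting v sigma p f pi.

(** The value [v 0] is unconstrained by [breve_setting]; [vge] supplies the convention that zero has
    infinite valuation. *)
Definition vge (N : int) (x : L) : bool := (x == 0) || (N <= v x).

Lemma vM (x y : L) : x != 0 -> y != 0 -> v (x * y) = v x + v y.
Proof. by case: bs => -[+ _ _ _ _] _; apply. Qed.

Lemma pi_neq0 : pi != 0.
Proof. by case: bs => -[_ _ [] ? ? _ _] _. Qed.

Lemma v_pi : v pi = 1.
Proof. by case: bs => -[_ _ [] ? ? _ _] _. Qed.

Lemma natr_neq0 (k : nat) : (0 < k)%N -> (k%:R : L) != 0.
Proof. by case: bs => -[_ _ _ + _] _; apply. Qed.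

Lemma p_prime : prime p.
Proof. by case: bs => -[_ _ _ _ []]. Qed.

Lemma v_sigma x : v (sigma x) = v x.
Proof.
case: bs => _ [_ _ _ [_ H _ _ _]]; have [->|x0] := eqVneq x 0; last exact: H.
by rewrite rmorph0.
Qed.

Lemma v_iter_sigma n x : v (iter n sigma x) = v x.
Proof. by elim: n => //= n IH; rewrite v_sigma. Qed.

Lemma sigma_pi : sigma pi = pi.
Proof. by case: bs => _ [_ _ _ [_ _ _ _]]. Qed.

Lemma v1 : v 1 = 0.
Proof.
have h : v 1 = v 1 + v 1 by rewrite -vM ?oner_neq0 // mulr1.
lia.
Qed.

Lemma vV x : x != 0 -> v x^-1 = - v x.
Proof.
move=> x0; have := vM x0 (invr_neq0 x0); rewrite divff // v1; lia.
Qed.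

Lemma vN x : v (- x) = v x.
Proof.
have [->|x0] := eqVneq x 0; first by rewrite oppr0.
have N1 : (-1 : L) != 0 by rewrite oppr_eq0 oner_neq0.
have := vM N1 N1; rewrite mulrNN mulr1 v1 => vN1.
by rewrite -mulN1r vM //; lia.
Qed.

Lemma vX x n : x != 0 -> v (x ^+ n) = v x * n%:Z.
Proof.
move=> x0; elim: n => [|n IH]; first by rewrite expr0 v1 mulr0.
by rewrite exprS vM ?expf_neq0 // IH; lia.
Qed.

Lemma vXz x (n : int) : x != 0 -> v (x ^ n) = v x * n.
Proof.
move=> x0; case: n => n; first by rewrite -exprnP vX.
by rewrite NegzE -exprnN vV ?expf_neq0 // vX //; lia.
Qed.

Lemma v_piz (n : int) : v (pi ^ n) = n.
Proof. by rewrite vXz ?pi_neq0 // v_pi; lia. Qed.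

Lemma piz_neq0 (n : int) : pi ^ n != 0.
Proof. by rewrite expfz_neq0 ?pi_neq0. Qed.

Lemma sigma_piz (n : int) : sigma (pi ^ n) = pi ^ n.
Proof. by rewrite rmorphXz /= ?sigma_pi // unitfE pi_neq0. Qed.

Lemma vge0 N : vge N 0. Proof. by rewrite /vge eqxx. Qed.

Lemma vgeD N x y : vge N x -> vge N y -> vge N (x + y).
Proof.
rewrite /vge; have [->|x0] := eqVneq x 0; first by rewrite add0r.
have [->|y0] := eqVneq y 0; first by rewrite addr0 (negbTE x0).
have [//|xy0] := eqVneq (x + y) 0 => /= hx hy.
case: bs => -[_ H _ _ _] _; apply: le_trans (H _ _ x0 y0 xy0).
by rewrite le_min hx.
Qed.

Lemma vgeN N x : vge N (- x) = vge N x.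
Proof. by rewrite /vge oppr_eq0 vN. Qed.

Lemma vgeB N x y : vge N x -> vge N y -> vge N (x - y).
Proof. by move=> hx hy; apply: vgeD; rewrite ?vgeN. Qed.

Lemma vgeM N M x y : vge N x -> vge M y -> vge (N + M) (x * y).
Proof.
rewrite /vge mulf_eq0; have [//|x0] := eqVneq x 0.
have [//|y0] := eqVneq y 0 => /= hx hy; rewrite vM //; lia.
Qed.

Lemma vgeW N M x : (M <= N)%R -> vge N x -> vge M x.
Proof. by rewrite /vge; case: eqP => //= _; apply: le_trans. Qed.

Lemma vge_sum (I : Type) (r : seq I) (P : pred I) (F : I -> L) N :
  (forall i, P i -> vge N (F i)) -> vge N (\sum_(i <- r | P i) F i).
Proof. by move=> H; apply: (big_ind (vge N)) => //; [exact: vge0 | exact: vgeD]. Qed.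

Lemma vge1 : vge 0 1. Proof. by rewrite /vge v1 lexx orbT. Qed.

Lemma vgeMl N x y : vge 0 x -> vge N y -> vge N (x * y).
Proof. by move=> hx hy; rewrite -[N]add0r; apply: vgeM. Qed.

Lemma vgeMr N x y : vge N x -> vge 0 y -> vge N (x * y).
Proof. by move=> hx hy; rewrite -[N]addr0; apply: vgeM. Qed.

Lemma vgeX x n : vge 0 x -> vge 0 (x ^+ n).
Proof.
by move=> hx; elim: n => [|n IH]; rewrite ?vge1 // exprS; apply: vgeMl.
Qed.

Lemma vge_nat n : vge 0 n%:R.
Proof. by elim: n => [|n IH]; rewrite ?vge0 // -natr1; apply: vgeD => //; exact: vge1. Qed.

Lemma vge_piz N : vge N (pi ^ N).
Proof. by rewrite /vge v_piz lexx orbT. Qed.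

Lemma vge_pizM N M x : vge N (pi ^ M * x) = vge (N - M) x.
Proof.
apply/idP/idP => h; last by rewrite -[N](subrK M) addrC; apply: vgeM => //; exact: vge_piz.
have -> : x = pi ^ (- M) * (pi ^ M * x).
  by rewrite mulrA -expfzDr ?pi_neq0 // addNr expr0z mul1r.
by rewrite addrC; apply: vgeM => //; exact: vge_piz.
Qed.

Lemma vge_all x : (forall N, vge N x) -> x = 0.
Proof.
move=> h; apply/eqP; have := h (v x + 1); rewrite /vge.
by case: eqP => //= _; lia.
Qed.

Lemma vge_sigma N x : vge N (sigma x) = vge N x.
Proof. by rewrite /vge v_sigma fmorph_eq0. Qed.

(** An iterate of [sigma] is only a function; Lang's theorem, applied to a power of [sigma], needs a
    bundled morphism. *)
Lemma iter_sigma_rmorph s : {tau : {rmorphism L -> L} | tau =1 iter s sigma}.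
Proof.
elim: s => [|s [tau Ht]]; first by exists idfun.
by exists (sigma \o tau) => x /=; rewrite Ht.
Qed.

Lemma v_unitP x : vge 0 x -> ~~ vge 1 x -> x != 0 /\ v x = 0.
Proof. by rewrite /vge; case: eqP => //= _; lia. Qed.

Lemma vge1_unit x : x != 0 -> v x = 0 -> vge 0 x /\ ~~ vge 1 x.
Proof. by rewrite /vge => /negbTE-> ->. Qed.

Lemma vge0V x : v x = 0 -> vge 0 x^-1.
Proof.
move=> vx; have [->|x0] := eqVneq x 0; first by rewrite invr0 vge0.
by rewrite /vge vV // vx lexx orbT.
Qed.

Lemma close_vge x y N : close v x y N <-> vge N (x - y).
Proof.
rewrite /close /vge subr_eq0; split; first by case=> [->|->]; rewrite ?eqxx ?orbT.
by case/orP=> [/eqP|]; [left|right].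
Qed.

Lemma intg_vge x : intg v x <-> vge 0 x.
Proof.
rewrite /intg /vge; split; first by case=> [->|->]; rewrite ?eqxx ?orbT.
by case/orP=> [/eqP|]; [left|right].
Qed.

(** Algebraic closedness of the residue field. The root is exact only modulo [pi]; higher precision
    comes from successive approximation. *)
Lemma root_mod (P : {poly L}) : (1 < size P)%N -> P \is monic ->
  (forall i, vge 0 P`_i) -> exists2 a, vge 0 a & vge 1 P.[a].
Proof.
case: bs => _ [_ H _ _] sP /monicP mP iP.
have [i|a [ha1 ha2]] := H P sP mP; first exact/intg_vge.
exists a; first exact/intg_vge.
by move/close_vge: ha2; rewrite subr0.
Qed.

Lemma complete_vge (u : nat -> L) :
  (forall k, vge k%:Z (u k.+1 - u k)) ->
  exists l, forall k, vge k%:Z (u k - l).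
Proof.
move=> hu; case: bs => _ [H _ _ _].
have [N|l Hl] := H u.
  exists `|N|%N => k hk; apply/close_vge; apply: vgeW (hu k); lia.
have hd k n : vge k%:Z (u k - u (k + n)%N).
  elim: n => [|n IH]; first by rewrite addn0 subrr vge0.
  rewrite addnS -[u k - _](subrKA (u (k + n)%N)); apply: vgeD => //.
  by rewrite -vgeN opprB; apply: vgeW (hu _); lia.
exists l => k; have [M HM] := Hl k%:Z.
rewrite -[u k - _](subrKA (u (k + M)%N)); apply: vgeD; first exact: hd.
by apply/close_vge/HM; lia.
Qed.

Lemma vge_modX (a b : L) n : vge 0 a -> vge 0 b -> vge 1 (a - b) ->
  vge 1 (a ^+ n - b ^+ n).
Proof.
move=> ha hb hab; rewrite subrXX; apply: vgeMr => //.
by apply: vge_sum => i _; apply: vgeMl; exact: vgeX.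
Qed.

Lemma sigma_frob x : vge 0 x -> vge 1 (sigma x - x ^+ (p ^ f)).
Proof.
case: bs => _ [_ _ _ [_ _ _ H _]] hx; apply/close_vge/H; exact/intg_vge.
Qed.

Lemma f_gt0 : (0 < f)%N.
Proof. by case: bs => _ [_ _ _ [_ _ ? _ _]]. Qed.

Lemma vge_iter_sigma s N x : vge N (iter s sigma x) = vge N x.
Proof. by elim: s x => //= s IH x; rewrite vge_sigma IH. Qed.

Lemma iter_sigma_frob s x : vge 0 x ->
  vge 1 (iter s sigma x - x ^+ ((p ^ f) ^ s)).
Proof.
move=> hx; elim: s => [|s IH] /=; first by rewrite expr1 subrr vge0.
rewrite -(subrKA (iter s sigma x ^+ (p ^ f))); apply: vgeD.
  by apply: sigma_frob; rewrite vge_iter_sigma.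
rewrite expnSr exprM; apply: vge_modX => //; first by rewrite vge_iter_sigma.
exact: vgeX.
Qed.

Lemma p1_unit : (1 + p%:R : L) != 0 /\ v (1 + p%:R) = 0.
Proof.
have vp : vge 1 p%:R.
  by case: bs => -[_ _ _ _ [_ /close_vge h]] _; rewrite subr0 in h.
apply: v_unitP; first by rewrite nat1r vge_nat.
apply/negP => h; have := vgeB h vp; rewrite addrK /vge oner_eq0 v1.
by [].
Qed.

(** For k > 0 the element (1 + p)^k - 1 is the image of a positive integer, hence non-zero in
    characteristic 0. *)
Lemma p1X_neq1 (n : int) : n != 0 -> (1 + p%:R : L) ^ n != 1.
Proof.
have H k : (0 < k)%N -> (1 + p%:R : L) ^+ k != 1.
  move=> k0; rewrite -subr_eq0 nat1r -natrX -[1]/(1%:R) -natrB ?expn_gt0 //.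
  apply: natr_neq0; rewrite subn_gt0 -[1%N](exp1n k) ltn_exp2r //.
  by have /prime_gt0 := p_prime.
case: n => k k0; first by apply: H; lia.
by rewrite NegzE -exprnN invr_eq1 H.
Qed.

End Valuation.

(** * Matrices over O_L and the group GL_d(O_L) *)

Section IntegralMatrices.
Variables (L : fieldType) (v : L -> int) (sigma : {rmorphism L -> L}).
Variables (p f : nat) (pi : L).
Hypothesis bs : breve_setting v sigma p f pi.
Local Notation vg := (vge v).

Definition mge m n (N : int) (A : 'M[L]_(m, n)) : Prop := forall i j, vg N (A i j).

(** Unlike [Kmx], this description of GL_d(O_L) mentions no inverse, so it can be tested modulo
    [pi]; [GLO_Kmx] identifies the two. *)
Definition GLO d (A : 'M[L]_d) : Prop := mge 0 A /\ (\det A != 0 /\ v (\det A) = 0).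

Lemma mgeD m n (N : int) (A B : 'M[L]_(m, n)) : mge N A -> mge N B -> mge N (A + B).
Proof. by move=> hA hB i j; rewrite mxE; apply: (vgeD bs). Qed.

Lemma mgeN m n (N : int) (A : 'M[L]_(m, n)) : mge N A -> mge N (- A).
Proof. by move=> hA i j; rewrite mxE (vgeN bs). Qed.

Lemma mgeB m n (N : int) (A B : 'M[L]_(m, n)) : mge N A -> mge N B -> mge N (A - B).
Proof. by move=> hA hB; apply: mgeD => //; apply: mgeN. Qed.

Lemma mgeM m n k (N M : int) (A : 'M[L]_(m, n)) (B : 'M[L]_(n, k)) :
  mge N A -> mge M B -> mge (N + M) (A *m B).
Proof.
by move=> hA hB i j; rewrite mxE; apply: (vge_sum bs) => l _; apply: (vgeM bs).
Qed.

Lemma mgeMl m n k (N : int) (A : 'M[L]_(m, n)) (B : 'M[L]_(n, k)) :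
  mge 0 A -> mge N B -> mge N (A *m B).
Proof. by move=> hA hB; rewrite -[N]add0r; apply: mgeM. Qed.

Lemma mgeMr m n k (N : int) (A : 'M[L]_(m, n)) (B : 'M[L]_(n, k)) :
  mge N A -> mge 0 B -> mge N (A *m B).
Proof. by move=> hA hB; rewrite -[N]addr0; apply: mgeM. Qed.

Lemma mge_scale m n (N M : int) a (A : 'M[L]_(m, n)) :
  vg N a -> mge M A -> mge (N + M) (a *: A).
Proof. by move=> ha hA i j; rewrite mxE; apply: (vgeM bs). Qed.

Lemma mgeW m n (N M : int) (A : 'M[L]_(m, n)) : (M <= N)%R -> mge N A -> mge M A.
Proof. by move=> h hA i j; apply: vgeW (hA i j). Qed.

Lemma mge_scalar d : mge 0 (1%:M : 'M[L]_d).
Proof. by move=> i j; rewrite mxE; case: eqP => _; [exact: (vge1 bs) | exact: vge0]. Qed.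

(** The relation [K], integrality of both sides together with congruence, is stable under sums and
    products and so passes through the Leibniz expansion. *)
Lemma det_mod d (A B : 'M[L]_d) (N : int) : (0 <= N)%R -> mge 0 A -> mge 0 B ->
  mge N (A - B) -> [/\ vg 0 (\det A), vg 0 (\det B) & vg N (\det A - \det B)].
Proof.
move=> N0 hA hB hAB; rewrite /determinant.
pose K (x y : L) := [/\ vg 0 x, vg 0 y & vg N (x - y)].
apply: (big_ind2 K); first by rewrite /K subrr !vge0.
  move=> x1 x2 y1 y2 [h1 h2 h3] [h4 h5 h6]; split; try exact: (vgeD bs).
  by rewrite opprD addrACA; apply: (vgeD bs).
move=> s _; set e : L := (-1) ^+ _; have he : vg 0 e.
  by apply: (vgeX bs); rewrite (vgeN bs) (vge1 bs).
have [h1 h2 h3] : K (\prod_(i < d) A i (s i)) (\prod_(i < d) B i (s i)).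
  apply: (big_ind2 K); first by rewrite /K subrr (vge1 bs) vge0.
    move=> x1 x2 y1 y2 [h1 h2 h3] [h4 h5 h6]; split; try exact: (vgeMl bs).
    have -> : x1 * y1 - x2 * y2 = (x1 - x2) * y1 + x2 * (y1 - y2) by ring.
    by apply: (vgeD bs); [apply: (vgeMr bs) | apply: (vgeMl bs)].
  by move=> i _; split=> //; have := hAB i (s i); rewrite !mxE.
by split; rewrite -?mulrBr; apply: (vgeMl bs).
Qed.

Lemma det_int d (A : 'M[L]_d) : mge 0 A -> vg 0 (\det A).
Proof.
move=> hA; have [] // := @det_mod d A A 0 (lexx 0) hA hA.
by rewrite subrr => i j; rewrite mxE vge0.
Qed.

Lemma GLO_mod d (A B : 'M[L]_d) : mge 0 A -> GLO B -> mge 1 (A - B) -> GLO A.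
Proof.
move=> hA [hB [dB vB]] hAB; split=> //.
have [h1 h2 h3] := @det_mod d A B 1 isT hA hB hAB.
apply: (v_unitP h1); apply/negP => h4.
have [_] := vge1_unit dB vB; rewrite -[\det B](subKr (\det A)).
by rewrite (vgeB bs).
Qed.

Lemma GLO_unit d (A : 'M[L]_d) : GLO A -> A \in unitmx.
Proof. by case=> _ [dA _]; rewrite unitmxE unitfE. Qed.

Lemma GLO_inv d (A : 'M[L]_d) : GLO A -> mge 0 (invmx A).
Proof.
move=> hA i j; rewrite /invmx (GLO_unit hA) !mxE; case: hA => hA [dA vA].
apply: (vgeMl bs); first exact: (vge0V bs).
rewrite /cofactor; apply: (vgeMl bs).
  by apply: (vgeX bs); rewrite (vgeN bs) (vge1 bs).
by apply: det_int => k l; rewrite !mxE.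
Qed.

Lemma GLO_invmx d (A : 'M[L]_d) : GLO A -> GLO (invmx A).
Proof.
move=> hA; split; first exact: GLO_inv.
by case: hA => _ [dA vA]; rewrite det_inv invr_eq0 (vV bs) // vA oppr0.
Qed.

Lemma GLO_mul d (A B : 'M[L]_d) : GLO A -> GLO B -> GLO (A *m B).
Proof.
move=> [hA [dA vA]] [hB [dB vB]]; split; first exact: mgeMl.
by rewrite det_mulmx mulf_neq0 // (vM bs) // vA vB.
Qed.

Lemma GLO1 d : GLO (1%:M : 'M[L]_d).
Proof. by split; [exact: mge_scalar | rewrite det1 oner_neq0 (v1 bs)]. Qed.

Lemma GLO_Kmx d (A : 'M[L]_d) : GLO A <-> Kmx v A.
Proof.
split=> [hA|[uA [iA iV]]].
  split; first exact: GLO_unit.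
  by split=> i j; apply/intg_vge; [case: hA => hA _ | apply: GLO_inv].
have hA : mge 0 A by move=> i j; apply/intg_vge.
have hV : mge 0 (invmx A) by move=> i j; apply/intg_vge.
have dA : \det A != 0 by move: uA; rewrite unitmxE unitfE.
split=> //; split=> //; move: (det_int hA) (det_int hV).
rewrite det_inv /vge invr_eq0 (negbTE dA) /= (vV bs) // oppr_ge0 => h1 h2.
by apply/eqP; rewrite eq_le h1 h2.
Qed.

Lemma mge_block m1 m2 n1 n2 (N : int) (A : 'M[L]_(m1, n1)) (B : 'M[L]_(m1, n2))
    (C : 'M[L]_(m2, n1)) (D : 'M[L]_(m2, n2)) :
  mge N A -> mge N B -> mge N C -> mge N D -> mge N (block_mx A B C D).
Proof.
move=> hA hB hC hD i j.
by rewrite mxE; case: splitP => k _; rewrite mxE; case: splitP => l _.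
Qed.

Lemma mge0 m n (N : int) : mge N (0 : 'M[L]_(m, n)).
Proof. by move=> i j; rewrite mxE vge0. Qed.

End IntegralMatrices.

(** * Lang's theorem over the ring of integers *)

Lemma ex_min_nat (P : nat -> Prop) : (exists n, P n) ->
  exists2 n, P n & forall m, (m < n)%N -> ~ P m.
Proof.
case=> n; elim/ltn_ind: n => n IH Pn.
case: (classic (exists2 m, (m < n)%N & P m)) => [[m lmn Pm]|H]; first exact: IH lmn Pm.
by exists n => // m lmn Pm; apply: H; exists m.
Qed.

Lemma choose_fun (I T : Type) (R : I -> T -> Prop) :
  (forall i, exists t, R i t) -> exists g : I -> T, forall i, R i (g i).
Proof.
move=> H; exists (fun i => proj1_sig (constructive_indefinite_description _ (H i))) => i.
exact: (proj2_sig (constructive_indefinite_description _ (H i))).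
Qed.

Section Lang.
Variables (L : fieldType) (v : L -> int) (sigma : {rmorphism L -> L}).
Variables (p f : nat) (pi : L).
Hypothesis bs : breve_setting v sigma p f pi.
Local Notation vg := (vge v).
Local Notation mg := (mge v).
Local Notation GLO := (GLO v).

Variables (tau : {rmorphism L -> L}) (Q : nat).
Hypothesis Q1 : (1 < Q)%N.
Hypothesis tv : forall x, v (tau x) = v x.
Hypothesis tfrob : forall x, vg 0 x -> vg 1 (tau x - x ^+ Q).
Hypothesis tpi : tau pi = pi.

Lemma vge_tau N x : vg N (tau x) = vg N x.
Proof. by rewrite /vge tv fmorph_eq0. Qed.

Lemma vge_iter_tau k N x : vg N (iter k tau x) = vg N x.
Proof. by elim: k x => //= k IH x; rewrite vge_tau IH. Qed.

Lemma mge_tau m n N (A : 'M[L]_(m, n)) : mg N (map_mx tau A) <-> mg N A.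
Proof. by split=> h i j; have := h i j; rewrite mxE vge_tau. Qed.

Lemma GLO_tau d (A : 'M[L]_d) : GLO A -> GLO (map_mx tau A).
Proof.
by move=> [hA [dA vA]]; split; [apply/mge_tau | rewrite det_map_mx fmorph_eq0 tv].
Qed.

Lemma iter_tau_frob k x : vg 0 x -> vg 1 (iter k tau x - x ^+ (Q ^ k)).
Proof.
move=> hx; elim: k => [|k IH] /=; first by rewrite expr1 subrr vge0.
rewrite -(subrKA (iter k tau x ^+ Q)); apply: (vgeD bs).
  by apply: tfrob; rewrite vge_iter_tau.
rewrite expnSr exprM; apply: (vge_modX bs) => //; first by rewrite vge_iter_tau.
exact: (vgeX bs).
Qed.

(** Modulo [pi] this is the equation y^Q - y + w = 0. It corrects the unipotent part in [lang_mod]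
    and each further digit in [lang_step]. *)
Lemma artin_schreier_mod w : vg 0 w -> exists2 y, vg 0 y & vg 1 (tau y - y + w).
Proof.
move=> hw; pose P : {poly L} := 'X^Q + (w%:P - 'X).
have sr : (size (w%:P - 'X)%R < size ('X^Q : {poly L}))%N.
  rewrite size_polyXn; apply: leq_ltn_trans (size_polyD _ _) _.
  by rewrite size_polyN size_polyX size_polyC; case: (w == 0) => /=; lia.
have sP : size P = Q.+1 by rewrite size_polyDl // size_polyXn.
have [||i|y hy] := @root_mod _ _ _ _ _ _ bs P.
- by rewrite sP; lia.
- by rewrite monicE lead_coefDl // lead_coefXn.
- rewrite /P !coefD coefN coefXn coefC coefX.
  apply: (vgeD bs); last apply: (vgeB bs); last by case: eqP => _; rewrite ?(vge1 bs) ?vge0.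
    by case: eqP => _; rewrite ?(vge1 bs) ?vge0.
  by case: eqP => _ //; rewrite vge0.
rewrite /P !hornerE => hr; exists y => //.
have -> : tau y - y + w = (tau y - y ^+ Q) + (y ^+ Q + (w - y)) by ring.
by apply: (vgeD bs); [exact: tfrob | rewrite addrA].
Qed.

(* A nontrivial relation over [L], scaled to be primitive, whose last unit
   coefficient sits at index [e]. *)
Lemma dep_mod d (x : nat -> 'cV[L]_d) : (forall j, mg 0 (x j)) ->
  exists e (c : nat -> L), (forall j, vg 0 (c j)) /\ mg 1 (x e - \sum_(j < e) c j *: x j).
Proof.
move=> hx; pose M : 'M[L]_(d.+1, d) := \matrix_(i, j) x i j 0.
have [l l0 lM] : exists2 l : 'rV[L]_d.+1, l != 0 & l *m M = 0.
  have : kermx M != 0.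
    rewrite kermx_eq0 /row_free; apply/negP => /eqP rM.
    by have := rank_leq_col M; rewrite rM ltnn.
  by case/rowV0Pn => l /sub_kermxP lM l0; exists l.
have [j0 hj0] : exists j0, l 0 j0 != 0.
  by apply/rV0Pn.
pose a := [arg min_(j < j0 | l 0 j != 0) v (l 0 j)]%O.
have [ha hmin] : l 0 a != 0 /\ forall j, l 0 j != 0 -> v (l 0 a) <= v (l 0 j).
  by rewrite /a; case: arg_minP.
pose T := [pred j | (l 0 j != 0) && (v (l 0 j) == v (l 0 a))].
have Ta : T a by rewrite /= ha eqxx.
case: (@arg_maxnP _ a T (fun j => nat_of_ord j) Ta) => e /andP[le0 /eqP ve] emax.
have hle j : vg 0 (l 0 j / l 0 e).
  rewrite /vge mulf_eq0; have [//|lj0] := eqVneq (l 0 j) 0.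
  rewrite /= (vM bs) ?invr_eq0 // (vV bs) // ve.
  by have := hmin j lj0; rewrite -subr_ge0 => ->; rewrite orbT.
have hgt (j : 'I_d.+1) : (e < j)%N -> vg 1 (l 0 j / l 0 e).
  move=> ltej; rewrite /vge mulf_eq0; have [//|lj0] := eqVneq (l 0 j) 0.
  rewrite /= (vM bs) ?invr_eq0 // (vV bs) // ve.
  have /negP h : ~ T j by move/emax; rewrite /geq /= leqNgt ltej.
  move: h; rewrite /= lj0 /= => h; have h2 := hmin j lj0.
  have : v (l 0 a) < v (l 0 j) by rewrite lt_neqAle eq_sym h h2.
  by move: (v (l 0 a)) (v (l 0 j)) => A B; lia.
pose c j : L := - (l 0 (inord j) / l 0 e).
exists e, c; split.
  by move=> j; rewrite (vgeN bs).
have rel i : \sum_j (l 0 j / l 0 e) * x j i 0 = 0.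
  have := congr1 (fun A : 'rV_d => A 0 i) lM; rewrite !mxE => h.
  rewrite (eq_bigr (fun j => (l 0 e)^-1 * (l 0 j * M j i))) => [|j _]; last first.
    by rewrite mxE mulrCA mulrA.
  by rewrite -mulr_sumr h mulr0.
move=> i k; rewrite ord1 {k} !mxE summxE.
have := rel i; rewrite (bigID (fun j : 'I_d.+1 => (j < e)%N)) /=.
rewrite [X in _ + X](bigD1 e) ?ltnn //= divff // mul1r => h.
have -> : \sum_(j < e) (c j *: x j) i 0 =
   - \sum_(j < d.+1 | (j < e)%N) l 0 j / l 0 e * x j i 0.
  rewrite -sumrN (big_ord_widen_cond d.+1 xpredT (fun j => (c j *: x j) i 0)) /=; last first.
    by apply: ltnW.
  by apply: eq_bigr => j _; rewrite mxE /c inord_val mulNr.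
rewrite opprK; set S2 := (X in _ + (_ + X) = 0) in h.
have -> : x e i 0 + \sum_(j < d.+1 | (j < e)%N) l 0 j / l 0 e * x j i 0 = - S2.
  by apply/eqP; rewrite -addr_eq0 addrAC addrC addrA -addrA h.
rewrite (vgeN bs); apply: (vge_sum bs) => j /andP[h1 h2].
apply: (vgeMr bs); last exact: hx.
by apply: hgt; rewrite ltn_neqAle eq_sym (inj_eq val_inj) h2 leqNgt.
Qed.


(** Modulo [pi] the expression is an additive polynomial in [t], with linear term -t. Its degree is
    governed by the least index [J] at which [c] is a unit. Dividing by [t] leaves a non-constant
    polynomial with constant term -1, so its roots are units. *)
Lemma additive_root_mod (e : nat) (c : nat -> L) :
  (forall j, vg 0 (c j)) -> (exists2 j, (j <= e)%N & ~~ vg 1 (c j)) ->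
  exists t, [/\ vg 0 t, ~~ vg 1 t &
    vg 1 (\sum_(i < e.+1) iter (e - i) tau (c i) * iter (e - i).+1 tau t - t)].
Proof.
move=> hc exJ.
have exJ' : exists j, (j <= e)%N && ~~ vg 1 (c j).
  by case: exJ => j h1 h2; exists j; rewrite h1.
case: (ex_minnP exJ') => J /andP[Je cJ] Jmin {exJ exJ'}.
pose d i := iter (e - i) tau (c i).
have hd i : vg 0 (d i) by rewrite vge_iter_tau.
have [dJ0 vdJ] : d J != 0 /\ v (d J) = 0 by apply: v_unitP; rewrite // vge_iter_tau.
have hdV : vg 0 (d J)^-1 by apply: (vge0V bs).
pose k i := (Q ^ (e - i).+1).-1.
have k0 i : (0 < k i)%N.
  have : (Q ^ 1 <= Q ^ (e - i).+1)%N by rewrite leq_exp2l.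
  by rewrite /k expn1; lia.
have klt i : (J < i <= e)%N -> (k i < k J)%N.
  move=> hi; have : (Q ^ (e - i).+1 < Q ^ (e - J).+1)%N by rewrite ltn_exp2l //; lia.
  have : (0 < Q ^ (e - i).+1)%N by rewrite expn_gt0; lia.
  by rewrite /k; lia.
pose r : {poly L} := \sum_(i < e.+1 | (J < i)%N) (d i / d J) *: 'X^(k i) - (d J)^-1%:P.
pose R := 'X^(k J) + r.
have sr : (size r < size ('X^(k J) : {poly L}))%N.
  rewrite size_polyXn ltnS; apply: leq_trans (size_polyD _ _) _.
  rewrite geq_max size_polyN size_polyC; apply/andP; split; last first.
    by apply: leq_trans (leq_b1 _) (k0 J).
  apply: leq_trans (size_sum _ _ _) _; apply/bigmax_leqP => i hi.
  apply: leq_trans (size_scale_leq _ _) _; rewrite size_polyXn; apply: klt.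
  by rewrite hi -ltnS ltn_ord.
have [||i|t ht] := @root_mod _ _ _ _ _ _ bs R.
- by rewrite size_polyDl // size_polyXn ltnS.
- by rewrite monicE lead_coefDl // lead_coefXn.
- rewrite /R /r coefD coefXn coefB coef_sum coefC.
  apply: (vgeD bs); first by case: eqP => _; rewrite ?(vge1 bs) ?vge0.
  apply: (vgeB bs); last by case: eqP => _; rewrite ?vge0.
  apply: (vge_sum bs) => j _; rewrite coefZ coefXn; apply: (vgeMl bs).
    exact: (vgeMl bs).
  by case: eqP => _; rewrite ?(vge1 bs) ?vge0.
have -> : R.[t] = (d J)^-1 * (\sum_(i < e.+1 | (J <= i)%N) d i * t ^+ k i - 1).
  rewrite /R /r !hornerD hornerXn hornerN horner_sum hornerC mulrBr mulr1 addrA.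
  congr (_ - _); rewrite mulr_sumr [RHS](bigD1 (Ordinal (Je : (J < e.+1)%N))) //=.
  rewrite mulrA mulVf // mul1r; congr (_ + _); apply: eq_big => i.
    by rewrite -val_eqE /= ltn_neqAle eq_sym andbC.
  by rewrite hornerZ hornerXn mulrA [_^-1 * _]mulrC.
move=> hr; have hs : vg 1 (\sum_(i < e.+1 | (J <= i)%N) d i * t ^+ k i - 1).
  have := vgeMl bs (hd J) hr; rewrite mulrA divff // mul1r.
  by [].
exists t; split=> //.
  apply/negP => t1; have : vg 1 (1 : L); last by rewrite /vge oner_eq0 (v1 bs).
  rewrite -[X in vg _ X](subKr (\sum_(i < e.+1 | (J <= i)%N) d i * t ^+ k i)).
  apply: (vgeB bs) => //; apply: (vge_sum bs) => i _; apply: (vgeMl bs) => //.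
  by rewrite -(prednK (k0 i)) exprS; apply: (vgeMr bs) => //; apply: (vgeX bs).
have := vgeMr bs hs ht; rewrite mulrBl mul1r mulr_suml => h.
rewrite (bigID (fun i : 'I_e.+1 => (J <= i)%N)) /= addrAC.
apply: (vgeD bs); last first.
  apply: (vge_sum bs) => i; rewrite -ltnNge => iJ; apply: (vgeMr bs); last first.
    by rewrite -[tau _]/(iter (e - i).+1 tau t) vge_iter_tau.
  rewrite vge_iter_tau; apply/negPn/negP => ci.
  have hie : (i <= e)%N by rewrite -ltnS ltn_ord.
  by have := Jmin i; rewrite hie ci leqNgt iJ => /(_ isT).
rewrite -(subrKA (\sum_(i < e.+1 | (J <= i)%N) d i * t ^+ k i * t)).
apply: (vgeD bs) => //; rewrite -sumrB; apply: (vge_sum bs) => i _.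
rewrite -mulrA -mulrBr; apply: (vgeMl bs); first exact: hd.
rewrite -exprSr prednK ?expn_gt0; last by lia.
exact: (iter_tau_frob (e - i).+1 ht).
Qed.

Section FixedVector.
Variables (d : nat) (A : 'M[L]_d).
Hypothesis hA : GLO A.
Let psi (x : 'cV[L]_d) := A *m map_mx tau x.

(** On the span of the iterates of [x0] under [psi], the map acts modulo [pi] like a companion
    matrix. Eliminating all coordinates of a fixed vector but the last leaves the scalar equation of
    [additive_root_mod]. *)
Lemma fixed_vector_mod (x0 : 'cV[L]_d) : mg 0 x0 -> ~ mg 1 x0 ->
  exists z : 'cV[L]_d, [/\ mg 0 z, ~ mg 1 z & mg 1 (A *m map_mx tau z - z)].
Proof.
move=> hx0 nx0; pose x j := iter j psi x0.
have hx j : mg 0 (x j).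
  elim: j => //= j IH; apply: (mgeMl bs); first by case: hA.
  exact/mge_tau.
have [e [c [hc rel]] emin] := ex_min_nat (dep_mod hx).
case: e => [|e] in rel emin *.
  by case: nx0; move: rel; rewrite big_ord0 subr0.
(* Minimality of the index of the relation: no combination of the earlier iterates with a unit last
   coefficient vanishes modulo [pi]. *)
have nrel (a : nat -> L) : (forall j, vg 0 (a j)) -> ~~ vg 1 (a e) ->
    ~ mg 1 (\sum_(j < e.+1) a j *: x j).
  move=> ha ae; rewrite big_ord_recr /= => h; apply: (emin e (ltnSn e)).
  have [ae0 vae] := v_unitP (ha e) ae.
  exists (fun j => - (a j / a e)); split.
    by move=> j; rewrite (vgeN bs); apply: (vgeMl bs) => //; apply: (vge0V bs).
  have -> : x e - \sum_(j < e) - (a j / a e) *: x j =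
      (a e)^-1 *: (\sum_(j < e) a j *: x j + a e *: x e).
    rewrite scalerDr scalerA mulVf // scale1r addrC scaler_sumr -sumrN.
    by congr (_ + _); apply: eq_bigr => j _; rewrite scaleNr opprK scalerA mulrC.
  by rewrite -[1]add0r; apply: (mge_scale bs) => //; apply: (vge0V bs).
(* If all [c j] were in the maximal ideal, the iterate of index e + 1 would vanish modulo [pi];
   since [A] and [tau] are invertible modulo [pi] on their images, so would the one of index e. *)
have exu : exists2 j, (j <= e)%N & ~~ vg 1 (c j).
  apply: NNPP => H; have xe1 : mg 1 (x e.+1).
    rewrite -[x e.+1](subrK (\sum_(j < e.+1) c j *: x j)).
    apply: (mgeD bs) => // i k; rewrite summxE; apply: (vge_sum bs) => j _.
    rewrite mxE; apply: (vgeMr bs); last exact: hx.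
    apply/negPn/negP => cj; apply: H; exists j => //; rewrite -ltnS; exact: ltn_ord.
  have : mg 1 (map_mx tau (x e)).
    have -> : map_mx tau (x e) = invmx A *m x e.+1.
      by rewrite /= /psi mulKmx // (GLO_unit hA).
    by apply: (mgeMl bs) => //; apply: (GLO_inv bs).
  move/mge_tau => xe; apply: (emin e (ltnSn e)); exists (fun=> 0); split.
    by move=> j; apply: vge0.
  by rewrite big1 ?subr0 // => j _; rewrite scale0r.
have [t [ht nt tz]] := additive_root_mod hc exu.
(* Comparing coordinates in psi(z) = z forces this recursion once [t] stands for the last
   coordinate; closing it requires z e = t, which holds modulo [pi] by the choice of [t]. *)
pose fix z j := if j is j'.+1 then tau (z j') + c j * tau t else c 0%N * tau t.
have zE j : z j = \sum_(i < j.+1) iter (j - i) tau (c i) * iter (j - i).+1 tau t.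
  elim: j => [|j IH]; first by rewrite big_ord1.
  rewrite big_ord_recr /= subnn /= IH raddf_sum; congr (_ + _); apply: eq_bigr => i _.
  have ij : (i <= j)%N by rewrite -ltnS ltn_ord.
  by rewrite subSn //; exact: rmorphM.
have hz j : vg 0 (z j).
  elim: j => [|j IH] /=; first by apply: (vgeMl bs) => //; rewrite vge_tau.
  by apply: (vgeD bs); [rewrite vge_tau | apply: (vgeMl bs) => //; rewrite vge_tau].
have zet : vg 1 (z e - t) by rewrite zE.
have nze : ~~ vg 1 (z e).
  by apply: contra nt => h; rewrite -[t](subKr (z e)); apply: (vgeB bs).
exists (\sum_(j < e.+1) z j *: x j); split; last first.
- have -> : A *m map_mx tau (\sum_(j < e.+1) z j *: x j) - \sum_(j < e.+1) z j *: x j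
    = tau (z e) *: (x e.+1 - \sum_(j < e.+1) c j *: x j)
      + tau (z e - t) *: (\sum_(j < e.+1) c j *: x j).
    have zsum : \sum_(j < e.+1) z j *: x j =
        \sum_(j < e) tau (z j) *: x j.+1 + tau t *: \sum_(j < e.+1) c j *: x j.
      rewrite !big_ord_recl /= scalerDr scaler_sumr scalerA [tau t * _]mulrC.
      rewrite [RHS]addrCA -big_split /=; congr (_ + _); apply: eq_bigr => j _.
      by rewrite scalerDl scalerA [tau t * _]mulrC.
    rewrite {1}raddf_sum mulmx_sumr /= zsum.
    rewrite (eq_bigr (fun j : 'I_e.+1 => tau (z j) *: x j.+1)) => [|j _]; last first.
      by rewrite map_mxZ -scalemxAr.
    rewrite big_ord_recr /= rmorphB scalerBl scalerBr addrA subrK.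
    by rewrite opprD addrACA subrr add0r.
  apply: (mgeD bs).
    by rewrite -[1]add0r; apply: (mge_scale bs) => //; rewrite vge_tau.
  rewrite -[1]addr0; apply: (mge_scale bs); first by rewrite vge_tau.
  move=> i k; rewrite summxE; apply: (vge_sum bs) => j _; rewrite mxE.
  by apply: (vgeMl bs) => //; apply: hx.
- exact: nrel.
- move=> i k; rewrite summxE; apply: (vge_sum bs) => j _; rewrite mxE.
  by apply: (vgeMl bs) => //; apply: hx.
Qed.

End FixedVector.

(** A transposition brings a unit entry to the top; then replacing the first column of the identity
    keeps the determinant a unit. *)
Lemma primitive_completion d (z : 'cV[L]_(1 + d)) : mg 0 z -> ~ mg 1 z ->
  exists2 G : 'M[L]_(1 + d), GLO G & G *m delta_mx 0 0 = z.
Proof.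
move=> hz nz; have [i0 hi0] : exists i0, ~~ vg 1 (z i0 0).
  apply: NNPP => H; apply: nz => i j; rewrite ord1; apply/negPn/negP => h.
  by apply: H; exists i.
pose z' : 'cV[L]_(1 + d) := xrow 0 i0 z.
pose C : 'M[L]_(1 + d) := block_mx (usubmx z') 0 (dsubmx z') 1%:M.
have CE : C *m delta_mx 0 0 = z'.
  rewrite -colE; apply/matrixP => i j; rewrite ord1 mxE -[RHS](congr1 (fun A : 'cV_(1+d) => A i 0) (vsubmxK z')).
  rewrite /C block_mxEh mxE; case: splitP => k /=; last by [].
  by rewrite ord1 => _; congr (col_mx _ _ _ _); apply: val_inj.
exists (tperm_mx 0 i0 *m C); last first.
  rewrite -mulmxA CE -xrowE /z' /xrow -row_permM tperm2; apply/matrixP => i j.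
  by rewrite mxE perm1.
have hz' : mg 0 z' by move=> i j; rewrite mxE.
apply: (GLO_mul bs).
  split; last by rewrite det_perm; case: (odd_perm _);
    rewrite /= ?expr1 ?expr0 ?oppr_eq0 oner_neq0 ?(vN bs) (v1 bs).
  by move=> i j; rewrite !mxE; case: eqP => _; rewrite ?(vge1 bs) ?vge0.
split.
  by apply: mge_block; [| exact: mge0 | | exact: (mge_scalar bs)] => i j; rewrite mxE.
rewrite det_lblock det1 mulr1 det_mx11 !mxE.
rewrite (_ : lshift d 0 = 0); last exact: val_inj.
by rewrite tpermL; apply: v_unitP.
Qed.

(** A fixed vector used as first basis vector makes [A] block upper triangular modulo [pi].
    Induction treats the lower block, and the remaining top row satisfies Artin-Schreier equations
    entry by entry. *)
Lemma lang_mod d (A : 'M[L]_d) : GLO A ->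
  exists2 G : 'M[L]_d, GLO G & mg 1 (A *m map_mx tau G - G).
Proof.
elim: d A => [|d IH] A hA; first by exists 1%:M; [exact: (GLO1 bs)|case].
have [|hd|z [hz nz fz]] := @fixed_vector_mod d.+1 A hA (delta_mx 0 0).
- by move=> i j; rewrite mxE; case: andP => _; rewrite ?(vge1 bs) ?vge0.
- by have := hd 0 0; rewrite mxE /vge oner_eq0 (v1 bs).
have [G1 hG1 G1z] := @primitive_completion d z hz nz.
have uG1 := GLO_unit hG1.
have [A1 A1E] : {A1 : 'M[L]_(1 + d) | A1 = invmx G1 *m A *m map_mx tau G1} by eexists.
have hA1 : GLO A1.
  by rewrite A1E; apply: (GLO_mul bs); [apply: (GLO_mul bs) => //; apply: (GLO_invmx bs)|apply: GLO_tau].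
pose e0 : 'cV[L]_(1 + d) := delta_mx 0 0.
have A1c : mg 1 (A1 *m e0 - e0).
  have -> : A1 *m e0 - e0 = invmx G1 *m (A *m map_mx tau z - z).
    rewrite mulmxBr -{2}G1z mulKmx // A1E -!mulmxA; congr (_ *m (_ *m _) - _).
    by rewrite -G1z map_mxM; congr (_ *m _); apply/matrixP => i j; rewrite !mxE rmorph_nat.
  by apply: (mgeMl bs) => //; apply: (GLO_inv bs).
pose be := ursubmx A1; pose de := drsubmx A1.
(* [A1] with its first column replaced by the basis vector to which it is congruent: exactly block
   triangular, equal to [A1] modulo [pi]. *)
pose A2 : 'M[L]_(1 + d) := block_mx 1%:M be 0 de.
have hA2 : mg 0 A2.
  case: hA1 => hA1 _; apply: mge_block; [exact: (mge_scalar bs) | | exact: mge0 |];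
  by move=> i j; rewrite /be /de !mxE; apply: hA1.
have A1c' i : vg 1 (A1 i 0 - (i == 0)%:R).
  by have := A1c i 0; rewrite -colE !mxE andbT.
have hA12 : mg 1 (A1 - A2).
  rewrite -[A1]submxK opp_block_mx add_block_mx !subrr subr0.
  apply: mge_block; try exact: mge0.
    move=> i j; rewrite !ord1 !mxE eqxx; have := A1c' 0.
    by rewrite (_ : lshift d 0 = 0) //; apply: val_inj.
  move=> i j; rewrite !mxE ord1; have := A1c' (rshift 1 i).
  by rewrite (_ : lshift d 0 = 0) ?subr0 //; apply: val_inj.
have [hA2' hde] : GLO A2 /\ GLO de.
  have h2 : GLO A2.
    by apply: (GLO_mod bs hA2 hA1) => i j; have := hA12 i j; rewrite !mxE -opprB (vgeN bs).
  split=> //; case: h2 => _; rewrite det_ublock det1 mul1r => h2; split=> // i j.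
  by case: hA1 => hA1 _; rewrite /de !mxE; apply: hA1.
have [G' hG' fG'] := IH de hde.
pose w : 'rV[L]_d := be *m map_mx tau G'.
have hbe : mg 0 be by move=> i j; rewrite /be !mxE; case: hA1 => h _; apply: h.
have hw : mg 0 w by apply: (mgeMl bs) => //; apply/mge_tau; case: hG'.
have [y hy] : exists y : 'I_d -> L, forall j, vg 0 (y j) /\ vg 1 (tau (y j) - y j + w 0 j).
  apply: (choose_fun (R := fun j y => vg 0 y /\ vg 1 (tau y - y + w 0 j))) => j.
  by have [y] := artin_schreier_mod (hw 0 j); exists y.
pose Y : 'rV[L]_d := \row_j y j.
pose G2 : 'M[L]_(1 + d) := block_mx 1%:M Y 0 G'.
have hG2 : GLO G2.
  split; last by rewrite det_ublock det1 mul1r; case: hG'.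
  apply: mge_block; [exact: (mge_scalar bs) | | exact: mge0 | by case: hG'].
  by move=> i j; rewrite mxE; case: (hy j).
have fG2 : mg 1 (A1 *m map_mx tau G2 - G2).
  rewrite -[A1](subrK A2) mulmxDl -addrA; apply: (mgeD bs).
    by apply: (mgeMr bs) => //; apply/mge_tau; case: hG2.
  rewrite map_block_mx map_mx1 map_mx0 mulmx_block !mul1mx !mul0mx !mulmx0 !add0r !addr0.
  rewrite opp_block_mx add_block_mx !subrr.
  apply: mge_block => //; try exact: mge0.
  move=> i j; rewrite ord1 !mxE addrAC; case: (hy j) => _.
  by rewrite !mxE.
exists (G1 *m G2); first exact: (GLO_mul bs).
have -> : A *m map_mx tau (G1 *m G2) - G1 *m G2 = G1 *m (A1 *m map_mx tau G2 - G2).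
  by rewrite mulmxBr A1E !mulmxA mulmxV // mul1mx map_mxM !mulmxA.
by apply: (mgeMl bs) => //; case: hG1.
Qed.

(** Write the error as pi^N W and correct [G] by pi^N G0 Z. As [G0] is already a solution modulo
    [pi] and [tau] fixes [pi], the new error is governed by tau Z - Z + G0^-1 W, which can be made
    zero modulo [pi]. *)
Lemma lang_step d (A G0 : 'M[L]_d) (N : nat) (G : 'M[L]_d) :
  GLO A -> GLO G0 -> mg 1 (A *m map_mx tau G0 - G0) ->
  mg N%:Z (A *m map_mx tau G - G) ->
  exists2 G', mg N%:Z (G' - G) & mg N.+1%:Z (A *m map_mx tau G' - G').
Proof.
move=> hA hG0 fG0 fG.
pose W := pi ^ (- N%:Z) *: (A *m map_mx tau G - G).
have hW : mg 0 W.
  by rewrite -(addNr N%:Z); apply: (mge_scale bs) => //; rewrite /W (vge_piz bs).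
have [W' W'E] : {W' | W' = invmx G0 *m W} by eexists.
have hW' : mg 0 W' by rewrite W'E; apply: (mgeMl bs) => //; apply: (GLO_inv bs).
have [Z hZ] : exists Z : 'M[L]_d,
    forall i j, vg 0 (Z i j) /\ vg 1 (tau (Z i j) - Z i j + W' i j).
  have [Z hZ] : exists Z, forall ij, vg 0 (Z ij) /\ vg 1 (tau (Z ij) - Z ij + W' ij.1 ij.2).
    apply: (choose_fun (R := fun ij y => vg 0 y /\ vg 1 (tau y - y + W' ij.1 ij.2))) => -[i j].
    by have [y] := artin_schreier_mod (hW' i j); exists y.
  by exists (\matrix_(i, j) Z (i, j)) => i j; rewrite mxE; apply: (hZ (i, j)).
have Z0 : mg 0 Z by move=> i j; case: (hZ i j).
exists (G + pi ^ N%:Z *: (G0 *m Z)).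
  rewrite addrC addKr -[X in mge _ X _]addr0; apply: (mge_scale bs); first exact: (vge_piz bs).
  by apply: (mgeMl bs) => //; case: hG0.
have -> : A *m map_mx tau (G + pi ^ N%:Z *: (G0 *m Z)) - (G + pi ^ N%:Z *: (G0 *m Z)) =
   pi ^ N%:Z *: (G0 *m (map_mx tau Z - Z + W') + (A *m map_mx tau G0 - G0) *m map_mx tau Z).
  rewrite map_mxD map_mxZ map_mxM /= rmorphXz ?unitfE ?(pi_neq0 bs) //= tpi.
  have E1 : A *m map_mx tau G - G = pi ^ N%:Z *: (G0 *m W').
    rewrite W'E mulKVmx ?(GLO_unit hG0) // /W scalerA -expfzDr ?(pi_neq0 bs) //.
    by rewrite subrr expr0z scale1r.
  rewrite mulmxDr -scalemxAr opprD addrACA -scalerBr E1 -scalerDr; congr (_ *: _).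
  rewrite mulmxDr mulmxBr mulmxBl -mulmxA.
  move: (G0 *m W') (G0 *m Z) (G0 *m map_mx tau Z) (A *m (_ *m _)) => a b c e.
  by apply/matrixP => i j; rewrite !mxE; ring.
rewrite -addn1 PoszD; apply: (mge_scale bs); first exact: (vge_piz bs).
apply: (mgeD bs).
  apply: (mgeMl bs); first by case: hG0.
  by move=> i j; case: (hZ i j); rewrite !mxE.
by apply: (mgeMr bs) => //; apply/mge_tau.
Qed.

Theorem lang_integral d (A : 'M[L]_d) : GLO A ->
  exists2 G : 'M[L]_d, GLO G & A *m map_mx tau G = G.
Proof.
move=> hA; have [G0 hG0 fG0] := lang_mod hA.
(* Stage N carries precision N + 1, so that every stage, and the limit, stays congruent to [G0]
   modulo [pi] and hence invertible over O_L. *)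
pose T (N : nat) := {G : 'M[L]_d | mg N.+1%:Z (A *m map_mx tau G - G)}.
have step N (G : T N) : {G' : T N.+1 | mg N.+1%:Z (sval G' - sval G)}.
  case: G => G hG; apply: constructive_indefinite_description.
  by have [G' h1 h2] := lang_step hA hG0 fG0 hG; exists (exist _ G' h2).
pose fix u N : T N := if N is N'.+1 then sval (step N' (u N')) else exist _ G0 fG0.
have hu N : mg N.+1%:Z (sval (u N.+1) - sval (u N)) by exact: (svalP (step N (u N))).
have [G hG] : exists G : 'M[L]_d, forall k, mg k%:Z (sval (u k) - G).
  have [G hG] : exists G, forall ij k, vg k%:Z (sval (u k) ij.1 ij.2 - G ij).
    apply: (choose_fun (R := fun ij l => forall k, vg k%:Z (sval (u k) ij.1 ij.2 - l))) => -[i j].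
    apply: (complete_vge bs) => k.
    by have := hu k i j; rewrite !mxE; apply: vgeW; lia.
  by exists (\matrix_(i, j) G (i, j)) => k i j; rewrite !mxE; apply: (hG (i, j)).
have hA0 : mg 0 A by case: hA.
have h10 : mg 1 (sval (u 1%N) - G0) by exact: (hu 0%N).
have hG1 : mg 1 (G - G0).
  move=> i j; have := vgeB bs (h10 i j) (hG 1%N i j).
  by rewrite !mxE; congr (vg 1 _); ring.
exists G.
  apply: (GLO_mod bs _ hG0 hG1) => i j.
  have := vgeD bs (vgeW (ler01 : 0 <= 1 :> int) (hG1 i j)) ((proj1 hG0) i j).
  by rewrite !mxE subrK.
apply/eqP; rewrite -subr_eq0; apply/eqP/matrixP => i j; rewrite [RHS]mxE.
apply: (@vge_all _ v) => N; apply: (@vgeW _ v `|N|%N%:Z); first by lia.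
move: i j; change (mg `|N|%N (A *m map_mx tau G - G)).
have -> : A *m map_mx tau G - G = (A *m map_mx tau (sval (u `|N|%N)) - sval (u `|N|%N))
   - (A *m map_mx tau (sval (u `|N|%N) - G) - (sval (u `|N|%N) - G)).
  rewrite map_mxB mulmxBr; move: (A *m _) (A *m _) => X Y.
  by move: (sval _) => Z; apply/matrixP => i j; rewrite !mxE; ring.
apply: (mgeB bs).
  by case: (u _) => g hg /=; apply: mgeW hg; lia.
by apply: (mgeB bs) => //; apply: (mgeMl bs) => //; apply/mge_tau.
Qed.

End Lang.

Section LangSigma.
Variables (L : fieldType) (v : L -> int) (sigma : {rmorphism L -> L}).
Variables (p f : nat) (pi : L).
Hypothesis bs : breve_setting v sigma p f pi.

Theorem lang_iter d (A : 'M[L]_d) (s : nat) : (0 < s)%N -> GLO v A ->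
  exists2 G : 'M[L]_d, GLO v G & A *m map_mx (iter s sigma) G = G.
Proof.
move=> s0 hA; have [tau Ht] := iter_sigma_rmorph sigma s.
have vs := v_iter_sigma bs.
have [||||G hG fG] := @lang_integral L v sigma p f pi bs tau ((p ^ f) ^ s) _ _ _ _ d A hA.
- have p1 := prime_gt1 (p_prime bs); have f0 := f_gt0 bs.
  by rewrite -expnM -[1%N](expn0 p) ltn_exp2l // muln_gt0 f0.
- by move=> x; rewrite Ht.
- by move=> x hx; rewrite Ht; apply: (iter_sigma_frob bs).
- by rewrite Ht; elim: (s) => //= k ->; rewrite (sigma_pi bs).
exists G => //; rewrite -[RHS]fG; congr (_ *m _).
by apply/matrixP => i j; rewrite !mxE Ht.
Qed.

(** Lang's theorem in rank one for the matrix u^-1. It absorbs units into eigenvectors, into the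
    norm equation for two planes, and into the similitude factor. *)
Lemma lang_scalar (u : L) (s : nat) : (0 < s)%N -> u != 0 -> v u = 0 ->
  exists2 w, w != 0 & iter s sigma w = u * w.
Proof.
move=> s0 u0 vu; have [|G [_ [dG _]] fG] := @lang_iter 1 (u^-1)%:M s s0.
  split; last by rewrite det_scalar1 invr_eq0 u0 (vV bs) // vu.
  move=> i j; rewrite !mxE !ord1 eqxx mulr1n; exact: (vge0V bs).
exists (G 0 0); first by rewrite -det_mx11.
have := congr1 (fun A : 'M_1 => A 0 0) fG; rewrite mul_scalar_mx !mxE => h.
by rewrite -[in RHS]h mulrA divff // mul1r.
Qed.

End LangSigma.

(** * Isocrystals and slopes *)

Section Isocrystal.
Variables (L : fieldType) (v : L -> int) (sigma : {rmorphism L -> L}).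
Variables (p f : nat) (pi : L).
Hypothesis bs : breve_setting v sigma p f pi.

Definition den (lam : rat) : nat := `|denq lam|%N.

Lemma den_gt0 lam : (0 < den lam)%N.
Proof. by rewrite absz_gt0 denq_neq0. Qed.

Lemma ratE lam : lam * (den lam)%:R = (numq lam)%:~R.
Proof.
by rewrite -{1}[lam]divq_num_den /den pmulrn absz_denq divfK // intr_eq0 denq_neq0.
Qed.

Variables (vT : vectType L) (phi : vT -> vT).
Hypothesis phiD : forall x y, phi (x + y) = phi x + phi y.
Hypothesis phiZ : forall a x, phi (a *: x) = sigma a *: phi x.

Definition slopevec (lam : rat) (y : vT) : Prop :=
  iter (den lam) phi y = pi ^ numq lam *: y.

Definition orb (s : nat) (y : vT) : seq vT := mkseq (fun j => iter j phi y) s.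

Definition stable (W : {vspace vT}) : Prop := forall x, x \in W -> phi x \in W.

Lemma phi0 : phi 0 = 0.
Proof. by rewrite -[0 in LHS](scale0r (0 : vT)) phiZ rmorph0 scale0r. Qed.

Lemma phiN x : phi (- x) = - phi x.
Proof. by rewrite -!scaleN1r phiZ rmorphN1. Qed.

Lemma phiB x y : phi (x - y) = phi x - phi y.
Proof. by rewrite phiD phiN. Qed.

Lemma phi_sum (I : Type) (r : seq I) (P : pred I) (F : I -> vT) :
  phi (\sum_(i <- r | P i) F i) = \sum_(i <- r | P i) phi (F i).
Proof. exact: (big_morph phi phiD phi0). Qed.

Lemma iter_phiD n x y : iter n phi (x + y) = iter n phi x + iter n phi y.
Proof. by elim: n => //= n ->; rewrite phiD. Qed.

Lemma iter_phiZ n a x : iter n phi (a *: x) = iter n sigma a *: iter n phi x.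
Proof. by elim: n => //= n ->; rewrite phiZ. Qed.

Lemma iter_phi0 n : iter n phi 0 = 0.
Proof. by elim: n => //= n ->; rewrite phi0. Qed.

Lemma iter_phi_sum n (I : Type) (r : seq I) (P : pred I) (F : I -> vT) :
  iter n phi (\sum_(i <- r | P i) F i) = \sum_(i <- r | P i) iter n phi (F i).
Proof. exact: (big_morph (iter n phi) (iter_phiD n) (iter_phi0 n)). Qed.

Lemma iter_sigma_fix n a : sigma a = a -> iter n sigma a = a.
Proof. by move=> h; elim: n => //= n ->. Qed.

Lemma iter_phi_pi n (k : int) x : iter n phi (pi ^ k *: x) = pi ^ k *: iter n phi x.
Proof. by rewrite iter_phiZ iter_sigma_fix // (sigma_piz bs). Qed.

Lemma iter_phiC n m x : iter n phi (iter m phi x) = iter m phi (iter n phi x).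
Proof. by rewrite -!iterD addnC. Qed.

Lemma slopevec_iter lam y j : slopevec lam y -> slopevec lam (iter j phi y).
Proof. by rewrite /slopevec iter_phiC => ->; rewrite iter_phi_pi. Qed.

Lemma stable_iter W n x : stable W -> x \in W -> iter n phi x \in W.
Proof. by move=> hW hx; elim: n => //= n; apply: hW. Qed.

Lemma orb_spanP s y x :
  reflect (exists c : nat -> L, x = \sum_(j < s) c j *: iter j phi y)
          (x \in <<orb s y>>%VS).
Proof.
apply: (iffP idP) => [|[c ->]]; last first.
  apply: memv_suml => j _; apply/memvZ/memv_span.
  by apply: map_f; rewrite mem_iota ltn_ord.
elim: s x => [|s IH] x.
  by rewrite span_nil memv0 => /eqP->; exists (fun=> 0); rewrite big_ord0.
rewrite /orb mkseqS -cats1 span_cat span_seq1 => /memv_addP[x1 /IH[c ->] [x2]].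
case/vlineP=> a -> ->; exists (fun j => if (j < s)%N then c j else a).
rewrite big_ord_recr /= ltnn; congr (_ + _).
by apply: eq_bigr => j _; rewrite ltn_ord.
Qed.

Lemma mem_orb_iter s y j : (j < s)%N -> iter j phi y \in <<orb s y>>%VS.
Proof. by move=> js; apply/memv_span/map_f; rewrite mem_iota. Qed.

Lemma stable_orb lam y : slopevec lam y -> stable <<orb (den lam) y>>%VS.
Proof.
move=> hy x /orb_spanP[c ->]; rewrite phi_sum; apply: memv_suml => j _.
rewrite phiZ; apply: memvZ; rewrite -iterS.
have := ltn_ord j; rewrite leq_eqVlt => /orP[/eqP->|]; last exact: mem_orb_iter.
by rewrite hy; apply: memvZ; apply: (mem_orb_iter y (den_gt0 lam)).
Qed.

Lemma stableD W1 W2 : stable W1 -> stable W2 -> stable (W1 + W2)%VS.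
Proof.
move=> h1 h2 x /memv_addP[x1 hx1 [x2 hx2 ->]]; rewrite phiD.
by apply: memv_add; [apply: h1 | apply: h2].
Qed.

Lemma dim_add_line (U : {vspace vT}) x : x \notin U -> \dim (U + <[x]>) = (\dim U).+1.
Proof.
move=> xU; have x0 : x != 0 by apply: contra xU => /eqP->; rewrite mem0v.
rewrite dimv_disjoint_sum ?dim_vline ?x0 ?addn1 //.
apply/eqP; rewrite -subv0; apply/subvP => y /memv_capP[yU /vlineP[a ya]].
rewrite memv0; have [a0|a0] := eqVneq a 0; first by rewrite ya a0 scale0r.
by case/negP: xU; rewrite -[x](scalerK a0) -ya; apply: memvZ.
Qed.

Lemma det_sigma_norm e (C : 'M[L]_e) s : \det C != 0 ->
  \det (sigma_norm sigma s C) != 0 /\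
  v (\det (sigma_norm sigma s C)) = s%:Z * v (\det C).
Proof.
move=> dC; elim: s => [|s [IH1 IH2]] /=; first by rewrite det1 oner_neq0 (v1 bs) mul0r.
rewrite det_mulmx det_map_mx mulf_neq0 ?fmorph_eq0 // (vM bs) ?fmorph_eq0 //.
by rewrite (v_sigma bs) IH2; split=> //; rewrite -addn1 PoszD mulrDl mul1r addrC.
Qed.

(* An isocrystal generated by a vector of slope [r/s] in lowest terms has
   dimension divisible by [s]: compare valuations of determinants. *)
Lemma simple_dim (W : {vspace vT}) lam y : stable W -> slopevec lam y -> y \notin W ->
  \dim (W + <<orb (den lam) y>>) = (\dim W + den lam)%N.
Proof.
move=> hW hy yW; set s := den lam.
(* The least such [e] is the dimension of the subobject generated by [y] in the quotient by [W]; the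
   claim is that it equals [s]. *)
pose Pm e := iter e phi y \in (W + <<orb e y>>)%VS.
have Ps : Pm s.
  rewrite /Pm hy; apply/memvZ/(subvP (addvSr _ _)).
  exact: (mem_orb_iter y (den_gt0 lam)).
case: (ex_minnP (ex_intro _ s Ps)) => e Pe emin.
have es : (e <= s)%N by apply: emin.
have e0 : (0 < e)%N.
  case: (posnP e) Pe => // ->; rewrite /Pm /= span_nil addv0 => h.
  by rewrite h in yW.
have dimk k : (k <= e)%N -> \dim (W + <<orb k y>>) = (\dim W + k)%N.
  elim: k => [|k IH] ke; first by rewrite span_nil addv0 addn0.
  rewrite /orb mkseqS -cats1 span_cat span_seq1 addvA dim_add_line ?IH 1?ltnW ?addnS //.
  by apply/negP => /emin; rewrite leqNgt ke.
suff -> : s = e by apply: dimk.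
have indep k (a : nat -> L) : (k <= e)%N ->
    \sum_(j < k) a j *: iter j phi y \in W -> forall j, (j < k)%N -> a j = 0.
  elim: k a => // k IH a ke; rewrite big_ord_recr /= => h.
  have ak : a k = 0.
    apply/eqP/negPn/negP => ak; suff /emin : Pm k by rewrite leqNgt ke.
    apply/memv_addP; exists ((a k)^-1 *: (\sum_(j < k) a j *: iter j phi y + a k *: iter k phi y)).
      exact: memvZ.
    exists (- ((a k)^-1 *: \sum_(j < k) a j *: iter j phi y)).
      by rewrite memvN; apply/memvZ/orb_spanP; exists a.
    by rewrite scalerDr scalerA mulVf // scale1r addrAC subrr add0r.
  move: h; rewrite ak scale0r addr0 => h j; rewrite ltnS leq_eqVlt.
  by case/orP=> [/eqP->//|]; apply: IH => //; apply: ltnW.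
case/memv_addP: Pe => w hw [z /orb_spanP[c ->] Ec].
case: e e0 es dimk indep Ec {emin} => // e _ es _ indep Ec.
(* Companion matrix of [phi] on that quotient; [comb] turns coordinates into vectors, so all
   identities hold modulo [W]. *)
pose C : 'M[L]_e.+1 := \matrix_(i, j) if (j < e)%N then (i == j.+1 :> nat)%:R else c i.
pose comb (a : 'cV[L]_e.+1) := \sum_(j < e.+1) a j 0 *: iter j phi y.
have combD a b : comb (a + b) = comb a + comb b.
  by rewrite /comb -big_split; apply: eq_bigr => j _; rewrite mxE scalerDl.
have combZ k a : comb (k *: a) = k *: comb a.
  by rewrite /comb scaler_sumr; apply: eq_bigr => j _; rewrite mxE scalerA.
have combN a : comb (- a) = - comb a by rewrite -scaleN1r combZ scaleN1r.
have comb_delta (j : 'I_e.+1) : comb (delta_mx j 0) = iter j phi y.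
  rewrite /comb (bigD1 j) //= mxE !eqxx scale1r big1 ?addr0 // => k /negbTE kj.
  by rewrite mxE kj scale0r.
have combC (j : 'I_e.+1) : phi (iter j phi y) - comb (col j C) \in W.
  rewrite -iterS /comb; have [je|ej] := ltnP j e.
    rewrite (bigD1 (Ordinal (je : (j.+1 < e.+1)%N))) //= !mxE /= je eqxx scale1r.
    rewrite big1 ?addr0 ?subrr ?mem0v // => k kj; rewrite !mxE je.
    by case: eqP => [kE|]; rewrite ?scale0r //; case/eqP: kj; apply: val_inj.
  have -> : nat_of_ord j = e by have := ltn_ord j; lia.
  rewrite Ec; have -> : \sum_(i < e.+1) col j C i 0 *: iter i phi y =
      \sum_(i < e.+1) c i *: iter i phi y.
    by apply: eq_bigr => i _; rewrite !mxE ltnNge ej.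
  by rewrite addrK.
have phicomb a : phi (comb a) - comb (C *m map_mx sigma a) \in W.
  have -> : comb (C *m map_mx sigma a) = \sum_(j < e.+1) sigma (a j 0) *: comb (col j C).
    rewrite /comb; under [RHS]eq_bigr do rewrite scaler_sumr.
    rewrite exchange_big /=; apply: eq_bigr => i _.
    rewrite mxE scaler_suml; apply: eq_bigr => j _.
    by rewrite !mxE scalerA mulrC.
  rewrite /comb phi_sum -sumrB; apply: memv_suml => j _.
  by rewrite phiZ -scalerBr; apply: memvZ; apply: combC.
have itcomb n a : iter n phi (comb a) -
    comb (sigma_norm sigma n C *m map_mx (iter n sigma) a) \in W.
  elim: n => [|n IH] /=.
    rewrite mul1mx (_ : map_mx _ a = a) ?subrr ?mem0v //.
    by apply/matrixP => i j; rewrite mxE.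
  set X := sigma_norm sigma n C *m map_mx (iter n sigma) a in IH.
  rewrite -(subrKA (phi (comb X))); apply: memvD.
    by rewrite -phiB; apply: hW.
  rewrite (_ : C *m _ *m _ = C *m map_mx sigma X) //.
  rewrite /X map_mxM -mulmxA; congr (_ *m (_ *m _)).
  by apply/matrixP => i j; rewrite !mxE.
(* On the quotient phi^s is multiplication by pi^r. Valuations of determinants then give s v(det C)
   = r (e + 1), and coprimality of r and s makes s divide e + 1. *)
have NE : sigma_norm sigma s C = (pi ^ numq lam)%:M.
  apply/matrixP => i j; have := itcomb s (delta_mx j 0).
  rewrite comb_delta (slopevec_iter j hy) -comb_delta -combZ -combN -combD => h.
  have comb0 D : comb D \in W -> forall i, D i 0 = 0.
    move=> hD k; have := indep e.+1 (fun i => D (inord i) 0) (leqnn _) _ k (ltn_ord k).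
    rewrite inord_val; apply; rewrite (eq_bigr (fun j : 'I_e.+1 => D j 0 *: iter j phi y)) //.
    by move=> l _; rewrite inord_val.
  have := comb0 _ h i; rewrite (_ : map_mx _ (delta_mx j 0) = delta_mx j 0); last first.
    by apply/matrixP => k l; rewrite !mxE iter_sigma_fix // rmorph_nat.
  rewrite -colE !mxE andbT => /eqP; rewrite subr_eq0 => /eqP <-.
  by rewrite mulr_natr.
have dC : \det C != 0.
  have := congr1 determinant NE; rewrite det_scalar /s -(prednK (den_gt0 lam)) /=.
  rewrite det_mulmx => h; apply/eqP => dC0; move: h; rewrite dC0 mul0r => /esym/eqP.
  by rewrite expf_eq0 (negbTE (piz_neq0 bs _)) andbF.
have [_] := det_sigma_norm s dC; rewrite NE det_scalar (vX bs) ?(piz_neq0 bs) // (v_piz bs) => h.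
have : (s %| `|(numq lam * e.+1%:Z)%R|)%N.
  by rewrite h abszM dvdn_mulr.
rewrite abszM Gauss_dvdr; last by rewrite coprime_sym coprime_num_den.
by move=> /dvdn_leq; lia.
Qed.

(** Every vector of an orbit carries the slope of its generator, so one list records both a
    candidate basis and the slopes with multiplicity. *)
Definition orbits (C : seq (rat * vT)) : seq (rat * vT) :=
  flatten [seq [seq (c.1, x) | x <- orb (den c.1) c.2] | c <- C].

Lemma orbits_cat C1 C2 : orbits (C1 ++ C2) = orbits C1 ++ orbits C2.
Proof. by rewrite /orbits map_cat flatten_cat. Qed.

Lemma orbits1 lam y : unzip2 (orbits [:: (lam, y)]) = orb (den lam) y.
Proof. by rewrite /orbits /= cats0 /unzip2 -map_comp; apply: map_id. Qed.

Lemma slopevec_orbits C : (forall c, c \in C -> slopevec c.1 c.2) ->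
  forall c, c \in orbits C -> slopevec c.1 c.2.
Proof.
move=> hC c /flattenP[s /mapP[d dC ->]] /mapP[x /mapP[j _ ->] -> /=].
exact: slopevec_iter (hC d dC).
Qed.

Lemma span_orbits_cons lam y C :
  <<unzip2 (orbits ((lam, y) :: C))>>%VS = (<<orb (den lam) y>> + <<unzip2 (orbits C)>>)%VS.
Proof.
by rewrite -cat1s orbits_cat /unzip2 map_cat span_cat -/unzip2 orbits1.
Qed.

Lemma size_orbits_cons lam y C :
  size (orbits ((lam, y) :: C)) = (den lam + size (orbits C))%N.
Proof. by rewrite -cat1s orbits_cat size_cat /orbits /= cats0 size_map size_mkseq. Qed.

Lemma stable_orbits C : (forall c, c \in C -> slopevec c.1 c.2) ->
  stable <<unzip2 (orbits C)>>%VS.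
Proof.
elim: C => [|[lam y] C IH] hC.
  by move=> x; rewrite span_nil !memv0 => /eqP->; rewrite phi0.
rewrite span_orbits_cons; apply: stableD.
  by apply: stable_orb; apply: (hC (lam, y)); rewrite mem_head.
by apply: IH => c cC; apply: hC; rewrite inE cC orbT.
Qed.

(** The slope vectors span, phrased as what a greedy choice consumes: a new slope vector outside any
    proper subspace. *)
Definition slope_spanned : Prop := forall W : {vspace vT}, W != fullv ->
  exists2 c : rat * vT, slopevec c.1 c.2 & c.2 \notin W.

(** By [simple_dim], a slope vector outside the current stable span increases its dimension by
    exactly the length of its orbit, so independence persists until the space is exhausted. *)
Lemma slope_decomposition : slope_spanned ->
  exists C : seq (rat * vT), [/\ forall c, c \in C -> slopevec c.1 c.2,
    <<unzip2 (orbits C)>>%VS = fullv & size (orbits C) = \dim {:vT}].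
Proof.
move=> HS.
suff H n : exists C : seq (rat * vT), [/\ forall c, c \in C -> slopevec c.1 c.2,
    \dim <<unzip2 (orbits C)>> = size (orbits C) &
    (n <= size (orbits C))%N \/ <<unzip2 (orbits C)>>%VS = fullv].
  have [C [h1 h2 h3]] := H (\dim {:vT}); exists C; split=> //.
    case: h3 => // h3; apply/eqP; rewrite eqEdim subvf h2; exact: h3.
  case: h3 => h3; last by rewrite -h2 h3.
  by apply/eqP; rewrite eqn_leq h3 -h2 dimvS ?subvf.
elim: n => [|n [C [h1 h2 h3]]]; first by exists [::]; split=> //; [rewrite span_nil dimv0|left].
have [full|nfull] := eqVneq <<unzip2 (orbits C)>>%VS fullv.
  by exists C; split=> //; right.
case: h3 => [h3|h3]; last by rewrite h3 eqxx in nfull.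
have [[lam y] /= sy yW] := HS _ nfull.
exists ((lam, y) :: C); rewrite span_orbits_cons size_orbits_cons; split.
- by move=> c; rewrite inE => /orP[/eqP->//|]; apply: h1.
- by rewrite addvC simple_dim //; [rewrite h2 addnC|apply: stable_orbits].
- by left; have := den_gt0 lam; lia.
Qed.

End Isocrystal.

(** * The action of F[X] on an isocrystal *)

Section PolyAction.
Variables (L : fieldType) (v : L -> int) (sigma : {rmorphism L -> L}).
Variables (p f : nat) (pi : L).
Hypothesis bs : breve_setting v sigma p f pi.

Definition fixp (P : {poly L}) : Prop := map_poly sigma P = P.

Lemma fixpM P Q : fixp P -> fixp Q -> fixp (P * Q).
Proof. by rewrite /fixp rmorphM /= => -> ->. Qed.

Lemma fixp1 : fixp 1. Proof. exact: rmorph1. Qed.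

Lemma fixp_prod (I : Type) (r : seq I) (A : pred I) (P : I -> {poly L}) :
  (forall a, A a -> fixp (P a)) -> fixp (\prod_(a <- r | A a) P a).
Proof. by move=> h; apply: (big_ind fixp) => //; [exact: fixp1 | exact: fixpM]. Qed.

Lemma fixpXnsubC s a : sigma a = a -> fixp ('X^s - a%:P).
Proof. by move=> h; rewrite /fixp rmorphB /= map_polyXn map_polyC /= h. Qed.

Lemma fixp_coef P i : fixp P -> sigma P`_i = P`_i.
Proof. by move=> h; rewrite -[in RHS]h coef_map. Qed.

(** The extended Euclidean algorithm commutes with [sigma], so its output has coefficients in F; the
    constant gcd by which one divides is then in F too. *)
Lemma bezout_fixp P Q : fixp P -> fixp Q -> coprimep P Q ->
  exists U V, [/\ fixp U, fixp V & U * P + V * Q = 1].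
Proof.
move=> fP fQ cPQ; have := egcdp_map sigma P Q; rewrite fP fQ.
case: (egcdp P Q) (egcdpE P Q) => u w /= e [fu fw].
have : size (u * P + w * Q)%R == 1%N.
  by rewrite size_poly_eq1; apply: eqp_trans (_ : gcdp P Q %= 1); rewrite ?gcdp_eqp1 // eqp_sym.
case/size_poly1P => c c0 E.
have fc : sigma c = c.
  by apply/polyC_inj; rewrite -[LHS]map_polyC -E rmorphD !rmorphM /= -fu -fw fP fQ.
have fcV : fixp (c^-1)%:P by rewrite /fixp map_polyC /= fmorphV fc.
exists (c^-1%:P * u), (c^-1%:P * w); split; try by apply: fixpM; rewrite // /fixp.
by rewrite -!mulrA -mulrDr E -polyCM mulVf.
Qed.

(** The two polynomials divide X^(st) - a^t and X^(st) - b^s respectively, and these differ by a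
    non-zero constant. *)
Lemma coprimep_XnsubC (s t : nat) (a b : L) : a ^+ t != b ^+ s ->
  coprimep ('X^s - a%:P) ('X^t - b%:P).
Proof.
move=> h; apply/Bezout_coprimepP.
exists (\sum_(i < t) ('X^s) ^+ (t.-1 - i) * a%:P ^+ i,
        - \sum_(i < s) ('X^t) ^+ (s.-1 - i) * b%:P ^+ i) => /=.
rewrite mulNr ![_ * (_ - _)]mulrC -!subrXX -!exprM (mulnC t s).
rewrite -!rmorphXn /= opprB [X in X %= _](_ : _ = (b ^+ s - a ^+ t)%:P); last first.
  by rewrite rmorphB /=; ring.
by rewrite -size_poly_eq1 size_polyC subr_eq0 [b ^+ s == _]eq_sym (negbTE h).
Qed.

Variables (vT : vectType L) (phi : vT -> vT).
Hypothesis phiD : forall x y, phi (x + y) = phi x + phi y.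
Hypothesis phiZ : forall a x, phi (a *: x) = sigma a *: phi x.

Definition pact (P : {poly L}) (x : vT) : vT := \sum_(i < size P) P`_i *: iter i phi x.

Lemma pact_bound n (P : {poly L}) (x : vT) : (size P <= n)%N -> pact P x = \sum_(i < n) P`_i *: iter i phi x.
Proof.
move=> h; rewrite /pact (big_ord_widen n (fun i => P`_i *: iter i phi x) h).
rewrite [RHS](bigID (fun i : 'I_n => (i < size P)%N)) /= [X in _ + X]big1 ?addr0 //.
by move=> i; rewrite -leqNgt => hi; rewrite nth_default // scale0r.
Qed.

Lemma pactD P Q x : pact (P + Q) x = pact P x + pact Q x.
Proof.
pose n := maxn (size P) (size Q).
rewrite (@pact_bound n) ?(@pact_bound n P) ?(@pact_bound n Q) ?leq_maxl ?leq_maxr //.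
  by rewrite -big_split; apply: eq_bigr => i _; rewrite coefD scalerDl.
exact: size_polyD.
Qed.

Lemma pactZ c P x : pact (c *: P) x = c *: pact P x.
Proof.
rewrite (@pact_bound (size P)) ?size_scale_leq // scaler_sumr.
by apply: eq_bigr => i _; rewrite coefZ scalerA.
Qed.

Lemma pact0 x : pact 0 x = 0.
Proof. by rewrite /pact size_poly0 big_ord0. Qed.

Lemma pact_sum (I : Type) (r : seq I) (A : pred I) (P : I -> {poly L}) x :
  pact (\sum_(a <- r | A a) P a) x = \sum_(a <- r | A a) pact (P a) x.
Proof. exact: (big_morph (pact^~ x) (fun P Q => pactD P Q x) (pact0 x)). Qed.

Lemma pactC c x : pact c%:P x = c *: x.
Proof. by rewrite (@pact_bound 1) ?size_polyC_leq1 // big_ord1 coefC. Qed.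

Lemma pact1 x : pact 1 x = x.
Proof. by rewrite -[1]/(1%:P) pactC scale1r. Qed.

Lemma pactMX P x : pact (P * 'X) x = pact P (phi x).
Proof.
rewrite (@pact_bound (size P).+1) ?size_polyMXn_le //; last first.
  by have [->|P0] := eqVneq P 0; rewrite ?mul0r ?size_poly0 // size_mulX.
rewrite big_ord_recl coefMX scale0r add0r; apply: eq_bigr => i _.
by rewrite coefMX /= -iterSr.
Qed.

Lemma pactXM P x : fixp P -> pact ('X * P) x = phi (pact P x).
Proof.
move=> fP; rewrite -commr_polyX pactMX /pact (phi_sum phiD phiZ); apply: eq_bigr => i _.
by rewrite phiZ fixp_coef // -iterSr.
Qed.

(** Multiplying [Q] by X means applying [phi] after [Q], and [phi] passes the coefficients of [Q]
    because [sigma] fixes them. *)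
Lemma pactM P Q x : fixp Q -> pact (P * Q) x = pact P (pact Q x).
Proof.
elim/poly_ind: P Q => [|P c IH] Q fQ; first by rewrite mul0r !pact0.
rewrite mulrDl -mulrA pactD IH; last by apply: fixpM => //; rewrite /fixp map_polyX.
by rewrite pactXM // mul_polyC pactZ pactD pactMX pactC.
Qed.

Lemma pactDr P x y : pact P (x + y) = pact P x + pact P y.
Proof.
by rewrite /pact -big_split; apply: eq_bigr => i _; rewrite (iter_phiD phiD) scalerDr.
Qed.

Lemma pact0r P : pact P 0 = 0.
Proof. by rewrite /pact big1 // => i _; rewrite (iter_phi0 phiZ) scaler0. Qed.

Lemma pact_sumr P (I : Type) (r : seq I) (A : pred I) (x : I -> vT) :
  pact P (\sum_(a <- r | A a) x a) = \sum_(a <- r | A a) pact P (x a).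
Proof. exact: (big_morph (pact P) (pactDr P) (pact0r P)). Qed.

Lemma pactXn n x : pact 'X^n x = iter n phi x.
Proof.
elim: n x => [|n IH] x; first by rewrite expr0 pact1.
by rewrite exprSr pactMX IH -iterSr.
Qed.

Lemma pact_XnsubC s a x : iter s phi x = a *: x <-> pact ('X^s - a%:P) x = 0.
Proof.
rewrite pactD -polyCN pactC pactXn scaleNr; split=> [->|/eqP]; first by rewrite subrr.
by rewrite subr_eq0 => /eqP.
Qed.

End PolyAction.

(** * Primary decomposition for coprime annihilators *)

Section PartialFractions.
Variables (L : fieldType) (sigma : {rmorphism L -> L}).
Local Notation fixp := (fixp sigma).

(** The summand with [U0] starts the induction at the empty list, where the identity reads 1 = 1; it
    dies on any vector killed by the full product. *)
Lemma partial_fractions_seq (I : eqType) (r : seq I) (P : I -> {poly L}) : uniq r ->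
  (forall a, fixp (P a)) ->
  (forall a b, a \in r -> b \in r -> a != b -> coprimep (P a) (P b)) ->
  exists (U : I -> {poly L}) U0, [/\ forall a, fixp (U a), fixp U0 &
    \sum_(a <- r) U a * \prod_(b <- r | b != a) P b + U0 * \prod_(b <- r) P b = 1].
Proof.
move=> + fP; elim: r => [|c r IH] /= ur cop.
  exists (fun=> 0), 1; split; [by move=> a; apply: rmorph0|exact: fixp1|].
  by rewrite !big_nil mulr1 add0r.
case/andP: ur => cr ur; have [|U [U0 [fU fU0 E]]] := IH ur.
  by move=> a b ha hb; apply: cop; rewrite inE ?ha ?hb orbT.
have cc : coprimep (P c) (\prod_(b <- r) P b).
  rewrite big_seq; apply: (big_ind (fun Q => coprimep (P c) Q)); first exact: coprimep1.
    by move=> x y hx hy; rewrite coprimepMr hx.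
  move=> b hb; apply: cop; rewrite ?inE ?eqxx ?hb ?orbT //.
  by apply: contraNneq cr => ->.
have [al [be [fal fbe E2]]] :=
  bezout_fixp (fP c) (fixp_prod r (fun b (_ : xpredT b) => fP b)) cc.
exists (fun a => if a == c then be else al * U a), (U0 * al); split.
- by move=> a; case: ifP => // _; apply: fixpM.
- exact: fixpM.
rewrite !big_cons eqxx /=; have -> : \prod_(b <- r | b != c) P b = \prod_(b <- r) P b.
  rewrite big_seq_cond [RHS]big_seq; apply: eq_bigl => b.
  by case hb: (b \in r) => //=; apply: contraNneq cr => <-.
have -> : \sum_(a <- r) (if a == c then be else al * U a) * \prod_(b <- c :: r | b != a) P b
    = al * P c * \sum_(a <- r) U a * \prod_(b <- r | b != a) P b.
  rewrite mulr_sumr big_seq [RHS]big_seq; apply: eq_bigr => a ha.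
  have ca : (c != a) by apply: contraNneq cr => ->.
  by rewrite eq_sym (negbTE ca) big_cons ca; ring.
move: E; set S := \sum_(a <- r) _ => E; have -> : S = 1 - U0 * \prod_(b <- r) P b.
  by apply/eqP; rewrite eq_sym subr_eq E.
by rewrite -[RHS]E2; ring.
Qed.

Lemma partial_fractions (I : finType) (P : I -> {poly L}) :
  (forall a, fixp (P a)) -> (forall a b, a != b -> coprimep (P a) (P b)) ->
  exists (U : I -> {poly L}) U0, [/\ forall a, fixp (U a), fixp U0 &
    \sum_a U a * \prod_(b | b != a) P b + U0 * \prod_b P b = 1].
Proof.
move=> fP cop; apply: partial_fractions_seq => //; first exact: index_enum_uniq.
by move=> a b _ _; apply: cop.
Qed.

Variables (vT : vectType L) (phi : vT -> vT).
Hypothesis phiD : forall x y, phi (x + y) = phi x + phi y.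
Hypothesis phiZ : forall a x, phi (a *: x) = sigma a *: phi x.
Local Notation pact := (pact phi).

Lemma primary_decomposition (I : finType) (P : I -> {poly L}) (x : vT) :
  (forall a, fixp (P a)) -> (forall a b, a != b -> coprimep (P a) (P b)) ->
  pact (\prod_a P a) x = 0 ->
  exists Q : I -> {poly L}, [/\ forall a, fixp (Q a),
    forall a, pact (P a) (pact (Q a) x) = 0 & \sum_a pact (Q a) x = x].
Proof.
move=> fP cop hx; have [U [U0 [fU fU0 E]]] := partial_fractions fP cop.
have fR a : fixp (\prod_(b | b != a) P b) by apply: fixp_prod.
have fPr : fixp (\prod_b P b) by apply: fixp_prod.
exists (fun a => U a * \prod_(b | b != a) P b); split=> [a|a|]; first exact: fixpM.
  rewrite -(pactM phiD phiZ); last exact: fixpM.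
  have PE : P a * \prod_(b | b != a) P b = \prod_b P b by rewrite [RHS](bigD1 a).
  rewrite mulrCA PE (pactM phiD phiZ) // hx (pact0r phiZ) //.
have := congr1 (pact^~ x) E; rewrite /= pactD pact1 (pactM phiD phiZ _ _ fPr).
by rewrite hx (pact0r phiZ) addr0 pact_sum.
Qed.

(** The idempotents of the partial fraction identity recover each summand from the sum, which
    therefore generates everything the summands generate. *)
Lemma crt_component (I : finType) (P : I -> {poly L}) (x : I -> vT) :
  (forall a, fixp (P a)) -> (forall a b, a != b -> coprimep (P a) (P b)) ->
  (forall a, pact (P a) (x a) = 0) ->
  pact (\prod_a P a) (\sum_a x a) = 0 /\
  forall a, exists Q, x a = pact Q (\sum_b x b).
Proof.
move=> fP cop hx; have [U [U0 [fU fU0 E]]] := partial_fractions fP cop.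
have fR a : fixp (\prod_(b | b != a) P b) by apply: fixp_prod.
have fPr : fixp (\prod_b P b) by apply: fixp_prod.
have kill a b : a != b -> pact (\prod_(c | c != a) P c) (x b) = 0.
  move=> ab; rewrite (bigD1 b) 1?eq_sym //= mulrC (pactM phiD phiZ) // hx.
  exact: (pact0r phiZ).
have killP b : pact (\prod_c P c) (x b) = 0.
  by rewrite (bigD1 b) //= mulrC (pactM phiD phiZ) // hx (pact0r phiZ).
split; first by rewrite (pact_sumr phiD phiZ) big1.
move=> a; exists (U a * \prod_(b | b != a) P b).
have XE : pact (\prod_(b | b != a) P b) (\sum_b x b) = pact (\prod_(b | b != a) P b) (x a).
  rewrite (pact_sumr phiD phiZ) [LHS](bigD1 a) //= [X in _ + X]big1 ?addr0 // => b ba.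
  by rewrite kill // eq_sym.
rewrite (pactM phiD phiZ) // XE.
have := congr1 (pact^~ (x a)) E; rewrite /= pactD pact1 (pactM phiD phiZ _ _ fPr) killP.
rewrite (pact0r phiZ) addr0 pact_sum [X in X = _](bigD1 a) //= [X in _ + X]big1 ?addr0; last first.
  by move=> b ba; rewrite (pactM phiD phiZ) // kill // (pact0r phiZ).
by rewrite (pactM phiD phiZ) // => ->.
Qed.

Lemma stable_orb_pact m (P : {poly L}) X : P \is monic -> size P = m.+1 -> pact P X = 0 ->
  stable phi <<orb phi m X>>%VS.
Proof.
move=> mP sP hP; have lead : iter m phi X \in <<orb phi m X>>%VS.
  move: hP; rewrite /pact sP big_ord_recr /=.
  have -> : P`_m = 1 by move/monicP: mP; rewrite lead_coefE sP.
  rewrite scale1r => /eqP; rewrite addrC addr_eq0 => /eqP->; rewrite memvN.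
  by apply/orb_spanP; exists (fun j => P`_j).
move=> x /orb_spanP[c ->]; rewrite (phi_sum phiD phiZ); apply: memv_suml => j _.
rewrite phiZ; apply: memvZ; rewrite -iterS.
have := ltn_ord j; rewrite leq_eqVlt => /orP[/eqP->|] //; exact: mem_orb_iter.
Qed.

Lemma orb_pact m (P : {poly L}) X : P \is monic -> size P = m.+1 -> pact P X = 0 ->
  forall Q, pact Q X \in <<orb phi m X>>%VS.
Proof.
move=> mP sP hP Q; have st := stable_orb_pact mP sP hP.
apply: memv_suml => j _; apply: memvZ; apply: stable_iter => //.
(* For m = 0 the orbit list is empty; the polynomial is then 1 and the vector it kills is zero. *)
case: (posnP m) => [m0|m0]; last exact: (mem_orb_iter _ _ m0).
have P1 : P = 1.
  rewrite m0 in sP; move/monicP: mP; rewrite lead_coefE sP /= => P0.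
  by rewrite (size1_polyC (eq_leq sP)) P0.
by move: hP; rewrite P1 pact1 => ->; rewrite mem0v.
Qed.

End PartialFractions.

(** * Lower bounds for Newton polygons *)

Section GaussBound.
Variables (L : fieldType) (v : L -> int) (sigma : {rmorphism L -> L}).
Variables (p f : nat) (pi : L).
Hypothesis bs : breve_setting v sigma p f pi.

(* [C] is the Legendre transform [theta |-> \sum (theta - slope)^+] of the Newton
   polygon with [m] slopes and total height [V]. *)
Definition gauss_bound (m : nat) (P : {poly L}) (C : rat -> rat) (V : rat) : Prop :=
  [/\ P \is monic, size P = m.+1, P`_0 != 0 /\ (v P`_0)%:~R = V &
   forall theta (j : nat), P`_j != 0 -> (m%:R - j%:R) * theta - C theta <= (v P`_j)%:~R].

Lemma ultrametric_sum (I : Type) (r : seq I) (A : pred I) (F : I -> L) (rho : rat) :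
  (forall i, A i -> F i != 0 -> rho <= (v (F i))%:~R) ->
  \sum_(i <- r | A i) F i != 0 -> rho <= (v (\sum_(i <- r | A i) F i))%:~R.
Proof.
move=> h; apply: (big_ind (fun x => x != 0 -> rho <= (v x)%:~R)) => //.
  by rewrite eqxx.
move=> x y hx hy; have [->|x0] := eqVneq x 0; first by rewrite add0r.
have [->|y0] := eqVneq y 0; first by rewrite addr0.
move=> xy0; have [le|/ltW le] := leP (v x) (v y).
  have := vgeD bs (_ : vge v (v x) x) (_ : vge v (v x) y).
  rewrite /vge lexx le !orbT => /(_ isT isT); rewrite (negbTE xy0) /= => h2.
  by apply: le_trans (hx x0) _; rewrite ler_int.
have := vgeD bs (_ : vge v (v y) x) (_ : vge v (v y) y).
rewrite /vge lexx le !orbT => /(_ isT isT); rewrite (negbTE xy0) /= => h2.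
by apply: le_trans (hy y0) _; rewrite ler_int.
Qed.

(** For fixed theta the last clause bounds from below the Gauss valuation min_j (v(P_j) + j theta)
    by m theta - C(theta), and such bounds add up under multiplication. *)
Lemma gauss_boundM m1 P1 C1 V1 m2 P2 C2 V2 :
  gauss_bound m1 P1 C1 V1 -> gauss_bound m2 P2 C2 V2 ->
  gauss_bound (m1 + m2) (P1 * P2) (fun t => C1 t + C2 t) (V1 + V2).
Proof.
move=> [mo1 s1 [z1 w1] b1] [mo2 s2 [z2 w2] b2]; split.
- by rewrite monicMl.
- by rewrite size_monicM ?monic_neq0 // s1 s2 addSn addnS.
- by rewrite coef0M mulf_neq0 // (vM bs) // intrD w1 w2.
move=> t j; rewrite coefM; apply: ultrametric_sum => i _; rewrite mulf_eq0 negb_or.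
case/andP=> h1 h2; rewrite (vM bs) // intrD.
have := lerD (b1 t _ h1) (b2 t _ h2); apply: le_trans.
have ij : (i <= j)%N by rewrite -ltnS.
by rewrite natrD natrB //; lra.
Qed.

Lemma gauss_bound1 : gauss_bound 0 1 (fun=> 0) 0.
Proof.
split; [exact: monic1 | by rewrite size_poly1 | by rewrite coef1 oner_neq0 (v1 bs) |].
move=> t [|j]; rewrite coef1 ?eqxx //= (v1 bs) => _; lra.
Qed.

Lemma gauss_bound_prod (I : Type) (r : seq I) (m : I -> nat) (P : I -> {poly L})
    (C : I -> rat -> rat) (V : I -> rat) :
  (forall a, gauss_bound (m a) (P a) (C a) (V a)) ->
  gauss_bound (\sum_(a <- r) m a) (\prod_(a <- r) P a)
    (fun t => \sum_(a <- r) C a t) (\sum_(a <- r) V a).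
Proof.
move=> h; elim: r => [|a r IH].
  have [h1 h2 h3 h4] := gauss_bound1; rewrite /gauss_bound !big_nil; split=> //.
  by move=> t j; rewrite big_nil; apply: h4.
have [h1 h2 h3 h4] := gauss_boundM (h a) IH; rewrite /gauss_bound !big_cons; split=> //.
by move=> t j; rewrite big_cons; apply: h4.
Qed.

(** Only the coefficients of index 0 and [den lam] can be non-zero; they yield the two arguments of
    the maximum. *)
Lemma gauss_bound_XnsubC (lam : rat) (a : L) : a != 0 -> v a = numq lam ->
  gauss_bound (den lam) ('X^(den lam) - a%:P)
    (fun t => (den lam)%:R * Num.max 0 (t - lam)) ((den lam)%:R * lam).
Proof.
move=> a0 va; have s0 := den_gt0 lam; have rE := ratE lam.
have d0F : (0%N == den lam) = false by rewrite eq_sym; lia.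
have d0F' : (den lam == 0%N) = false by lia.
have sa : (size (- a%:P : {poly L}) < size ('X^(den lam) : {poly L}))%N.
  by rewrite size_polyXn size_polyN size_polyC a0.
split.
- by rewrite monicE lead_coefDl // lead_coefXn.
- by rewrite size_polyDl // size_polyXn.
- rewrite coefB coefXn coefC eqxx d0F sub0r oppr_eq0 a0 (vN bs) va.
  by rewrite -rE mulrC.
move=> t j; rewrite coefB coefXn coefC; have d0 : (0 : rat) < (den lam)%:R by rewrite ltr0n.
have [->|jd] := eqVneq j (den lam).
  rewrite d0F' subr0 (v1 bs) subrr mul0r sub0r => _.
  rewrite oppr_le0; apply: mulr_ge0; first exact: ltW.
  by rewrite le_max lexx.
rewrite sub0r; have [->|_] := eqVneq j 0%N; last by rewrite oppr0 eqxx.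
move=> _; rewrite subr0 (vN bs) va -rE -mulrBr [lam * _]mulrC ler_pM2l //.
have : t - lam <= Num.max 0 (t - lam) by rewrite le_max lexx orbT.
move: (Num.max _ _) => M; lra.
Qed.

End GaussBound.

(** * Eigenvalues twisted by units of F *)

Section Twist.
Variables (L : fieldType) (v : L -> int) (sigma : {rmorphism L -> L}).
Variables (p f : nat) (pi : L).
Hypothesis bs : breve_setting v sigma p f pi.
Local Notation u := (1 + p%:R : L).

(* [1 + p] is a unit of [L^sigma] which is not a root of unity. *)
Definition twc (b : bool) (e r : int) : L := (-1) ^+ b * u ^ e * pi ^ r.

Lemma twc_neq0 b e r : twc b e r != 0.
Proof.
have [u0 _] := p1_unit bs.
by rewrite /twc !mulf_neq0 ?signr_eq0 ?expfz_neq0 ?(pi_neq0 bs).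
Qed.

Lemma v_twc b e r : v (twc b e r) = r.
Proof.
have [u0 vu] := p1_unit bs; rewrite /twc.
rewrite (vM bs) ?mulf_neq0 ?signr_eq0 ?expfz_neq0 ?(pi_neq0 bs) // (v_piz bs).
rewrite (vM bs) ?signr_eq0 ?expfz_neq0 // (vXz bs) // vu mul0r addr0.
by case: b; rewrite /= ?expr0 ?expr1 ?(vN bs) (v1 bs) add0r.
Qed.

Lemma sigma_twc b e r : sigma (twc b e r) = twc b e r.
Proof.
have [u0 _] := p1_unit bs.
rewrite /twc !rmorphM /= rmorphXn rmorphN1 (sigma_piz bs) rmorphXz ?unitfE //=.
by rewrite rmorphD rmorph1 rmorph_nat.
Qed.

(** The valuation gives R = 0; squaring then removes the sign, and 1 + p is not a root of unity. *)
Lemma twc_eq1 (n : nat) (E R : int) : (-1) ^+ n * u ^ E * pi ^ R = 1 -> E = 0 /\ R = 0.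
Proof.
have [u0 vu] := p1_unit bs.
move=> h; have R0 : R = 0.
  have := congr1 v h; rewrite -signr_odd -/(twc (odd n) E R) v_twc (v1 bs).
  by [].
split=> //; apply/eqP/negPn/negP => E0; move: h; rewrite R0 expr0z mulr1 => h.
have /eqP : u ^ (E * 2) != 1 by apply: (p1X_neq1 bs); lia.
apply; rewrite -exprz_exp -exprnP -[u ^ E](mulKf (_ : (-1) ^+ n != 0)) ?signr_eq0 // h.
by rewrite mulr1 -exprVn -exprM mulnC exprM exprVn sqrrN expr1n invr1 expr1n.
Qed.

Lemma twcX b e r n : twc b e r ^+ n = (-1) ^+ (b * n) * u ^ (e * n%:Z) * pi ^ (r * n%:Z).
Proof. by rewrite /twc !exprMn -exprM !exprnP !exprz_exp. Qed.

Lemma slope_eq lam lam' :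
  numq lam * (den lam')%:Z = numq lam' * (den lam)%:Z -> lam = lam'.
Proof.
have s0 : (den lam)%:R != 0 :> rat by rewrite pnatr_eq0; have := den_gt0 lam; lia.
have s0' : (den lam')%:R != 0 :> rat by rewrite pnatr_eq0; have := den_gt0 lam'; lia.
move/(congr1 (fun z : int => z%:~R : rat)); rewrite !intrM -!ratE -!pmulrn => E.
apply/eqP; rewrite -subr_eq0; have /eqP : (lam - lam') * ((den lam)%:R * (den lam')%:R) = 0.
  by rewrite mulrBl mulrA E; ring.
by rewrite !mulf_eq0 (negbTE s0) (negbTE s0') !orbF.
Qed.

Lemma slope_sum lam lam' (c : int) :
  numq lam * (den lam')%:Z + numq lam' * (den lam)%:Z = c * ((den lam)%:Z * (den lam')%:Z) ->
  lam + lam' = c%:~R.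
Proof.
have s0 : (den lam)%:R != 0 :> rat by rewrite pnatr_eq0; have := den_gt0 lam; lia.
have s0' : (den lam')%:R != 0 :> rat by rewrite pnatr_eq0; have := den_gt0 lam'; lia.
move/(congr1 (fun z : int => z%:~R : rat)); rewrite intrD !intrM -!ratE -!pmulrn => E.
apply/eqP; rewrite -subr_eq0.
have /eqP : (lam + lam' - c%:~R) * ((den lam)%:R * (den lam')%:R) = 0.
  rewrite mulrBl -[X in _ - X]E; ring.
by rewrite !mulf_eq0 (negbTE s0) (negbTE s0') !orbF.
Qed.

Lemma den_intB (c : int) lam : den (c%:~R - lam) = den lam.
Proof.
have -> : c%:~R - lam = (c * denq lam - numq lam)%:~R / (denq lam)%:~R.
  rewrite intrB intrM mulrBl mulfK ?intr_eq0 ?denq_neq0 //.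
  by rewrite divq_num_den.
rewrite /den coprimeq_den ?(negbTE (denq_neq0 _)) //.
by rewrite -coprimezE /coprimez gcdzC gcdzMDl gcdzN gcdzC -/(coprimez _ _) coprimezE coprime_num_den.
Qed.

(** The hypothesis is the negation of what [coprimep_XnsubC] asks for, so distinct exponents make
    the annihilators coprime. *)
Lemma twc_inj b e lam b' e' lam' :
  twc b e (numq lam) ^+ den lam' = twc b' e' (numq lam') ^+ den lam ->
  lam = lam' /\ e = e'.
Proof.
move=> h; have s0 := den_gt0 lam; have s0' := den_gt0 lam'.
have [u0 _] := p1_unit bs; have E := congr1 v h.
rewrite !(vX bs) ?twc_neq0 // !v_twc in E.
have ll := slope_eq E; split=> //; move: h; rewrite -ll !twcX => h.
have [|E0 _] := @twc_eq1 (b * den lam + b' * den lam) (e * (den lam)%:Z - e' * (den lam)%:Z) 0.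
  have h2 : (-1) ^+ (b * den lam) * u ^ (e * (den lam)%:Z) =
            (-1) ^+ (b' * den lam) * u ^ (e' * (den lam)%:Z).
    exact: (mulIf (piz_neq0 bs (numq lam * (den lam)%:Z))).
  have yy := sqrr_sign L (b' * den lam).
  rewrite expr0z mulr1 exprD expfzDr // -invr_expz mulrACA h2 mulrACA -expr2 yy mul1r.
  by rewrite divff // expfz_neq0.
nia.
Qed.

(** The hypothesis is what a non-zero pairing between two eigenvectors imposes, when its value is
    fixed by [sigma]. *)
Lemma twc_dual (c : int) b e lam b' e' lam' :
  twc b e (numq lam) ^+ den lam' * twc b' e' (numq lam') ^+ den lam =
    pi ^ (c * ((den lam)%:Z * (den lam')%:Z)) ->
  lam + lam' = c%:~R /\ e * (den lam')%:Z + e' * (den lam)%:Z = 0.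
Proof.
have [u0 _] := p1_unit bs; move=> h; split.
  apply: slope_sum; have := congr1 v h.
  by rewrite (vM bs) ?expf_neq0 ?twc_neq0 // !(vX bs) ?twc_neq0 // !v_twc (v_piz bs).
move: h; rewrite !twcX => h.
have [|//] := @twc_eq1 (b * den lam' + b' * den lam)
  (e * (den lam')%:Z + e' * (den lam)%:Z)
  (numq lam * (den lam')%:Z + numq lam' * (den lam)%:Z - c * ((den lam)%:Z * (den lam')%:Z)).
rewrite exprD (expfzDr _ _ u0) !(expfzDr _ _ (pi_neq0 bs)).
rewrite -[RHS](divff (piz_neq0 bs (c * ((den lam)%:Z * (den lam')%:Z)))) -{1}h invr_expz; ring.
Qed.

(** Rescaling [y] by a solution of sigma^s(w) = u w changes the eigenvalue of phi^s by the unit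
    u. *)
Lemma twist_vec (vT : vectType L) (phi : vT -> vT)
    (phiZ : forall a x, phi (a *: x) = sigma a *: phi x) lam y b e :
  slopevec pi phi lam y ->
  exists2 w, w != 0 & iter (den lam) phi (w *: y) = twc b e (numq lam) *: (w *: y).
Proof.
move=> hy; have e0 := twc_neq0 b e 0; have ve := v_twc b e 0.
have [w w0 E] := lang_scalar bs (den_gt0 lam) e0 ve.
exists w => //; rewrite (iter_phiZ phiZ) E hy !scalerA /twc expr0z mulr1.
by rewrite mulrAC.
Qed.

End Twist.

(** * The Newton point *)

Section NewtonPoint.
Variables (L : fieldType) (v : L -> int) (sigma : {rmorphism L -> L}).
Variables (p f : nat) (pi : L).
Hypothesis bs : breve_setting v sigma p f pi.

Definition frob m (b : 'M[L]_m) (x : 'cV[L]_m) : 'cV[L]_m := b *m map_mx sigma x.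

Lemma frobD m (b : 'M[L]_m) x y : frob b (x + y) = frob b x + frob b y.
Proof. by rewrite /frob map_mxD mulmxDr. Qed.

Lemma frobZ m (b : 'M[L]_m) a x : frob b (a *: x) = sigma a *: frob b x.
Proof. by rewrite /frob map_mxZ scalemxAr. Qed.

Lemma iter_frob m (b : 'M[L]_m) n x :
  iter n (frob b) x = sigma_norm sigma n b *m map_mx (iter n sigma) x.
Proof.
elim: n => [|n IH] /=.
  by rewrite mul1mx; apply/matrixP => i j; rewrite mxE.
rewrite IH /frob map_mxM -mulmxA; congr (_ *m (_ *m _)).
by apply/matrixP => i j; rewrite !mxE.
Qed.

Lemma iter_frob_conj m (b P : 'M[L]_m) n x : P \in unitmx ->
  iter n (frob b) (P *m x) = P *m iter n (frob (invmx P *m b *m map_mx sigma P)) x.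
Proof.
move=> uP; elim: n => //= n ->; rewrite /frob map_mxM !mulmxA mulmxV // mul1mx.
by [].
Qed.

Variables (m : nat) (b : 'M[L]_m) (nu : 'I_m -> rat) (P b' : 'M[L]_m).
Hypothesis uP : P \in unitmx.
Hypothesis b'E : b' = invmx P *m b *m map_mx sigma P.
Hypothesis b'0 : forall i j, nu i != nu j -> b' i j = 0.
Hypothesis bK : forall i0 : 'I_m,
  Kmx v (\matrix_(i, j) if (nu i == nu i0) && (nu j == nu i0)
     then pi ^ (- numq (nu i0)) * sigma_norm sigma (absz (denq (nu i0))) b' i j
     else (i == j)%:R).

Let proj (lam : rat) : 'M[L]_m := diag_mx (\row_i (nu i == lam)%:R).

Lemma proj_mul lam n (x : 'M[L]_(m, n)) i j : (proj lam *m x) i j = (nu i == lam)%:R * x i j.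
Proof. by rewrite mul_diag_mx !mxE. Qed.

Lemma mul_proj lam n (x : 'M[L]_(n, m)) i j : (x *m proj lam) i j = x i j * (nu j == lam)%:R.
Proof. by rewrite mul_mx_diag !mxE. Qed.

Lemma sigma_norm_block n i j : nu i != nu j -> sigma_norm sigma n b' i j = 0.
Proof.
elim: n i j => [|n IH] i j ij /=.
  by rewrite mxE; case: eqP => // e; rewrite e eqxx in ij.
rewrite mxE big1 // => k _; rewrite mxE; have [ik|ik] := eqVneq (nu i) (nu k).
  by rewrite IH ?rmorph0 ?mulr0 // -ik.
by rewrite b'0 ?mul0r.
Qed.

Lemma frob_proj lam (x : 'cV[L]_m) : frob b' (proj lam *m x) = proj lam *m frob b' x.
Proof.
apply/matrixP => i j; rewrite proj_mul !mxE mulr_sumr; apply: eq_bigr => k _.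
rewrite ![map_mx _ _ _ _]mxE proj_mul rmorphM rmorph_nat; have [ik|ik] := eqVneq (nu i) (nu k).
  by rewrite ik mulrCA.
by rewrite b'0 // !mul0r mulr0.
Qed.

Lemma iter_frob_proj n lam (x : 'cV[L]_m) :
  iter n (frob b') (proj lam *m x) = proj lam *m iter n (frob b') x.
Proof. by elim: n => //= n ->; rewrite frob_proj. Qed.

(** Lang's theorem for the integral matrix attached to a slope class turns phi^s there into pi^r
    times sigma^s in the coordinates given by [G]. The second clause says that sigma^s in these
    coordinates respects the class. *)
Lemma lang_class (i0 : 'I_m) : exists2 G : 'M[L]_m, G \in unitmx &
  forall x : 'cV[L]_m, iter (den (nu i0)) (frob b') (proj (nu i0) *m (G *m x)) =
    pi ^ numq (nu i0) *: (proj (nu i0) *m (G *m map_mx (iter (den (nu i0)) sigma) x)) /\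
  (proj (nu i0) *m (G *m x) = G *m x ->
   proj (nu i0) *m (G *m map_mx (iter (den (nu i0)) sigma) x) =
     G *m map_mx (iter (den (nu i0)) sigma) x).
Proof.
have /(GLO_Kmx bs) hA := bK i0; set A := \matrix_(i, j) _ in hA.
have [G hG fG] := lang_iter bs (den_gt0 (nu i0)) hA.
exists G; first exact: GLO_unit hG.
have [tau Ht] := iter_sigma_rmorph sigma (den (nu i0)).
have mapE n (M : 'M[L]_(m, n)) : map_mx (iter (den (nu i0)) sigma) M = map_mx tau M.
  by apply/matrixP => i j; rewrite !mxE Ht.
rewrite mapE in fG; move=> x; rewrite mapE; split.
  rewrite iter_frob_proj iter_frob mapE map_mxM -{2}fG !mulmxA scalemxAl; congr (_ *m _).
  rewrite scalemxAl; congr (_ *m _).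
  apply/matrixP => i j; rewrite [RHS]mxE !proj_mul [A i j]mxE -/(den (nu i0)).
  case: (eqVneq (nu i) (nu i0)) => [ii|_]; last by rewrite !mul0r mulr0.
  rewrite !mul1r /=; case: (eqVneq (nu j) (nu i0)) => [jj|jj].
    by rewrite mulrA -expfzDr ?(pi_neq0 bs) // subrr expr0z mul1r.
  rewrite sigma_norm_block ?ii 1?eq_sym //; case: eqP => [e|]; last by rewrite mulr0.
  by move: jj; rewrite e ii eqxx.
have Gx : G *m map_mx tau x = A *m map_mx tau (G *m x) by rewrite map_mxM mulmxA fG.
rewrite Gx => hx; rewrite -[in RHS]hx [in RHS]map_mxM mulmxA [in RHS]mulmxA; congr (_ *m _).
apply/matrixP => i j; rewrite proj_mul.
have -> : map_mx tau (proj (nu i0)) = proj (nu i0).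
  by apply/matrixP => k l; rewrite !mxE rmorphMn /= rmorph_nat.
rewrite mul_proj [A i j]mxE.
case: (eqVneq (nu i) (nu i0)) => [ii|ii]; case: (eqVneq (nu j) (nu i0)) => [jj|jj];
  rewrite /= ?mul1r ?mulr1 ?mul0r ?mulr0 //; case: eqP => // e.
  by move: jj; rewrite -e ii eqxx.
by move: ii; rewrite e jj eqxx.
Qed.

(** Columns of [G] projected to their slope class are slope vectors, since the coordinate vectors
    are fixed by [sigma]; these projections span every class. *)
Lemma slope_spanned_newton : slope_spanned pi (frob b).
Proof.
move=> W nW; apply: NNPP => H; case/negP: nW; apply/eqP/vspaceP => x; rewrite memvf.
have HW lam y : slopevec pi (frob b) lam y -> y \in W.
  move=> hy; apply/negPn/negP => yW; apply: H; by exists (lam, y).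
have -> : x = \sum_i (invmx P *m x) i 0 *: (P *m delta_mx i 0).
  rewrite -{1}[x](mulKVmx uP); set y := invmx P *m x.
  rewrite {1}[y](matrix_sum_delta y) mulmx_sumr; apply: eq_bigr => i _.
  by rewrite big_ord1 scalemxAr.
apply: memv_suml => i _; apply: memvZ; have [G uG hG] := lang_class i.
have -> : delta_mx i 0 = proj (nu i) *m (G *m (invmx G *m (delta_mx i 0 : 'cV[L]_m))).
  rewrite mulKVmx //; apply/matrixP => k l; rewrite proj_mul !mxE.
  by case: (eqVneq k i) => [->|]; rewrite ?eqxx ?mul1r // mulr0.
set y := invmx G *m _; rewrite [y](matrix_sum_delta y) !mulmx_sumr.
apply: memv_suml => k _; rewrite big_ord1 -!scalemxAr; apply: memvZ.
apply: (HW (nu i)); rewrite /slopevec iter_frob_conj // -b'E (proj1 (hG _)) -scalemxAr.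
congr (_ *: (_ *m (_ *m (_ *m _)))); apply/matrixP => k' l; rewrite !mxE.
by rewrite iter_sigma_fix // rmorph_nat.
Qed.

(** Compute phi^(s s') on the projection of [z] to the class of [i] in two ways, by its own slope
    and by [lang_class]; the valuations of a non-zero coordinate give equal slopes. *)
Lemma slopevec_support lam (z : 'cV[L]_m) i : slopevec pi (frob b) lam z ->
  (invmx P *m z) i 0 != 0 -> nu i = lam.
Proof.
rewrite /slopevec => hz; set y := invmx P *m z => yi0.
have hy : iter (den lam) (frob b') y = pi ^ numq lam *: y.
  apply: (can_inj (mulKmx uP)); rewrite b'E -iter_frob_conj // -scalemxAr.
  by rewrite /y mulKVmx.
have [G uG hG] := lang_class i; set s' := den (nu i) in hG; set s := den lam in hy.
pose y' := proj (nu i) *m y.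
have [c y'E] : {c | y' = G *m c} by exists (invmx G *m y'); rewrite mulKVmx.
have py' : proj (nu i) *m y' = y'.
  apply/matrixP => k l; rewrite /y' !proj_mul mulrA -natrM mulnb andbb //.
have hy' n : iter (n * s) (frob b') y' = pi ^ (numq lam * n%:Z) *: y'.
  elim: n => [|n IH]; first by rewrite mul0n mulr0 expr0z scale1r.
  rewrite mulSn iterD IH (iter_phi_pi bs (@frobZ m b')) /y' iter_frob_proj hy -scalemxAr scalerA.
  by rewrite -expfzDr ?(pi_neq0 bs) //; congr (pi ^ _ *: _); lia.
have pG n : exists cn, [/\ iter (n * s') (frob b') y' = G *m cn,
    proj (nu i) *m (G *m cn) = G *m cn &
    cn = pi ^ (numq (nu i) * n%:Z) *: map_mx (iter (n * s') sigma) c].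
  elim: n => [|n [cn [IH pcn cnE]]].
    exists c; split; rewrite -?y'E //.
    by rewrite mul0n mulr0 expr0z scale1r; apply/matrixP => k l; rewrite [RHS]mxE.
  have [h1 h2] := hG cn; exists (pi ^ numq (nu i) *: map_mx (iter s' sigma) cn); split.
  - by rewrite mulSn iterD IH -pcn h1 -scalemxAr h2.
  - by rewrite -!scalemxAr h2.
  rewrite cnE; apply/matrixP => k l; rewrite !mxE.
  have [tau Ht] := iter_sigma_rmorph sigma s'.
  rewrite -Ht rmorphM !Ht iter_sigma_fix ?(sigma_piz bs) // mulrA -expfzDr ?(pi_neq0 bs) //.
  by rewrite mulSn iterD; congr (pi ^ _ * _); lia.
have [cn [E _ cnE]] := pG s; rewrite mulnC hy' y'E scalemxAr in E.
have {E} := can_inj (mulKmx uG) E; rewrite cnE => E.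
have [k ck] : exists k, c k 0 != 0.
  apply/existsP; rewrite -negb_forall; apply/negP => /forallP h.
  have c0 : c = 0 by apply/matrixP => k l; rewrite ord1 mxE; apply/eqP.
  have := congr1 (fun z : 'cV[L]_m => z i 0) y'E; rewrite c0 mulmx0 /y' proj_mul eqxx mul1r [RHS]mxE.
  by move=> h0; rewrite h0 eqxx in yi0.
have := congr1 (fun z : 'cV[L]_m => v (z k 0)) E; rewrite !mxE.
have vs := v_iter_sigma bs.
have s0 n x : x != 0 -> iter n sigma x != 0.
  by move=> x0; elim: n => //= n IH; rewrite fmorph_eq0.
rewrite !(vM bs) ?(piz_neq0 bs) ?s0 // vs !(v_piz bs) => /addIr h.
by apply/esym/slope_eq.
Qed.

(** Any basis of slope vectors has the Newton slopes, with multiplicity: the equality of multisets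
    is tested against an arbitrary function [F]. *)
Lemma slope_basis_sum (cs : seq (rat * 'cV[L]_m)) (F : rat -> rat) :
  (forall c, c \in cs -> slopevec pi (frob b) c.1 c.2) -> size cs = m ->
  <<unzip2 cs>>%VS = fullv -> \sum_(c <- cs) F c.1 = \sum_i F (nu i).
Proof.
move=> hc sc full; pose c0 : rat * 'cV[L]_m := (0, 0).
pose Y : 'M[L]_m := \matrix_(i, j) (nth c0 cs j).2 i 0.
have szu : size (unzip2 cs) == m by rewrite size_map sc.
have uY : Y \in unitmx.
  pose Z : 'M[L]_m := \matrix_(i, j) coord (Tuple szu) i (delta_mx j 0).
  suff /mulmx1_unit[] : Y *m Z = 1%:M by [].
  apply/matrixP => i j; rewrite !mxE.
  have := coord_span (_ : (delta_mx j 0 : 'cV[L]_m) \in <<Tuple szu>>%VS).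
  rewrite full memvf => /(_ isT)/(congr1 (fun z : 'cV[L]_m => z i 0)).
  rewrite mxE andbT summxE => ->; apply: eq_bigr => k _; rewrite !mxE mulrC.
  by congr (_ * _); rewrite (nth_map c0) ?sc.
pose M := invmx P *m Y.
have dM : \det M != 0 by rewrite -unitfE -unitmxE unitmx_mul unitmx_inv uP.
(* A non-zero Leibniz term of the base change is a bijection between the two bases, and by
   [slopevec_support] it preserves slopes. *)
have [s hs] : exists s : 'S_m, forall i, M i (s i) != 0.
  apply: NNPP => H; case/eqP: dM; apply: big1 => s _.
  suff -> : \prod_i M i (s i) = 0 by rewrite mulr0.
  apply/eqP/prodf_eq0; apply: NNPP => H2; apply: H; exists s => i.
  by apply/eqP => Mi; apply: H2; exists i => //; apply/eqP.
have nuE i : nu i = (nth c0 cs (s i)).1.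
  have si : (s i < size cs)%N by rewrite sc.
  apply: (slopevec_support (hc _ (mem_nth c0 si))).
  have := hs i; rewrite !mxE; congr (_ != 0); apply: eq_bigr => k _.
  by rewrite !mxE.
rewrite (big_nth c0) sc big_mkord (reindex_inj (@perm_inj _ s)) /=.
by apply: eq_bigr => i _; rewrite nuE.
Qed.

End NewtonPoint.

(** * The general linear group *)

Section CyclicConjugation.
Variables (L : fieldType) (v : L -> int) (sigma : {rmorphism L -> L}).
Variables (p f : nat) (pi : L).
Hypothesis bs : breve_setting v sigma p f pi.

Lemma dim_cV m : \dim {: 'cV[L]_m} = m.
Proof. by rewrite dimvf /dim /= muln1. Qed.

Definition orbmx m (b : 'M[L]_m) (x : 'cV[L]_m) : 'M[L]_m :=
  \matrix_(i, k) iter k (frob sigma b) x i 0.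

Lemma orbmx_unit m (b : 'M[L]_m) x :
  <<orb (frob sigma b) m x>>%VS = fullv -> orbmx b x \in unitmx.
Proof.
move=> full; pose c j := delta_mx j 0 : 'cV[L]_m.
have [a aE] : exists a : 'I_m -> nat -> L, forall j, c j = \sum_(k < m) a j k *: iter k (frob sigma b) x.
  apply: (choose_fun (R := fun j (a : nat -> L) => c j = \sum_(k < m) a k *: iter k (frob sigma b) x)) => j.
  by apply/orb_spanP; rewrite full memvf.
suff /mulmx1_unit[] : orbmx b x *m (\matrix_(k, j) a j k) = 1%:M by [].
apply/matrixP => i j; have := congr1 (fun z : 'cV[L]_m => z i 0) (aE j).
rewrite /c !mxE andbT summxE => ->; apply: eq_bigr => k _.
by rewrite !mxE mulrC.
Qed.

(** Both semilinear maps have the companion matrix of [P] in the bases formed by the orbits of their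
    cyclic vectors. *)
Lemma cyclic_conj m (b B : 'M[L]_m) (P : {poly L}) x e :
  P \is monic -> size P = m.+1 ->
  pact (frob sigma b) P x = 0 -> pact (frob sigma B) P e = 0 ->
  orbmx b x \in unitmx -> orbmx B e \in unitmx ->
  let g := orbmx b x *m invmx (orbmx B e) in
  g \in unitmx /\ invmx g *m b *m map_mx sigma g = B.
Proof.
move=> mP sP hx he ux ue g; have ug : g \in unitmx by rewrite unitmx_mul ux unitmx_inv.
split=> //; pose C : 'M[L]_m := \matrix_(i, k) if (k.+1 < m)%N then (i == k.+1 :> nat)%:R else - P`_i.
have key (b0 : 'M[L]_m) (z : 'cV[L]_m) : pact (frob sigma b0) P z = 0 ->
    b0 *m map_mx sigma (orbmx b0 z) = orbmx b0 z *m C.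
  move=> hz; apply/matrixP => i k.
  have -> : (b0 *m map_mx sigma (orbmx b0 z)) i k = iter k.+1 (frob sigma b0) z i 0.
    by rewrite /= /frob !mxE; apply: eq_bigr => l _; rewrite !mxE.
  rewrite [RHS]mxE; under [RHS]eq_bigr do rewrite [orbmx _ _ _ _]mxE [C _ _]mxE.
  have [km|km] := ltnP k.+1 m.
    rewrite [RHS](bigD1 (Ordinal km)) //= eqxx mulr1 big1 ?addr0 // => l hl.
    by case: eqP => [e1|]; rewrite ?mulr0 //; case/eqP: hl; apply: val_inj.
  have k1 : k.+1 = m by have := ltn_ord k; lia.
  rewrite k1; move: hz; rewrite /pact sP big_ord_recr /=.
  have -> : P`_m = 1 by move/monicP: mP; rewrite lead_coefE sP.
  rewrite scale1r => /eqP; rewrite addrC addr_eq0 => /eqP ->.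
  rewrite mxE summxE -sumrN; apply: eq_bigr => l _.
  by rewrite mxE mulrN mulrC.
have h : b *m map_mx sigma g = g *m B.
  have ue' : map_mx sigma (orbmx B e) \in unitmx by rewrite map_unitmx.
  apply: (can_inj (mulmxK ue')).
  rewrite -mulmxA -map_mxM /g mulmxKV // key // -!mulmxA key //.
  by rewrite (mulKmx ue).
by rewrite -mulmxA h mulKmx.
Qed.

(** At theta = nu_j the Legendre bound becomes the tail sum of [nu] from j on. Equality of totals
    turns the comparison of initial sums into the reverse one for tails. *)
Lemma newton_hodge_bound m (nu : 'I_m -> rat) (mu : 'I_m -> int) (P : {poly L}) (V : rat) :
  gauss_bound v m P (fun t => \sum_i Num.max 0 (t - nu i)) V ->
  dominant_rat nu -> dom_le nu mu ->
  forall j, (j < m)%N -> P`_j != 0 -> \sum_(i < m | (j <= i)%N) mu i <= v P`_j.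
Proof.
move=> [_ _ _ hb] dnu [dle tot] j jm Pj.
have := hb (nu (Ordinal jm)) j Pj; set t := nu _ => h.
rewrite -(ler_int rat); apply: le_trans h.
have E : \sum_i Num.max 0 (t - nu i) = (m%:R - j%:R) * t - \sum_(i < m | (j <= i)%N) nu i.
  rewrite (bigID (fun i : 'I_m => (j <= i)%N)) /= [X in _ + X]big1 ?addr0; last first.
    move=> i; rewrite -ltnNge => ij; apply/max_idPl; rewrite subr_le0.
    by apply: dnu; apply: ltnW.
  rewrite (eq_bigr (fun i => t - nu i)) => [|i ji]; last first.
    by apply/max_idPr; rewrite subr_ge0; apply: dnu.
  rewrite sumrB; congr (_ - _).
  rewrite -(big_geq_mkord j m xpredT (fun=> t)) sumr_const_nat -[LHS]mulr_natl.
  by rewrite natrB // ltnW.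
have split_sum (F : 'I_m -> rat) :
    \sum_i F i = \sum_(i < m | (j <= i)%N) F i + \sum_(i < m | (i < j)%N) F i.
  rewrite (bigID (fun i : 'I_m => (j <= i)%N)) /=; congr (_ + _).
  by apply: eq_bigl => i; rewrite -ltnNge.
rewrite E rmorph_sum /=; have := dle j (ltnW jm); move: tot; rewrite !split_sum; lra.
Qed.

Section GL.
Variables (m' : nat).
Let m := m'.+1.
Variables (mu : 'I_m -> int) (P : {poly L}).
Hypothesis mP : P \is monic.
Hypothesis sP : size P = m.+1.
Hypothesis bP : forall j, (j < m)%N -> P`_j != 0 -> \sum_(i < m | (j <= i)%N) mu i <= v P`_j.
Hypothesis P0 : P`_0 != 0.
Hypothesis vP0 : v P`_0 = \sum_i mu i.

Let S (k : nat) : int := \sum_(i < m | (i < k)%N) mu i.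

Definition gl_unit : 'M[L]_m := \matrix_(i, j)
  if (j < m')%N then (i == j.+1 :> nat)%:R else - (P`_i * pi ^ (S i - S m)).

Lemma partial_sum_total k : S m - S k = \sum_(i < m | (k <= i)%N) mu i.
Proof.
rewrite /S (eq_bigl xpredT) => [|i]; last by rewrite ltn_ord.
rewrite (bigID (fun i : 'I_m => (k <= i)%N)) /= -addrA [X in _ + X](_ : _ = 0) ?addr0 //.
by apply/eqP; rewrite subr_eq0; apply/eqP/eq_bigl => i; rewrite -ltnNge.
Qed.

Lemma partial_sum0 : S 0 = 0.
Proof. by rewrite /S big_pred0. Qed.

Lemma partial_sumS (j : 'I_m) : S j.+1 = S j + mu j.
Proof.
rewrite /S [LHS](bigD1 j) //= addrC; congr (_ + _).
by apply: eq_bigl => i; rewrite ltnS ltn_neqAle andbC.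
Qed.

(** Row 0 has its only non-zero entry in the last column, and the complementary minor is the
    identity; the determinant is thus plus or minus P_0 pi^(-|mu|), a unit by equality of totals. *)
Lemma gl_unit_GLO : GLO v gl_unit.
Proof.
split.
  move=> i j; rewrite mxE; case: ifP => _.
    by case: eqP => _; rewrite ?(vge1 bs) ?vge0.
  rewrite (vgeN bs) mulrC (vge_pizM bs) sub0r opprB partial_sum_total.
  by rewrite /vge; have [//|h] := eqVneq P`_i 0; rewrite bP.
rewrite (expand_det_row _ 0) (bigD1 ord_max) //= big1 ?addr0; last first.
  move=> i hi; rewrite mxE; have im : (i < m')%N.
    by rewrite ltn_neqAle -ltnS ltn_ord andbT; apply: contra hi => /eqP e; apply/eqP/val_inj.
  by rewrite im mul0r.
rewrite mxE ltnn /cofactor [X in \det X](_ : _ = 1%:M); last first.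
  apply/matrixP => i j; rewrite !mxE.
  by rewrite lift0 lift_max ltn_ord eqSS.
rewrite det1 mulr1 !mulf_neq0 ?oppr_eq0 ?signr_eq0 ?mulf_neq0 ?(piz_neq0 bs) //; split=> //.
rewrite (vM bs) ?oppr_eq0 ?signr_eq0 ?mulf_neq0 ?(piz_neq0 bs) // (vN bs).
rewrite (vM bs) ?(piz_neq0 bs) // (v_piz bs) partial_sum0 vP0 -signr_odd.
have -> : v ((-1) ^+ odd (0 + m')) = 0.
  by case: (odd _); rewrite ?expr0 ?expr1 ?(vN bs) (v1 bs).
rewrite addr0 sub0r; apply/eqP; rewrite subr_eq0; apply/eqP.
by have := partial_sum_total 0; rewrite partial_sum0 subr0.
Qed.

Let B := gl_unit *m pimx pi mu.

Lemma frob_gl_delta (j : 'I_m) : frob sigma B (delta_mx j 0) = pi ^ mu j *: col j gl_unit.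
Proof.
rewrite /frob map_delta_mx /B -colE; apply/matrixP => i k.
by rewrite mxE /pimx mul_mx_diag !mxE mulrC.
Qed.

Lemma iter_frob_gl (k : 'I_m) : iter k (frob sigma B) (delta_mx 0 0) = pi ^ S k *: delta_mx k 0.
Proof.
case: k => k; elim: k => [|k IH] km /=.
  by rewrite partial_sum0 expr0z scale1r; congr delta_mx; apply: val_inj.
have km' := ltnW km; rewrite (IH km') frobZ (sigma_piz bs) frob_gl_delta scalerA -expfzDr ?(pi_neq0 bs) //.
rewrite -(partial_sumS (Ordinal km')) /=; congr (_ *: _); apply/matrixP => i j.
by rewrite !mxE ord1 andbT -val_eqE /= -ltnS km.
Qed.

Lemma pact_gl : pact (frob sigma B) P (delta_mx 0 0) = 0.
Proof.
rewrite /pact sP big_ord_recr /=.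
have -> : P`_m = 1 by move/monicP: mP; rewrite lead_coefE sP.
rewrite scale1r (iter_frob_gl ord_max) frobZ (sigma_piz bs) frob_gl_delta scalerA -expfzDr ?(pi_neq0 bs) //.
rewrite -(partial_sumS ord_max) -/m.
rewrite (eq_bigr (fun k : 'I_m => (P`_k * pi ^ S k) *: delta_mx k 0)) => [|k _]; last first.
  by rewrite (iter_frob_gl k) scalerA.
apply/matrixP => i j; rewrite ord1 !mxE summxE (bigD1 i) //= !mxE !eqxx mulr1 big1 ?addr0.
  by rewrite ltnn mulrN mulrCA -expfzDr ?(pi_neq0 bs) //
    [_ + (_ - _)]addrC subrK subrr.
by move=> k ki; rewrite !mxE eq_sym (negbTE ki) mulr0.
Qed.

Lemma orbmx_gl_unit : orbmx B (delta_mx 0 0) \in unitmx.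
Proof.
have -> : orbmx B (delta_mx 0 0) = pimx pi (fun k : 'I_m => S k).
  apply/matrixP => i k; rewrite mxE (iter_frob_gl k) !mxE andbT.
  by rewrite mulr_natr; case: eqP => [->|]; rewrite ?mulr1n ?mulr0n.
rewrite unitmxE det_diag unitfE; apply/prodf_neq0 => k _.
by rewrite mxE (piz_neq0 bs).
Qed.

Lemma gl_cartan : in_cartan v pi (@inGL L m) B mu.
Proof.
exists gl_unit, 1%:M; split; first exact: GLO_unit gl_unit_GLO.
split; first exact/(GLO_Kmx bs)/gl_unit_GLO.
split; first by rewrite /inGL unitmx1.
by split; [apply/(GLO_Kmx bs)/(GLO1 bs) | rewrite mulmx1].
Qed.

End GL.

End CyclicConjugation.

(** * Existence of a cyclic vector *)

Section CyclicVector.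
Variables (L : fieldType) (v : L -> int) (sigma : {rmorphism L -> L}).
Variables (p f : nat) (pi : L).
Hypothesis bs : breve_setting v sigma p f pi.
Variables (vT : vectType L) (phi : vT -> vT).
Hypothesis phiD : forall x y, phi (x + y) = phi x + phi y.
Hypothesis phiZ : forall a x, phi (a *: x) = sigma a *: phi x.

Lemma sum_orbits (C : seq (rat * vT)) (F : rat -> rat) :
  \sum_(c <- orbits phi C) F c.1 = \sum_(c <- C) (den c.1)%:R * F c.1.
Proof.
rewrite /orbits big_flatten big_map; apply: eq_bigr => c _.
by rewrite big_map /= big_const_seq count_predT size_mkseq iter_addr addr0 mulr_natl.
Qed.

Lemma size_orbits (C : seq (rat * vT)) :
  size (orbits phi C) = (\sum_(c <- C) den c.1)%N.
Proof.
rewrite /orbits size_flatten sumnE big_map big_map; apply: eq_bigr => c _.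
by rewrite size_map size_mkseq.
Qed.

Lemma cyclic_vector : slope_spanned pi phi ->
  exists (C : seq (rat * vT)) P X,
  [/\ forall c, c \in C -> slopevec pi phi c.1 c.2,
      <<unzip2 (orbits phi C)>>%VS = fullv & size (orbits phi C) = \dim {:vT}] /\
  [/\ gauss_bound v (\dim {:vT}) P (fun t => \sum_(c <- orbits phi C) Num.max 0 (t - c.1))
        (\sum_(c <- orbits phi C) c.1),
      pact phi P X = 0 & <<orb phi (\dim {:vT}) X>>%VS = fullv].
Proof.
move=> HS; have [C [hC full sz]] := slope_decomposition bs phiD phiZ HS.
pose c (i : 'I_(size C)) := tnth (in_tuple C) i.
have hc i : slopevec pi phi (c i).1 (c i).2 by apply: hC; apply: mem_tnth.
(* The position in the list serves as exponent of 1 + p, which separates even generators of equal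
   slope. *)
pose a (i : 'I_(size C)) := twc p pi false i (numq (c i).1).
have [w hw] : exists w, forall i, w i != 0 /\
    iter (den (c i).1) phi (w i *: (c i).2) = a i *: (w i *: (c i).2).
  apply: (choose_fun (R := fun i w => w != 0 /\
    iter (den (c i).1) phi (w *: (c i).2) = a i *: (w *: (c i).2))) => i.
  by have [w] := twist_vec bs phiZ false i (hc i); exists w.
pose Pi i : {poly L} := 'X^(den (c i).1) - (a i)%:P.
have fPi i : fixp sigma (Pi i) by apply: fixpXnsubC; apply: (sigma_twc bs).
have copPi i j : i != j -> coprimep (Pi i) (Pi j).
  move=> ij; apply: coprimep_XnsubC; apply: contra ij => /eqP/(twc_inj bs)[_ e].
  by apply/eqP/val_inj; case: e.
have kPi i : pact phi (Pi i) (w i *: (c i).2) = 0.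
  by apply/pact_XnsubC; case: (hw i).
have [hP hX] := crt_component phiD phiZ fPi copPi kPi.
have sumE (F : rat -> rat) :
    \sum_(c0 <- orbits phi C) F c0.1 = \sum_(i < size C) (den (c i).1)%:R * F (c i).1.
  by rewrite sum_orbits big_tnth.
exists C, (\prod_i Pi i), (\sum_i w i *: (c i).2); split=> //; rewrite -sz.
have gb : gauss_bound v (size (orbits phi C)) (\prod_i Pi i)
   (fun t => \sum_(c <- orbits phi C) Num.max 0 (t - c.1)) (\sum_(c <- orbits phi C) c.1).
  have [h1 h2 h3 h4] := gauss_bound_prod bs (index_enum 'I_(size C))
    (fun i => gauss_bound_XnsubC bs (twc_neq0 bs false i (numq (c i).1)) (v_twc bs _ _ _)).
  have szE : size (orbits phi C) = (\sum_(i < size C) den (c i).1)%N.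
    by rewrite size_orbits big_tnth.
  split=> //; rewrite ?szE //; first by rewrite (sumE id).
  by move=> t j hj; rewrite (sumE (fun s => Num.max 0 (t - s))); apply: h4.
split=> //; set W := <<_>>%VS.
have [mP sP _ _] := gb; have pW := orb_pact phiD phiZ mP sP hP.
(* Each rescaled generator is a polynomial in [phi] applied to the sum, so its whole orbit lies in
   the stable span of the orbit of the sum. *)
apply/eqP; rewrite eqEsubv subvf -full; apply/span_subvP => x /mapP[y /flattenP[s]].
case/mapP=> c0 /(nthP (0, 0))[i iC <-] -> /mapP[z /mapP[k _ ->] ->] -> /=.
have -> : nth (0, 0) C i = c (Ordinal iC) by rewrite /c (tnth_nth (0, 0)).
have [Q E] := hX (Ordinal iC); have [w0 _] := hw (Ordinal iC).
have -> : iter k phi (c (Ordinal iC)).2 =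
    (iter k sigma (w (Ordinal iC)))^-1 *: pact phi 'X^k (w (Ordinal iC) *: (c (Ordinal iC)).2).
  rewrite pactXn (iter_phiZ phiZ) scalerK //.
  by elim: (k) => //= l IH; rewrite fmorph_eq0.
rewrite E; apply: memvZ; rewrite pactXn; apply: stable_iter; last exact: pW.
exact: (stable_orb_pact phiD phiZ mP sP hP).
Qed.

End CyclicVector.

Theorem hodge_newton_GL (L : fieldType) (v : L -> int) (sigma : {rmorphism L -> L})
    (p f : nat) (pi : L) (n : nat) (b : 'M[L]_n) (nu : 'I_n -> rat) (mu : 'I_n -> int) :
  breve_setting v sigma p f pi -> (0 < n)%N -> newton_point v sigma pi b nu ->
  dom_le nu mu ->
  exists g : 'M[L]_n, inGL g /\
    in_cartan v pi (@inGL L n) (invmx g *m b *m map_mx sigma g) mu.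
Proof.
move=> bs n0 [dnu [P0 [uP [b'0 bK]]]] dle.
case: n => // m' in b nu mu n0 dnu P0 uP b'0 bK dle *.
have HS := slope_spanned_newton bs uP erefl b'0 bK.
have [C [P [X [[hC full sz] [gb hX cX]]]]] :=
  cyclic_vector bs (frobD sigma b) (frobZ sigma b) HS.
rewrite dim_cV in sz gb cX.
have sumE (F : rat -> rat) : \sum_(c <- orbits (frob sigma b) C) F c.1 = \sum_i F (nu i).
  apply: (slope_basis_sum bs uP erefl b'0 bK) => //.
  exact: (slopevec_orbits bs (frobZ sigma b) hC).
have gb' : gauss_bound v m'.+1 P (fun t => \sum_i Num.max 0 (t - nu i)) (\sum_i nu i).
  have [h1 h2 h3 h4] := gb; split=> //; first by rewrite (sumE id) in h3.
  by move=> t j hj; rewrite -(sumE (fun s => Num.max 0 (t - s))); apply: h4.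
have [mP sP [P00 vP0] _] := gb.
have bP := newton_hodge_bound gb' dnu dle.
have vP0' : v P`_0 = \sum_i mu i.
  apply/eqP; rewrite -(eqr_int rat); apply/eqP; rewrite vP0 (sumE id) rmorph_sum.
  by case: dle.
have [ug gE] := cyclic_conj mP sP hX (pact_gl bs mu mP sP) (orbmx_unit cX) (orbmx_gl_unit bs mu P).
eexists; split; first exact: ug.
by rewrite gE; apply: (gl_cartan bs bP P00 vP0').
Qed.

(** * Symplectic isocrystals *)

Section Symplectic.
Variables (L : fieldType) (v : L -> int) (sigma : {rmorphism L -> L}).
Variables (p f : nat) (pi : L).
Hypothesis bs : breve_setting v sigma p f pi.
Variables (vT : vectType L) (phi : vT -> vT).
Hypothesis phiD : forall x y, phi (x + y) = phi x + phi y.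
Hypothesis phiZ : forall a x, phi (a *: x) = sigma a *: phi x.
Variables (form : vT -> vT -> L) (c : int).
Hypothesis formDl : forall x y z, form (x + y) z = form x z + form y z.
Hypothesis formZl : forall a x z, form (a *: x) z = a * form x z.
Hypothesis formDr : forall x y z, form x (y + z) = form x y + form x z.
Hypothesis formZr : forall a x z, form x (a *: z) = a * form x z.
Hypothesis form_alt : forall x, form x x = 0.
Hypothesis form_nd : forall x, (forall y, form x y = 0) -> x = 0.
Hypothesis form_phi : forall x y, form (phi x) (phi y) = pi ^ c * sigma (form x y).

Lemma form_antisym x y : form y x = - form x y.
Proof.
have := form_alt (x + y); rewrite formDl !formDr !form_alt add0r addr0 => /eqP.
by rewrite addr_eq0 => /eqP h; rewrite h opprK.
Qed.

Lemma form0l x : form 0 x = 0.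
Proof. by rewrite -[0 in LHS](scale0r (0 : vT)) formZl mul0r. Qed.

Lemma form0r x : form x 0 = 0.
Proof. by rewrite form_antisym form0l oppr0. Qed.

Lemma form_suml (I : Type) (r : seq I) (P : pred I) (F : I -> vT) y :
  form (\sum_(i <- r | P i) F i) y = \sum_(i <- r | P i) form (F i) y.
Proof. exact: (big_morph (form^~ y) (fun x z => formDl x z y) (form0l y)). Qed.

Lemma form_sumr (I : Type) (r : seq I) (P : pred I) (F : I -> vT) x :
  form x (\sum_(i <- r | P i) F i) = \sum_(i <- r | P i) form x (F i).
Proof. exact: (big_morph (form x) (formDr x) (form0r x)). Qed.

Lemma form_iter n x y :
  form (iter n phi x) (iter n phi y) = pi ^ (c * n%:Z) * iter n sigma (form x y).
Proof.
elim: n => [|n IH]; first by rewrite mulr0 expr0z mul1r.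
rewrite !iterS form_phi IH rmorphM /= (sigma_piz bs) mulrA -expfzDr ?(pi_neq0 bs) //.
by congr (pi ^ _ * _); lia.
Qed.

Lemma iter_sigma_eq0 n a : (iter n sigma a == 0) = (a == 0).
Proof. by elim: n => //= n IH; rewrite fmorph_eq0. Qed.

Local Notation slopevec := (slopevec pi phi).
Local Notation orb := (orb phi).
Local Notation stable := (stable phi).
Local Notation orbits := (orbits phi).

Lemma slopevec_iterM lam x n : slopevec lam x ->
  iter (n * den lam) phi x = pi ^ (numq lam * n%:Z) *: x.
Proof.
move=> hx; elim: n => [|n IH]; first by rewrite mul0n mulr0 expr0z scale1r.
rewrite mulSn iterD IH (iter_phi_pi bs phiZ) hx scalerA -expfzDr ?(pi_neq0 bs) //.
by congr (pi ^ _ *: _); lia.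
Qed.

(** Iterating the similitude relation s s' times multiplies the pairing by powers of [pi] on both
    sides; [sigma] preserves valuations. *)
Lemma slope_pair lam x lam' y : slopevec lam x -> slopevec lam' y -> form x y != 0 ->
  lam + lam' = c%:~R.
Proof.
move=> hx hy xy; apply: slope_sum.
have := form_iter (den lam' * den lam) x y.
rewrite {1}slopevec_iterM // mulnC slopevec_iterM // formZl formZr => /(congr1 v).
have vs := v_iter_sigma bs.
rewrite !(vM bs) ?mulf_neq0 ?(piz_neq0 bs) ?iter_sigma_eq0 // vs !(v_piz bs) PoszM addrA.
by move/addIr => ->.
Qed.

Definition orth (x y : vT) : Prop := forall i j, form (iter i phi x) (iter j phi y) = 0.

Lemma orthC x y : orth x y -> orth y x.
Proof. by move=> h i j; rewrite form_antisym h oppr0. Qed.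

(** The similitude relation lowers both indices together. Once the left index is 0, periodicity
    phi^s x = pi^r x raises it again. *)
Lemma orth_slope lam x y : slopevec lam x -> (forall i, form (iter i phi x) y = 0) -> orth x y.
Proof.
move=> hx hy i j; elim: j i => // j IH i.
case: i => [|i]; last by rewrite !iterS form_phi IH rmorph0 mulr0.
have -> : iter 0 phi x = pi ^ (- numq lam) *: iter (den lam) phi x.
  by rewrite hx scalerA -expfzDr ?(pi_neq0 bs) // addNr expr0z scale1r.
rewrite formZl -(prednK (den_gt0 lam)) !iterS form_phi IH rmorph0 !mulr0 //.
Qed.

(** The orthogonal space is the kernel of pairing with a basis of [W], a map into a space of
    dimension [\dim W]. *)
Lemma ex_orthv (W : {vspace vT}) : exists U : {vspace vT},
  (forall y, y \in U <-> (forall x, x \in W -> form x y = 0)) /\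
  (\dim {:vT} <= \dim W + \dim U)%N.
Proof.
pose b := vbasis W; pose g (y : vT) : 'rV[L]_(\dim W) := \row_i form b`_i y.
have gl : GRing.linear_for *:%R g.
  by move=> a x y; apply/matrixP => i j; rewrite !mxE formDr formZr.
pose gL : {linear vT -> 'rV[L]_(\dim W)} :=
  HB.pack g (GRing.isLinear.Build _ _ _ _ g gl).
exists (lker (linfun gL)); split.
  move=> y; rewrite memv_ker lfunE /= /gL /=; split=> [/eqP h x xW|h].
    rewrite (coord_vbasis xW) form_suml big1 // => i _; rewrite formZl.
    by have := congr1 (fun z : 'rV_(\dim W) => z 0 i) h; rewrite !mxE => ->; rewrite mulr0.
  apply/eqP/matrixP => i j; rewrite !mxE; apply: h; apply: vbasis_mem.
  by apply: mem_nth; rewrite size_tuple.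
have := limg_ker_dim (linfun gL) fullv; rewrite capfv => <-; rewrite addnC leq_add2r.
by apply: leq_trans (dimvS (subvf _)) _; rewrite dimvf /dim /= mul1n.
Qed.

Lemma orth_span x y (n n' : nat) a b : orth x y -> a \in <<orb n x>>%VS ->
  b \in <<orb n' y>>%VS -> form a b = 0.
Proof.
move=> h /orb_spanP[k ->] /orb_spanP[k' ->]; rewrite form_suml big1 // => i _.
by rewrite form_sumr big1 // => j _; rewrite formZl formZr h !mulr0.
Qed.

Lemma orth_stable_slope lam x (U : {vspace vT}) : slopevec lam x ->
  (forall y, y \in U <-> (forall a, a \in <<orb (den lam) x>>%VS -> form a y = 0)) ->
  forall y, y \in U <-> orth x y.
Proof.
move=> hx hU y; split=> [/hU h|h]; last first.
  by apply/hU => a ha; apply: (orth_span h ha (mem_orb_iter phi y (ltn0Sn 0))).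
apply: (orth_slope hx) => i; apply: h; apply: stable_iter (stable_orb phiD phiZ hx) _.
exact: (mem_orb_iter phi x (den_gt0 lam)).
Qed.

Lemma orth_stable x (U : {vspace vT}) : (forall y, y \in U <-> orth x y) -> stable U.
Proof. by move=> hU y /hU h; apply/hU => i j; rewrite -iterSr; apply: h. Qed.

(* The radical of the pairing in the simple isocrystal generated by [y] is a
   proper subobject, hence zero. *)
Lemma pairing_nondeg lam x lam' y w : slopevec lam x -> slopevec lam' y -> ~ orth x y ->
  w \in <<orb (den lam') y>>%VS -> (forall i, form (iter i phi x) w = 0) -> w = 0.
Proof.
move=> hx hy nxy hw hxw.
have [U [hU _]] := ex_orthv <<orb (den lam) x>>%VS.
have {}hU := orth_stable_slope hx hU.
have yU : y \notin U by apply/negP => /hU.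
have dimE := simple_dim bs phiD phiZ (orth_stable hU) hy yU.
have dimD : (\dim <<orb (den lam') y>> <= den lam')%N.
  by apply: leq_trans (dim_span _) _; rewrite size_mkseq.
have := dimv_sum_cap U <<orb (den lam') y>>%VS; rewrite dimE => h.
have : (\dim (U :&: <<orb (den lam') y>>) == 0)%N by lia.
rewrite dimv_eq0 => /eqP capE; apply/eqP; rewrite -memv0 -capE memv_cap hw andbT.
by apply/hU; apply: orth_slope hx hxw.
Qed.

(** A non-zero self-pairing of the orbit forces slope c/2, so the denominator is at most 2 and all
    iterates are multiples of [u] and [phi u]. *)
Lemma isotropic_orth lam u : slopevec lam u -> form u (phi u) = 0 -> orth u u.
Proof.
move=> hu h0; apply: (orth_slope hu) => i; apply: NNPP => hi.
have hi' : form (iter i phi u) u != 0 by apply/eqP.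
have /(congr1 (fun z => z * (den lam)%:R)) := slope_pair (slopevec_iter bs phiZ i hu) hu hi'.
rewrite mulrDl ratE -intrD => E.
have {}E : numq lam * 2 = c * (den lam)%:Z.
  by apply/eqP; rewrite -(eqr_int rat) (intrM _ c) -pmulrn -E eqr_int; apply/eqP; lia.
have d2 : (den lam <= 2)%N.
  have : (den lam %| `|(numq lam * 2)%R|)%N by rewrite E abszM dvdn_mull.
  rewrite abszM Gauss_dvdr; last by rewrite coprime_sym coprime_num_den.
  by move/dvdn_leq; apply.
apply: hi; rewrite (divn_eq i (den lam)) addnC iterD slopevec_iterM // (iter_phi_pi bs phiZ).
rewrite formZl; have := ltn_pmod i (den_gt0 lam).
case: (i %% den lam)%N => [|[|k]] hk /=; last by lia.
  by rewrite form_alt mulr0.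
by rewrite form_antisym h0 oppr0 mulr0.
Qed.

(** The slope is c/2; with denominator 1 the vector [phi z] would be proportional to [z] and the
    alternating form would vanish. *)
Lemma anisotropic_slope lam z : slopevec lam z -> form z (phi z) != 0 ->
  [/\ den lam = 2, numq lam = c & odd `|c|].
Proof.
move=> hz hzz; have hpz := slopevec_iter bs phiZ 1 hz.
have /(congr1 (fun z => z * (den lam)%:R)) := slope_pair hz hpz hzz.
rewrite mulrDl ratE -intrD => E.
have {}E : numq lam * 2 = c * (den lam)%:Z.
  by apply/eqP; rewrite -(eqr_int rat) (intrM _ c) -pmulrn -E eqr_int; apply/eqP; lia.
have d2 : (den lam %| 2)%N.
  have : (den lam %| `|(numq lam * 2)%R|)%N by rewrite E abszM dvdn_mull.
  by rewrite abszM Gauss_dvdr // coprime_sym coprime_num_den.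
have d1 : den lam <> 1%N.
  move=> d1; move: hz; rewrite /slopevec d1 /= => hz.
  by move: hzz; rewrite hz formZr form_alt mulr0 eqxx.
have d : den lam = 2.
  by have := dvdn_leq (isT : (0 < 2)%N) d2; have := den_gt0 lam; lia.
have nc : numq lam = c by move: E; rewrite d; lia.
by split=> //; have := coprime_num_den lam; rewrite nc -/(den lam) d coprimen2.
Qed.

Lemma slopevec2E lam z : den lam = 2 -> numq lam = c ->
  slopevec lam z <-> phi (phi z) = pi ^ c *: z.
Proof. by rewrite /slopevec => -> ->. Qed.

Lemma sigma_form_plane z : phi (phi z) = pi ^ c *: z ->
  sigma (form z (phi z)) = - form z (phi z).
Proof.
move=> hz; apply: (mulfI (piz_neq0 bs c)).
by rewrite -form_phi hz formZr form_antisym.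
Qed.

(** An anisotropic [w] has the slope of [u], so it can be corrected by a multiple of [u]. The clause
    on stable subspaces keeps the result inside the orthogonal complement being split. *)
Lemma isotropic_partner lam u lam2 w : slopevec lam u -> orth u u -> slopevec lam2 w ->
  form u w != 0 ->
  exists y, [/\ slopevec lam2 y, orth y y, ~ orth u y &
    forall U : {vspace vT}, stable U -> u \in U -> w \in U -> y \in U].
Proof.
move=> hu ou hw uw; have [ww|ww] := eqVneq (form w (phi w)) 0.
  exists w; split=> //; first exact: isotropic_orth hw ww.
  by move=> /(_ 0%N 0%N)/eqP; rewrite (negbTE uw).
have [d2 nc _] := anisotropic_slope hw ww.
have ll : lam = lam2.
  have := slope_pair hu hw uw; rewrite -(slope_pair hw (slopevec_iter bs phiZ 1 hw) ww).
  exact: addIr.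
rewrite ll in hu; move/(slopevec2E _ d2 nc): hu => hu.
have [y' [hy' hh my']] : exists y', [/\ phi (phi y') = pi ^ c *: y', form u (phi y') != 0 &
    forall U : {vspace vT}, stable U -> w \in U -> y' \in U].
  move/(slopevec2E _ d2 nc): hw => hw; have [h1|h1] := eqVneq (form u (phi w)) 0; last by exists w.
  exists (phi w); split; first by rewrite hw phiZ (sigma_piz bs).
    by rewrite hw formZr mulf_neq0 ?(piz_neq0 bs).
  by move=> U sU wU; apply: sU.
set t := form y' (phi y'); set h := form u (phi y') in hh.
have st : sigma t = - t by apply: sigma_form_plane.
have fuy : form (phi u) y' = sigma h.
  by apply: (mulfI (piz_neq0 bs c)); rewrite -form_phi -formZr hy'.
have ssh : sigma (sigma h) = h.
  apply: (mulfI (piz_neq0 bs c)); apply: (mulfI (piz_neq0 bs c)).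
  have := form_phi (phi u) (phi (phi y')).
  by rewrite hy' hu phiZ (sigma_piz bs) !formZr formZl fuy rmorphM /= (sigma_piz bs) => ->.
have two0 : (2%:R : L) != 0 by apply: (natr_neq0 bs).
(* Isotropy of y' + al u means t + al h - sigma(al h) = 0, and al h = -t/2 solves it because
   sigma(t) = -t. *)
pose al := - (t / (2%:R * h)).
have ssal : sigma (sigma al) = al.
  by rewrite /al !rmorphN !fmorph_div !rmorphM /= !rmorph_nat ssh st rmorphN st opprK.
have uu i j : form (iter i phi u) (iter j phi u) = 0 by apply: ou.
have hy : phi (phi (y' + al *: u)) = pi ^ c *: (y' + al *: u).
  by rewrite !phiD !phiZ ssal hu hy' scalerDr !scalerA mulrC.
exists (y' + al *: u); split.
- exact/(slopevec2E _ d2 nc).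
- apply: (@isotropic_orth lam2); first exact/(slopevec2E _ d2 nc).
  rewrite phiD phiZ formDl !formDr !formZl !formZr (uu 0%N 1%N) -/t -/h (form_antisym (phi u) y') fuy.
  have -> : sigma al = t / (2%:R * sigma h).
    by rewrite /al rmorphN fmorph_div rmorphM /= rmorph_nat st mulNr opprK.
  have h0' : sigma h != 0 by rewrite fmorph_eq0.
  by rewrite /al; field; rewrite hh h0' two0.
- move=> /(_ 0%N 1%N) /=; rewrite phiD phiZ formDr formZr (uu 0%N 1%N) mulr0 addr0 => /eqP.
  by rewrite (negbTE hh).
- by move=> U sU uU wU; apply: memvD; [apply: my' | apply: memvZ].
Qed.

(* Two orthogonal planes: the reduced norm of the quaternion algebra is
   surjective, here through [alpha = pi^e sigma(d)/d] with [sigma^2(d) = u0 d]. *)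
Lemma isotropic_of_planes lam z1 lam' z2 : slopevec lam z1 -> slopevec lam' z2 ->
  form z1 (phi z1) != 0 -> form z2 (phi z2) != 0 -> orth z1 z2 ->
  exists x, [/\ x != 0, slopevec lam x, form x (phi x) = 0 &
    forall U : {vspace vT}, stable U -> z1 \in U -> z2 \in U -> x \in U].
Proof.
move=> hz1 hz2 n1 n2 o12.
have [d1 nc1 oc] := anisotropic_slope hz1 n1; have [d2 nc2 _] := anisotropic_slope hz2 n2.
move/(slopevec2E _ d1 nc1): hz1 => hz1; move/(slopevec2E _ d2 nc2): hz2 => hz2.
have st1 := sigma_form_plane hz1; set t1 := form z1 _ in n1 st1.
(* Replacing [z2] by [phi z2] shifts the valuation of its invariant by the odd number [c], so the
   difference of valuations can be taken even. *)
have [z [hz nz oz mz [e ee]]] : exists z, [/\ phi (phi z) = pi ^ c *: z, form z (phi z) != 0,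
    orth z1 z, (forall U : {vspace vT}, stable U -> z2 \in U -> z \in U) &
    exists e : int, v (form z (phi z)) - v t1 = e * 2].
  have [ev|od] := boolP (2 %| v (form z2 (phi z2)) - v t1)%Z.
    exists z2; split=> //; exists ((v (form z2 (phi z2)) - v t1) %/ 2)%Z.
    by rewrite divzK.
  exists (phi z2); have E : form (phi z2) (phi (phi z2)) = - (pi ^ c * form z2 (phi z2)).
    by rewrite form_phi (sigma_form_plane hz2) mulrN.
  split; first by rewrite hz2 phiZ (sigma_piz bs).
  - by rewrite E oppr_eq0 mulf_neq0 ?(piz_neq0 bs).
  - by move=> i j; rewrite -iterSr; apply: o12.
  - by move=> U sU zU; apply: sU.
  rewrite E (vN bs) (vM bs) ?(piz_neq0 bs) // (v_piz bs).
  have : (2 %| c + v (form z2 (phi z2)) - v t1)%Z.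
    by move: od oc; move: (v _) (v _) => a b; lia.
  by case/dvdzP => q ->; exists q.
have st := sigma_form_plane hz; set t := form z _ in nz st ee.
(* Isotropy of al z1 + z means that al sigma(al) equals -t/t1; [u0] is the unit left after removing
   pi^(2e). It is fixed by [sigma] since [t] and [t1] both change sign, which gives sigma^2(al) =
   al. *)
pose u0 := - (t / t1) * pi ^ (- (e * 2)).
have tt0 : t / t1 != 0 by rewrite mulf_neq0 ?invr_eq0.
have u00 : u0 != 0 by rewrite mulf_neq0 ?oppr_eq0 ?(piz_neq0 bs).
have vu0 : v u0 = 0.
  rewrite (vM bs) ?oppr_eq0 ?(piz_neq0 bs) // (vN bs) (vM bs) ?invr_eq0 // (vV bs) // (v_piz bs).
  by rewrite ee subrr.
have su0 : sigma u0 = u0.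
  by rewrite /u0 rmorphM /= (sigma_piz bs) rmorphN fmorph_div st st1 invrN mulrNN.
have [d d0 dE] := lang_scalar bs (isT : (0 < 2)%N) u00 vu0.
rewrite /= in dE; have sd0 : sigma d != 0 by rewrite fmorph_eq0.
pose al := pi ^ e * (sigma d / d).
have sal : sigma al = pi ^ e * (u0 * d / sigma d).
  by rewrite /al rmorphM /= (sigma_piz bs) fmorph_div dE.
have ssal : sigma (sigma al) = al.
  rewrite sal rmorphM /= (sigma_piz bs) fmorph_div rmorphM /= su0 dE /al; congr (_ * _).
  by field; rewrite u00 d0.
have nal : al * sigma al = - (t / t1).
  rewrite sal /al; have -> : pi ^ e * (sigma d / d) * (pi ^ e * (u0 * d / sigma d)) = pi ^ e * pi ^ e * u0.
    by field; rewrite d0 sd0.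
  rewrite /u0 mulrCA -!expfzDr ?(pi_neq0 bs) // (_ : e + e - e * 2 = 0); last by lia.
  by rewrite expr0z mulr1.
have o i j : form (iter i phi z1) (iter j phi z) = 0 by apply: oz.
have o' i j : form (iter i phi z) (iter j phi z1) = 0 by rewrite form_antisym o oppr0.
exists (al *: z1 + z); split.
- apply: contraNneq nz => x0; have : form (al *: z1 + z) (phi z) = 0 by rewrite x0 form0l.
  by rewrite formDl formZl (o 0%N 1%N) mulr0 add0r => /eqP.
- by apply/(slopevec2E _ d1 nc1); rewrite !phiD !phiZ ssal hz1 hz scalerDr !scalerA mulrC.
- rewrite phiD phiZ formDl !formDr !formZl !formZr (o 0%N 1%N) (o' 0%N 1%N) -/t -/t1.
  rewrite !mulr0 addr0 add0r mulrA nal mulNr divfK //; exact: addNr.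
- by move=> U sU U1 U2; apply: memvD; [apply: memvZ | apply: mz].
Qed.

Definition hyper (h : rat * vT * vT) : Prop :=
  [/\ slopevec h.1.1 h.1.2, slopevec (c%:~R - h.1.1) h.2, orth h.1.2 h.1.2,
      orth h.2 h.2 & ~ orth h.1.2 h.2].

Definition comps (H : seq (rat * vT * vT)) : seq (rat * vT) :=
  flatten [seq [:: (h.1.1, h.1.2); (c%:~R - h.1.1, h.2)] | h <- H].

Definition horth (h h' : rat * vT * vT) : Prop :=
  [/\ orth h.1.2 h'.1.2, orth h.1.2 h'.2, orth h.2 h'.1.2 & orth h.2 h'.2].

Definition pworth (H : seq (rat * vT * vT)) : Prop := forall i j,
  (i < size H)%N -> (j < size H)%N -> i != j -> horth (nth (0, 0, 0) H i) (nth (0, 0, 0) H j).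

Definition nondeg (W : {vspace vT}) : Prop :=
  forall w, w \in W -> (forall x, x \in W -> form x w = 0) -> w = 0.

Definition compl (W U : {vspace vT}) : Prop :=
  forall y, y \in U <-> (forall x, x \in W -> form x y = 0).

Lemma nondeg_decomp W : nondeg W -> exists2 U, compl W U &
  forall y, exists w u, [/\ w \in W, u \in U & y = w + u].
Proof.
move=> nW; have [U [hU dU]] := ex_orthv W; exists U => // y.
have cap0 : (W :&: U = 0)%VS.
  apply/eqP; rewrite -subv0; apply/subvP => w /memv_capP[wW /hU wU].
  by rewrite memv0 (nW w wW wU).
have : y \in (W + U)%VS.
  suff -> : (W + U = fullv)%VS by rewrite memvf.
  by apply/eqP; rewrite eqEdim subvf dimv_disjoint_sum.
by case/memv_addP => w wW [u uU ->]; exists w, u.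
Qed.

Lemma nondeg_add W D : nondeg W -> nondeg D ->
  (forall w d, w \in W -> d \in D -> form w d = 0) -> nondeg (W + D)%VS.
Proof.
move=> nW nD o z /memv_addP[w wW [d dD ->]] h.
have w0 : w = 0.
  apply: nW => // x xW; have := h x (subvP (addvSl W D) x xW).
  by rewrite formDr (o x d) // addr0.
have d0 : d = 0.
  apply: nD => // x xD; have := h x (subvP (addvSr W D) x xD).
  by rewrite formDr [form x w]form_antisym (o w x) // oppr0 add0r.
by rewrite w0 d0 addr0.
Qed.

Lemma compl_orbits C U : (forall a, a \in C -> slopevec a.1 a.2) ->
  compl <<unzip2 (orbits C)>>%VS U ->
  forall y, y \in U <-> (forall a, a \in C -> orth a.2 y).
Proof.
move=> hC hU y; split=> [/hU h a aC|h].
  apply: (orth_slope (hC a aC)) => i; apply: h; apply: stable_iter.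
    exact: (stable_orbits phiD phiZ hC).
  apply/memv_span/mapP; exists (a.1, a.2) => //; apply/flattenP.
  exists [seq (a.1, x) | x <- orb (den a.1) a.2]; first by apply/mapP; exists a.
  by apply: map_f; apply/mapP; exists 0%N; rewrite ?mem_iota ?den_gt0.
apply/hU => x hx; rewrite (coord_span (X := in_tuple (unzip2 (orbits C))) hx).
rewrite form_suml big1 // => i _; rewrite formZl.
have : (in_tuple (unzip2 (orbits C)))`_i \in unzip2 (orbits C) by apply: mem_nth.
case/mapP => b /flattenP[s /mapP[a aC ->]] /mapP[x0 /mapP[j _ ->] ->] /= ->.
by rewrite (h a aC j 0%N) mulr0.
Qed.

Lemma compl_stable C U : (forall a, a \in C -> slopevec a.1 a.2) ->
  compl <<unzip2 (orbits C)>>%VS U -> stable U.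
Proof.
move=> hC /(compl_orbits hC) hU y /hU h; apply/hU => a aC i j; rewrite -iterSr.
exact: h.
Qed.

Lemma slopevec_proj (W U : {vspace vT}) lam w u : stable W -> stable U ->
  (forall z, z \in W -> z \in U -> z = 0) -> w \in W -> u \in U ->
  slopevec lam (w + u) -> slopevec lam u.
Proof.
move=> sW sU WU wW uU; rewrite /slopevec (iter_phiD phiD) scalerDr => E.
apply/eqP; rewrite -subr_eq0; apply/eqP; apply: WU; last first.
  by apply: memvB; [apply: stable_iter | apply: memvZ].
have -> : iter (den lam) phi u - pi ^ numq lam *: u =
    pi ^ numq lam *: w - iter (den lam) phi w.
  by apply/eqP; rewrite subr_eq addrAC eq_sym subr_eq -E addrC.
by apply: memvB; [apply: memvZ | apply: stable_iter].
Qed.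

(** Invariant of the greedy construction: orthogonal hyperbolic pairs whose orbits are independent
    and span a non-degenerate subspace. *)
Definition hstate (H : seq (rat * vT * vT)) : Prop :=
  [/\ forall h, h \in H -> hyper h, pworth H,
      nondeg <<unzip2 (orbits (comps H))>>%VS &
      \dim <<unzip2 (orbits (comps H))>> = size (orbits (comps H))].

Lemma hyper_slope H : (forall h, h \in H -> hyper h) ->
  forall a, a \in comps H -> slopevec a.1 a.2.
Proof.
move=> hH a /flattenP[s /mapP[h hh ->]]; case: (hH h hh) => h1 h2 _ _ _.
by rewrite !inE => /orP[] /eqP->.
Qed.

(** Both summands of the orthogonal splitting are stable, so projecting a slope vector to the
    complement keeps its slope equation. *)
Lemma nondeg_slopes (W : {vspace vT}) C lam y : (forall a, a \in C -> slopevec a.1 a.2) ->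
  W = <<unzip2 (orbits C)>>%VS -> nondeg W -> slopevec lam y ->
  forall U, compl W U -> exists w u, [/\ w \in W, u \in U, y = w + u & slopevec lam u].
Proof.
move=> hC EW nW hy U hU; have [U' hU' dec] := nondeg_decomp nW.
have [w [u [wW uU' yE]]] := dec y.
have uU : u \in U by apply/hU; apply/hU'.
exists w, u; split=> //; rewrite EW in nW wW hU; rewrite yE in hy.
apply: (slopevec_proj _ (compl_stable hC hU) _ wW uU hy).
  exact: (stable_orbits phiD phiZ hC).
by move=> z zW /hU; apply: nW.
Qed.

(** The two simple pieces of a hyperbolic pair have the same dimension [s], and the pairing is
    injective on the second; evaluation on the [s] iterates of the first generator is therefore
    onto. *)
Lemma ex_dual_vector h (g : nat -> L) : hyper h ->
  exists2 y, y \in <<orb (den (c%:~R - h.1.1)) h.2>>%VS &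
    forall j, (j < den h.1.1)%N -> form (iter j phi h.1.2) y = g j.
Proof.
move=> [hx hy _ _ nxy]; set s := den h.1.1; set D := <<_>>%VS.
pose ev (y : vT) : 'rV[L]_s := \row_j form (iter j phi h.1.2) y.
have evl : GRing.linear_for *:%R ev.
  by move=> a x y; apply/matrixP => i j; rewrite !mxE formDr formZr.
pose evL : {linear vT -> 'rV[L]_s} := HB.pack ev (GRing.isLinear.Build _ _ _ _ ev evl).
have inj : (D :&: lker (linfun evL) = 0)%VS.
  apply/eqP; rewrite -subv0; apply/subvP => w /memv_capP[wD].
  rewrite memv_ker lfunE /= /evL /= => /eqP h0; rewrite memv0; apply/eqP.
  apply: (pairing_nondeg hx hy nxy wD) => i.
  have : iter i phi h.1.2 \in <<orb s h.1.2>>%VS.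
    apply: stable_iter (stable_orb phiD phiZ hx) _; exact: (mem_orb_iter phi _ (den_gt0 _)).
  case/orb_spanP => k ->; rewrite form_suml big1 // => j _; rewrite formZl.
  by have := congr1 (fun z : 'rV_s => z 0 j) h0; rewrite !mxE => ->; rewrite mulr0.
have dD : \dim D = s.
  have y0 : h.2 \notin (0%VS : {vspace vT}).
    by rewrite memv0; apply/eqP => y0; apply: nxy => i j; rewrite y0 (iter_phi0 phiZ) form0r.
  have st0 : stable 0%VS by move=> x; rewrite !memv0 => /eqP->; rewrite (phi0 phiZ).
  by have := simple_dim bs phiD phiZ st0 hy y0; rewrite add0v dimv0 add0n => ->; apply: den_intB.
have full : (linfun evL @: D)%VS = fullv.
  have dI : \dim (linfun evL @: D) = s.
    by have := limg_ker_dim (linfun evL) D; rewrite inj dimv0 add0n dD.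
  by apply/eqP; rewrite eqEdim subvf dI dimvf /dim /= mul1n leqnn.
have := memvf (\row_(j < s) g j); rewrite -full => /memv_imgP[y yD].
rewrite lfunE /= /evL /= => E; exists y => // j js.
by have := congr1 (fun z : 'rV_s => z 0 (Ordinal js)) E; rewrite !mxE.
Qed.

Hypothesis HS : slope_spanned pi phi.

Lemma hstate_step H U lam u : hstate H -> compl <<unzip2 (orbits (comps H))>>%VS U ->
  u \in U -> u != 0 -> slopevec lam u -> form u (phi u) = 0 ->
  exists h, hstate (h :: H).
Proof.
move=> [hH pH nW dW] hU uU u0 hu uu; have hC := hyper_slope hH.
have ou := isotropic_orth hu uu; set W := <<_>>%VS in hU nW dW.
have [K [hK _]] := ex_orthv <[u]>%VS.
(* Non-degeneracy makes the orthogonal of [u] a proper subspace, so some slope vector pairs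
   non-trivially with [u]; its projection off [W] has the same pairing with [u]. *)
have [|[lam2 y0] /= hy0 y0K] := HS (W := K).
  apply: contraNneq u0 => KE; apply/eqP/form_nd => y.
  by move: (memvf y); rewrite -KE => /hK/(_ u (memv_line u)).
have [w [u2 [wW u2U yE hu2]]] := nondeg_slopes hC erefl nW hy0 hU.
have uu2 : form u u2 != 0.
  apply: contra y0K => /eqP h; apply/hK => x /vlineP[k ->]; rewrite formZl yE formDr h addr0.
  by rewrite form_antisym (proj1 (hU u) uU w wW) oppr0 mulr0.
have [y [hy oy nuy my]] := isotropic_partner hu ou hu2 uu2.
have l2 : lam2 = c%:~R - lam by rewrite -(slope_pair hu hu2 uu2) addrC addKr.
have sU := compl_stable hC hU; have sW : stable W := stable_orbits phiD phiZ hC.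
have yU : y \in U by apply: my.
have WU z : z \in W -> z \in U -> z = 0 by move=> zW /hU; apply: nW.
rewrite l2 in hy; exists (lam, u, y); pose Du := <<orb (den lam) u>>%VS.
pose Dy := <<orb (den (c%:~R - lam)) y>>%VS.
have EW : <<unzip2 (orbits (comps ((lam, u, y) :: H)))>>%VS = (W + (Du + Dy))%VS.
  by rewrite /comps /= !span_orbits_cons -/(comps H) -/W addvA addvC.
have sub_span n z : z \in U -> (<<orb n z>> <= U)%VS.
  by move=> zU; apply/span_subvP => x /mapP[j _ ->]; apply: stable_iter.
have nxy' : ~ orth y u by move/orthC.
have nD : nondeg (Du + Dy)%VS.
  move=> z /memv_addP[a aD [b bD ->]] h.
  have b0 : b = 0.
    apply: (pairing_nondeg hu hy nuy bD) => i.
    have iD : iter i phi u \in Du.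
      apply: stable_iter (stable_orb phiD phiZ hu) _; exact: (mem_orb_iter phi u (den_gt0 lam)).
    have := h _ (subvP (addvSl Du Dy) _ iD).
    by rewrite formDr (orth_span ou iD aD) add0r.
  have a0 : a = 0.
    apply: (pairing_nondeg hy hu nxy' aD) => i.
    have iD : iter i phi y \in Dy.
      apply: stable_iter (stable_orb phiD phiZ hy) _; exact: (mem_orb_iter phi y (den_gt0 _)).
    have := h _ (subvP (addvSr Du Dy) _ iD).
    by rewrite formDr (orth_span oy iD bD) addr0.
  by rewrite a0 b0 addr0.
have DU : (Du + Dy <= U)%VS by rewrite subv_add !sub_span.
split.
- by move=> h; rewrite inE => /orP[/eqP->|]; [split | apply: hH].
- have oH z h : z \in U -> h \in H -> orth h.1.2 z /\ orth h.2 z.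
    move=> zU hh; have /compl_orbits := hU => /(_ hC z)[/(_ zU) oz _]; split.
      by apply: (oz (h.1.1, h.1.2)); apply/flattenP; eexists; [apply: map_f hh|rewrite mem_head].
    by apply: (oz (c%:~R - h.1.1, h.2)); apply/flattenP; eexists; [apply: map_f hh|rewrite !inE eqxx orbT].
  move=> [|i] [|j] //= hi hj ij.
  + have [o1 o2] := oH u _ uU (mem_nth (0, 0, 0) hj).
    have [o3 o4] := oH y _ yU (mem_nth (0, 0, 0) hj).
    by split; apply: orthC.
  + have [o1 o2] := oH u _ uU (mem_nth (0, 0, 0) hi).
    by have [o3 o4] := oH y _ yU (mem_nth (0, 0, 0) hi).
  + exact: pH.
- rewrite EW; apply: nondeg_add => // w1 d w1W /(subvP DU) /hU; exact.
- rewrite EW /comps /= !size_orbits_cons -/(comps H) addvA.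
  have uW : u \notin W by apply: contra u0 => uW; rewrite (WU u uW uU).
  have yW : y \notin (W + Du)%VS.
    apply/negP => /memv_addP[w1 w1W [a aD yE2]]; apply: nuy.
    have w10 : w1 = 0.
      apply: WU => //; have -> : w1 = y - a by rewrite yE2 addrK.
      by apply: memvB => //; apply: (subvP (sub_span _ _ uU)) aD.
    apply: (orth_slope hu) => i; rewrite yE2 w10 add0r; apply: (orth_span ou _ aD).
    exact: (mem_orb_iter phi u (ltnSn i)).
  have sWD : stable (W + Du)%VS by apply: stableD => //; apply: (stable_orb phiD phiZ hu).
  by rewrite (simple_dim bs phiD phiZ sWD hy yW) (simple_dim bs phiD phiZ sW hu uW) dW -addnA addnC -addnA.
Qed.

(** For a maximal family of hyperbolic pairs, the complement contains no isotropic slope vector.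
    After one anisotropic plane is split off from it, a second one would produce such a vector. *)
Theorem symplectic_decomposition : exists (H : seq (rat * vT * vT)) (zs : seq (rat * vT)),
  [/\ forall h, h \in H -> hyper h, pworth H, (size zs <= 1)%N &
    forall z, z \in zs -> [/\ slopevec z.1 z.2, form z.2 (phi z.2) != 0 &
       forall h, h \in H -> orth h.1.2 z.2 /\ orth h.2 z.2]] /\
  (<<unzip2 (orbits (comps H ++ zs))>>%VS = fullv /\
   size (orbits (comps H ++ zs)) = \dim {:vT}).
Proof.
have [H [hst stuck]] : exists H, hstate H /\ ~ exists h, hstate (h :: H).
  apply: NNPP => no.
  (* If every family could be enlarged, the independent orbits would outnumber the dimension. *)
  have grow n : exists2 H, hstate H & (n <= size (orbits (comps H)))%N.
    elim: n => [|n [H hH sz]].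
      exists [::] => //; split=> //.
        by move=> w; rewrite /comps /= span_nil memv0 => /eqP.
      by rewrite /comps /= span_nil dimv0.
    have [h hh] : exists h, hstate (h :: H).
      by apply: NNPP => h; apply: no; exists H.
    exists (h :: H) => //; rewrite /comps /= !size_orbits_cons -/(comps H).
    by have := den_gt0 h.1.1; lia.
  have [H [_ _ _ dH] sz] := grow (\dim {:vT}).+1.
  by have := dimvS (subvf <<unzip2 (orbits (comps H))>>%VS); rewrite dH; lia.
have [hH pH nW dW] := hst; have hC := hyper_slope hH.
set W := <<_>>%VS in nW dW; have [U hU _] := nondeg_decomp nW.
have noiso lam u : u \in U -> u != 0 -> slopevec lam u -> form u (phi u) != 0.
  move=> uU u0 hu; apply/eqP => uu; apply: stuck; exact: (hstate_step hst hU uU u0 hu uu).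
have [full|nfull] := eqVneq W fullv.
  exists H, [::]; rewrite cats0; split=> //; split=> //.
  by rewrite -dW full.
have sU := compl_stable hC hU; have sW : stable W := stable_orbits phiD phiZ hC.
have WU z : z \in W -> z \in U -> z = 0 by move=> zW /hU; apply: nW.
have [[lam y] /= hy yW] := HS nfull.
have [w [z [wW zU yE hz]]] := nondeg_slopes hC erefl nW hy hU.
have z0 : z != 0 by apply: contraNneq yW => z0; rewrite yE z0 addr0.
have nz := noiso _ _ zU z0 hz.
have nzz : ~ orth z z by move/(_ 0%N 1%N) => h; move: nz; rewrite -[phi z]/(iter 1 phi z) h eqxx.
pose Dz := <<orb (den lam) z>>%VS.
have sub_span n x : x \in U -> (<<orb n x>> <= U)%VS.
  by move=> xU; apply/span_subvP => x0 /mapP[j _ ->]; apply: stable_iter.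
have itD i : iter i phi z \in Dz.
  apply: stable_iter (stable_orb phiD phiZ hz) _; exact: (mem_orb_iter phi z (den_gt0 lam)).
have nW2 : nondeg (W + Dz)%VS.
  apply: nondeg_add => // [a aD h|w1 d w1W /(subvP (sub_span _ _ zU)) /hU]; last exact.
  by apply: (pairing_nondeg hz hz nzz aD) => i; apply: h.
have hC2 a : a \in (lam, z) :: comps H -> slopevec a.1 a.2.
  by rewrite inE => /orP[/eqP->//|]; apply: hC.
have EW2 : (W + Dz)%VS = <<unzip2 (orbits ((lam, z) :: comps H))>>%VS.
  by rewrite span_orbits_cons addvC.
have full2 : (W + Dz)%VS = fullv.
  apply/eqP/negPn/negP => nfull2; have [[lam' y'] /= hy' yW'] := HS nfull2.
  have [U2 hU2 _] := nondeg_decomp nW2.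
  have [w' [z' [wW' zU' yE' hz']]] := nondeg_slopes hC2 EW2 nW2 hy' hU2.
  have z'0 : z' != 0 by apply: contraNneq yW' => z'0; rewrite yE' z'0 addr0.
  have z'U : z' \in U.
    by apply/hU => x xW; apply: (proj1 (hU2 z') zU'); apply: (subvP (addvSl W Dz)).
  have nz' := noiso _ _ z'U z'0 hz'.
  have ozz : orth z z'.
    apply: (orth_slope hz) => i; apply: (proj1 (hU2 z') zU').
    exact: (subvP (addvSr W Dz) _ (itD i)).
  have [x [x0 hx xx mx]] := isotropic_of_planes hz hz' nz nz' ozz.
  by move: (noiso _ _ (mx U sU zU z'U) x0 hx); rewrite xx eqxx.
exists H, [:: (lam, z)]; split.
  split=> // z1; rewrite inE => /eqP->; split=> // h hh.
  have oz := proj1 (compl_orbits hC hU z) zU; split.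
    by apply: (oz (h.1.1, h.1.2)); apply/flattenP; eexists; [apply: map_f hh|rewrite mem_head].
  by apply: (oz (c%:~R - h.1.1, h.2)); apply/flattenP; eexists; [apply: map_f hh|rewrite !inE eqxx orbT].
have fullE : <<unzip2 (orbits (comps H ++ [:: (lam, z)]))>>%VS = fullv.
  by rewrite orbits_cat /unzip2 map_cat span_cat -!/(unzip2 _) orbits1 -/W full2.
split=> //; have zW : z \notin W by apply: contra z0 => zW; rewrite (WU z).
rewrite orbits_cat size_cat -dW -full2 (simple_dim bs phiD phiZ sW hz zW).
by rewrite size_orbits_cons addn0.
Qed.

End Symplectic.

(** * The group of symplectic similitudes *)

Section SelfDual.
Variables (L : fieldType) (q : L).

(* [X^(2n) P(q/X) = q^n P(X)], written on coefficients. *)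
Definition selfdual (n : nat) (P : {poly L}) : Prop :=
  (size P <= (n + n).+1)%N /\
  forall j, (j <= n + n)%N -> q ^+ j * P`_j = q ^+ n * P`_(n + n - j).

(** Summing over a full rectangle, with the antidiagonal as an indicator, makes the reflection in
    [selfdualM] two independent index reversals. *)
Lemma coefM_box a b (P Q : {poly L}) j : (size P <= a.+1)%N -> (size Q <= b.+1)%N ->
  (P * Q)`_j = \sum_(i < a.+1) \sum_(k < b.+1) (P`_i * Q`_k) * (j == i + k)%N%:R.
Proof.
have E m (R : {poly L}) : (size R <= m.+1)%N -> R = \sum_(i < m.+1) R`_i *: 'X^i.
  move=> h; rewrite -poly_def; apply/polyP => i; rewrite coef_poly.
  by case: ltnP => // h2; rewrite nth_default // (leq_trans h).
move=> hP hQ; rewrite {1}(E _ _ hP) {1}(E _ _ hQ) mulr_suml coef_sum.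
apply: eq_bigr => i _; rewrite mulr_sumr coef_sum; apply: eq_bigr => k _.
by rewrite -scalerAl -scalerAr scalerA -exprD coefZ coefXn.
Qed.

Lemma selfdualM n1 P1 n2 P2 : selfdual n1 P1 -> selfdual n2 P2 ->
  selfdual (n1 + n2) (P1 * P2).
Proof.
move=> [s1 h1] [s2 h2]; split.
  by apply: leq_trans (size_polyMleq _ _) _; lia.
move=> j hj; rewrite !(coefM_box _ s1 s2) !mulr_sumr.
rewrite [RHS](reindex_inj rev_ord_inj); apply: eq_bigr => i _ /=.
rewrite !mulr_sumr [RHS](reindex_inj rev_ord_inj); apply: eq_bigr => k _ /=.
have hi : (i <= n1 + n1)%N by rewrite -ltnS.
have hk : (k <= n2 + n2)%N by rewrite -ltnS.
rewrite !subSS; have -> : (n1 + n2 + (n1 + n2) - j == (n1 + n1 - i) + (n2 + n2 - k))%N = (j == i + k)%N.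
  by lia.
case: eqP => [->|]; rewrite ?mulr0 // !mulr1 !exprD.
by rewrite mulrACA h1 // h2 // mulrACA.
Qed.

Lemma selfdual1 : selfdual 0 1.
Proof. by split; [rewrite size_poly1 | case]. Qed.

Lemma selfdual_prod (I : Type) (r : seq I) (n : I -> nat) (P : I -> {poly L}) :
  (forall a, selfdual (n a) (P a)) -> selfdual (\sum_(a <- r) n a) (\prod_(a <- r) P a).
Proof.
move=> h; elim: r => [|a r IH]; first by rewrite !big_nil; apply: selfdual1.
by rewrite !big_cons; apply: selfdualM.
Qed.

Lemma selfdual_pair (s : nat) (a b : L) : (0 < s)%N -> a * b = q ^+ s ->
  selfdual s (('X^s - a%:P) * ('X^s - b%:P)).
Proof.
move=> s0 ab; have E : ('X^s - a%:P) * ('X^s - b%:P) =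
    'X^(s + s) - (a + b) *: 'X^s + (q ^+ s)%:P :> {poly L}.
  by rewrite -ab exprD -mul_polyC polyCD polyCM; ring.
rewrite {}E; split.
  apply: leq_trans (size_polyD _ _) _; rewrite geq_max; apply/andP; split; last first.
    by apply: leq_trans (size_polyC_leq1 _) _.
  apply: leq_trans (size_polyD _ _) _; rewrite geq_max size_polyXn leqnn size_polyN.
  by apply: leq_trans (size_scale_leq _ _) _; rewrite size_polyXn; lia.
move=> j hj; rewrite !coefD !coefN !coefZ !coefXn !coefC.
have [->|j0] := eqVneq j 0%N.
  have -> : (0 == s + s)%N = false by lia.
  have -> : (0 == s)%N = false by lia.
  have -> : (s + s - 0 == s)%N = false by lia.
  have -> : (s + s - 0 == 0)%N = false by lia.
  by rewrite subn0 !eqxx; rewrite /=; ring.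
have [->|j2] := eqVneq j (s + s)%N.
  rewrite subnn !eqxx; have -> : (s + s == s)%N = false by lia.
  have -> : (0 == s + s)%N = false by lia.
  have -> : (0 == s)%N = false by lia.
  by rewrite exprD /=; ring.
have -> : (s + s - j == s + s)%N = false by lia.
have -> : (s + s - j == 0)%N = false by lia.
have -> : (s + s - j == s)%N = (j == s)%N by lia.
by have [->|js] := eqVneq j s; rewrite /=; ring.
Qed.

(** At j = 0 self-duality reads P_0 = q P_2, which fixes the sign; this is the origin of the sign
    bit in [twc]. *)
Lemma selfdual_plane : selfdual 1 ('X^2 + q%:P).
Proof.
split.
  apply: leq_trans (size_polyD _ _) _; rewrite geq_max size_polyXn leqnn.
  by apply: leq_trans (size_polyC_leq1 _) _.
by move=> [|[|[|//]]] _; rewrite !coefD !coefXn !coefC /=; ring.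
Qed.

End SelfDual.

(** * The standard symplectic form *)

Section StandardForm.
Variables (L : fieldType) (n : nat).
Local Notation J := (Jsp L n).

Definition jform (x y : 'cV[L]_(n + n)) : L := (x^T *m J *m y) 0 0.

Lemma jformDl x y z : jform (x + y) z = jform x z + jform y z.
Proof. by rewrite /jform linearD !mulmxDl mxE. Qed.

Lemma jformZl a x z : jform (a *: x) z = a * jform x z.
Proof. by rewrite /jform linearZ -!scalemxAl mxE. Qed.

Lemma jformDr x y z : jform x (y + z) = jform x y + jform x z.
Proof. by rewrite /jform mulmxDr mxE. Qed.

Lemma jformZr a x z : jform x (a *: z) = a * jform x z.
Proof. by rewrite /jform -scalemxAr mxE. Qed.

Lemma jformNl x z : jform (- x) z = - jform x z.
Proof. by rewrite -scaleN1r jformZl mulN1r. Qed.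

Lemma jformNr x z : jform x (- z) = - jform x z.
Proof. by rewrite -scaleN1r jformZr mulN1r. Qed.

Lemma jform0r x : jform x 0 = 0.
Proof. by rewrite /jform mulmx0 mxE. Qed.

Lemma jform_sumr (I : Type) (r : seq I) (P : pred I) (F : I -> 'cV[L]_(n + n)) x :
  jform x (\sum_(i <- r | P i) F i) = \sum_(i <- r | P i) jform x (F i).
Proof. exact: (big_morph (jform x) (jformDr x) (jform0r x)). Qed.

Lemma jform_suml (I : Type) (r : seq I) (P : pred I) (F : I -> 'cV[L]_(n + n)) y :
  jform (\sum_(i <- r | P i) F i) y = \sum_(i <- r | P i) jform (F i) y.
Proof.
apply: (big_morph (jform^~ y) (fun x z => jformDl x z y)).
by rewrite /jform trmx0 !mul0mx mxE.
Qed.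

Lemma Jsp_tr : J^T = - J.
Proof.
apply/matrixP => i j; rewrite !mxE addnC; case: eqP => [e|]; last by rewrite oppr0.
have hi := ltn_ord i; have hj := ltn_ord j.
case: ltnP => h1; case: ltnP => h2; rewrite ?opprK //; exfalso; lia.
Qed.

Lemma jformC x y : jform y x = - jform x y.
Proof.
rewrite /jform; have -> : y^T *m J *m x = - (x^T *m J *m y)^T; last by rewrite !mxE.
by rewrite !trmx_mul trmxK Jsp_tr mulNmx mulmxN opprK mulmxA.
Qed.

Lemma jform_alt : (2%:R : L) != 0 -> forall x, jform x x = 0.
Proof.
move=> two x; have /eqP := jformC x x; rewrite -addr_eq0 -mulr2n -mulr_natl mulf_eq0.
by rewrite (negbTE two) => /eqP.
Qed.

(** Basis vectors indexed by natural numbers, zero out of range, so that the columns of the model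
    are described by plain index arithmetic. *)
Definition dlt (k : nat) : 'cV[L]_(n + n) := \col_i (i == k :> nat)%:R.

Lemma dltE (i : 'I_(n + n)) : dlt i = delta_mx i 0.
Proof. by apply/matrixP => k l; rewrite ord1 !mxE andbT. Qed.

Lemma jform_dlt k l : (k < n + n)%N -> (l < n + n)%N -> jform (dlt k) (dlt l) =
  if (k + l == (n + n).-1)%N then (if (k < n)%N then 1 else -1) else 0.
Proof.
move=> hk hl; rewrite -[k]/(nat_of_ord (Ordinal hk)) -[l]/(nat_of_ord (Ordinal hl)) !dltE.
by rewrite /jform trmx_delta -rowE -colE !mxE.
Qed.

Lemma jform_mx (A : 'M[L]_(n + n)) a b :
  (A^T *m J *m A) a b = jform (col a A) (col b A).
Proof. by rewrite /jform tr_col -row_mul colE mulmxA -colE -row_mul !mxE. Qed.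

Lemma Jsp_unit : J \in unitmx.
Proof.
suff /mulmx1_unit[] : J *m (- J) = 1%:M by [].
apply/matrixP => i j; rewrite mulmxN !mxE (bigD1 (rev_ord i)) //= big1 => [|k hk]; last first.
  rewrite !mxE; case: eqP => [e|]; last by rewrite mul0r.
  by case/eqP: hk; apply: val_inj => /=; have := ltn_ord i; lia.
rewrite !mxE /= addr0; have hi := ltn_ord i; have hj := ltn_ord j.
have -> : (i + (n + n - i.+1) == (n + n).-1)%N by lia.
have -> : (n + n - i.+1 + j == (n + n).-1)%N = (i == j) by rewrite -val_eqE /=; lia.
case: (eqVneq i j) => [_|_]; last by rewrite mulr0 oppr0.
case: ltnP => h1; case: ltnP => h2; rewrite ?mulr1 ?mul1r ?mulrN1 ?opprK ?mulN1r ?opprK //; exfalso; lia.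
Qed.

Lemma jform_nd x : (forall y, jform x y = 0) -> x = 0.
Proof.
move=> h; apply: trmx_inj; rewrite trmx0; apply: (can_inj (mulmxK Jsp_unit)); rewrite mul0mx.
apply/matrixP => i j; rewrite ord1 [RHS]mxE; have := h (delta_mx j 0).
by rewrite /jform -colE mxE.
Qed.

End StandardForm.

Lemma jform_frob (L : fieldType) (sigma : {rmorphism L -> L}) n (b : 'M[L]_(n + n)) (q : L) :
  b^T *m Jsp L n *m b = q *: Jsp L n ->
  forall x y, jform (frob sigma b x) (frob sigma b y) = q * sigma (jform x y).
Proof.
move=> bJ x y; have sJ : map_mx sigma (Jsp L n) = Jsp L n.
  apply/matrixP => i j; rewrite !mxE; case: ifP => _; last by rewrite rmorph0.
  by case: ifP => _; rewrite ?rmorphN rmorph1.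
rewrite /jform /frob; have -> : (b *m map_mx sigma x)^T *m Jsp L n *m (b *m map_mx sigma y) =
    (map_mx sigma x)^T *m (b^T *m Jsp L n *m b) *m map_mx sigma y.
  by rewrite trmx_mul !mulmxA.
by rewrite bJ -scalemxAr -scalemxAl mxE map_trmx -{1}sJ -!map_mxM mxE.
Qed.

(** * The symplectic model with prescribed polynomial *)

Section GSpModel.
Variables (L : fieldType) (v : L -> int) (sigma : {rmorphism L -> L}).
Variables (p f : nat) (pi : L).
Hypothesis bs : breve_setting v sigma p f pi.
Variables (n : nat) (c : int) (mu : 'I_(n + n) -> int) (P : {poly L}).
Hypothesis n0 : (0 < n)%N.
Hypothesis muc : forall i, mu i + mu (rev_ord i) = c.
Hypothesis mP : P \is monic.
Hypothesis sP : size P = (n + n).+1.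
Hypothesis fP : fixp sigma P.
Hypothesis sdP : selfdual (pi ^ c) n P.
Hypothesis bP : forall j, (j < n + n)%N -> P`_j != 0 ->
  \sum_(i < n + n | (j <= i)%N) mu i <= v P`_j.

Local Notation dlt := (dlt L n).

Definition muz (k : nat) : int := if insub k is Some i then mu i else 0.

Lemma muzE (i : 'I_(n + n)) : muz i = mu i.
Proof. by rewrite /muz valK. Qed.

Lemma muz_rev k : (k < n + n)%N -> muz k + muz ((n + n).-1 - k) = c.
Proof.
move=> hk; rewrite -(muc (Ordinal hk)) -!muzE /=; congr (_ + muz _); lia.
Qed.

Definition hsum (k : nat) : int := \sum_(i < k) muz (n + i).

Lemma hsum_total i : (i <= n)%N -> hsum n - hsum i = \sum_(l < n + n | (n + i <= l)%N) mu l.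
Proof.
move=> hi; rewrite (eq_bigr (fun l : 'I_(n + n) => muz l)) => [|l _]; last by rewrite muzE.
rewrite -(big_geq_mkord (n + i) (n + n) xpredT muz) /hsum.
rewrite -!(big_mkord xpredT (fun i => muz (n + i))) (@big_cat_nat _ _ _ i 0 n) //=.
rewrite addrAC subrr add0r (addnC n i) big_addn addnK.
by apply: eq_big_nat => l _; rewrite addnC.
Qed.

(** Upper-half coefficients of [P], divided by pi raised to the tail sum of [mu] from n + i on; [bP]
    makes the quotient integral. *)
Definition alpha (i : nat) : L := - (P`_(n + i) * pi ^ (hsum i - hsum n)).

Lemma alpha_int i : (i < n)%N -> vge v 0 (alpha i).
Proof.
move=> hi; rewrite (vgeN bs) mulrC (vge_pizM bs) sub0r opprB hsum_total; last exact: ltnW.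
by rewrite /vge; have [//|h] := eqVneq P`_(n + i) 0; rewrite bP //; lia.
Qed.

(* The columns of [u w], with [w] a lift of a Coxeter element of the symplectic
   Weyl group and [u] unipotent with [n] free entries. *)
Definition kcol (k : nat) : 'cV[L]_(n + n) :=
  if k == 0%N then dlt n
  else if (k < n)%N then dlt k.-1 - alpha (n - k) *: dlt n
  else if (k < (n + n).-1)%N then dlt k.+1
  else - dlt n.-1 + \sum_(i < n) alpha i *: dlt (n + i).

Definition kmx : 'M[L]_(n + n) := \matrix_(i, j) kcol j i 0.

Lemma col_kmx j : col j kmx = kcol j.
Proof. by apply/matrixP => i k; rewrite ord1 !mxE. Qed.

Lemma kmx_int : mge v 0 kmx.
Proof.
have hd k i : vge v 0 (dlt k i 0) by rewrite mxE; case: eqP; rewrite ?(vge1 bs) ?vge0.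
move=> i j; rewrite mxE /kcol; case: ifP => // j0; case: ifP => jn.
  rewrite !mxE; apply: (vgeB bs); first by case: eqP; rewrite ?(vge1 bs) ?vge0.
  apply: (vgeMl bs); first by apply: alpha_int; lia.
  by case: eqP; rewrite ?(vge1 bs) ?vge0.
case: ifP => // _; rewrite mxE; apply: (vgeD bs); first by rewrite mxE (vgeN bs).
rewrite summxE; apply: (vge_sum bs) => k _; rewrite mxE.
by apply: (vgeMl bs) => //; apply: alpha_int.
Qed.

Local Notation jf := (@jform L n).

Lemma jf_dlt_sum k (F : nat -> L) : (k < n + n)%N ->
  jf (dlt k) (\sum_(i < n) F i *: dlt (n + i)) = if (k < n)%N then F (n.-1 - k)%N else 0.
Proof.
move=> hk; rewrite jform_sumr; case: ltnP => kn.
  have hk' : (n.-1 - k < n)%N by lia.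
  rewrite (bigD1 (Ordinal hk')) //= jformZr jform_dlt //; last by lia.
  have -> : (k + (n + (n.-1 - k)) == (n + n).-1)%N by lia.
  rewrite kn mulr1 big1 ?addr0 // => i hi; rewrite jformZr jform_dlt //; last by rewrite ltn_add2l.
  case: eqP => [e|]; last by rewrite mulr0.
  by case/eqP: hi; apply: val_inj => /=; lia.
rewrite big1 // => i _; rewrite jformZr jform_dlt //; last by rewrite ltn_add2l.
by case: eqP => [e|]; rewrite ?mulr0 //; exfalso; lia.
Qed.

Lemma kcol_form a b : (a < n + n)%N -> (b < n + n)%N -> jf (kcol a) (kcol b) = jf (dlt a) (dlt b).
Proof.
have two0 : (2%:R : L) != 0 by apply: (natr_neq0 bs).
(* The last column is the only long sum. Keeping it out of the first argument suffices, as
   antisymmetry and alternation give the remaining pairs. *)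
have main a' b' : (a' < (n + n).-1)%N -> (b' < n + n)%N ->
    jf (kcol a') (kcol b') = jf (dlt a') (dlt b').
  move=> ha hb; have ha' : (a' < n + n)%N by lia.
  rewrite (jform_dlt L ha' hb).
  have D x y (hx : (x < n + n)%N) (hy : (y < n + n)%N) := jform_dlt L hx hy.
  have S x (hx : (x < n + n)%N) := jf_dlt_sum alpha hx.
  rewrite /kcol; case: (eqVneq a' 0%N) => [a0|a0].
    rewrite a0; case: (eqVneq b' 0%N) => [->|b0].
      rewrite D; try lia; have -> : (n + n == (n + n).-1)%N = false by lia.
      by have -> : (0 + 0 == (n + n).-1)%N = false by lia.
    case: ifP => bn.
      rewrite jformDr jformNr jformZr !D; try lia.
      have -> : (n + b'.-1 == (n + n).-1)%N = false by lia.
      have -> : (n + n == (n + n).-1)%N = false by lia.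
      have -> : (0 + b' == (n + n).-1)%N = false by lia.
      by rewrite mulr0 subr0.
    case: ifP => bl.
      rewrite D; try lia; have -> : (n + b'.+1 == (n + n).-1)%N = false by lia.
      by have -> : (0 + b' == (n + n).-1)%N = false by lia.
    rewrite jformDr jformNr D ?S; try lia; rewrite ltnn.
    have -> : (n + n.-1 == (n + n).-1)%N by lia.
    have -> : (0 + b' == (n + n).-1)%N by lia.
    by rewrite n0 opprK addr0.
  case: ifP => an.
    case: (eqVneq b' 0%N) => [->|b0].
      rewrite jformDl jformNl jformZl !D; try lia.
      have -> : (a'.-1 + n == (n + n).-1)%N = false by lia.
      have -> : (n + n == (n + n).-1)%N = false by lia.
      have -> : (a' + 0 == (n + n).-1)%N = false by lia.
      by rewrite mulr0 subr0.
    case: ifP => bn.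
      rewrite jformDl jformNl jformZl !jformDr !jformNr !jformZr !D; try lia.
      have -> : (a'.-1 + b'.-1 == (n + n).-1)%N = false by lia.
      have -> : (a'.-1 + n == (n + n).-1)%N = false by lia.
      have -> : (n + b'.-1 == (n + n).-1)%N = false by lia.
      have -> : (n + n == (n + n).-1)%N = false by lia.
      have -> : (a' + b' == (n + n).-1)%N = false by lia.
      by rewrite !(mulr0, subr0).
    case: ifP => bl.
      rewrite jformDl jformNl jformZl !D; try lia.
      have -> : (a'.-1 + b'.+1 == (n + n).-1)%N = (a' + b' == (n + n).-1)%N by lia.
      have -> : (n + b'.+1 == (n + n).-1)%N = false by lia.
      have -> : (a'.-1 < n)%N by lia.
      by rewrite mulr0 subr0.
    rewrite jformDl jformNl jformZl !jformDr !jformNr !D ?S; try lia; rewrite ltnn.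
    have -> : (a'.-1 + n.-1 == (n + n).-1)%N = false by lia.
    have -> : (n + n.-1 == (n + n).-1)%N by lia.
    have -> : (a' + b' == (n + n).-1)%N = false by lia.
    have -> : (a'.-1 < n)%N by lia.
    have -> : (n.-1 - a'.-1 = n - a')%N by lia.
    by rewrite oppr0 opprK addr0 add0r mulr1 subrr.
  rewrite ha; case: (eqVneq b' 0%N) => [->|b0].
    rewrite D; try lia; have -> : (a'.+1 + n == (n + n).-1)%N = false by lia.
    by have -> : (a' + 0 == (n + n).-1)%N = false by lia.
  case: ifP => bn.
    rewrite jformDr jformNr jformZr !D; try lia.
    have -> : (a'.+1 + b'.-1 == (n + n).-1)%N = (a' + b' == (n + n).-1)%N by lia.
    have -> : (a'.+1 + n == (n + n).-1)%N = false by lia.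
    have -> : (a'.+1 < n)%N = false by lia.
    by rewrite mulr0 subr0.
  case: ifP => bl.
    rewrite D; try lia; have -> : (a'.+1 + b'.+1 == (n + n).-1)%N = false by lia.
    by have -> : (a' + b' == (n + n).-1)%N = false by lia.
  rewrite jformDr jformNr D ?S; try lia.
  have -> : (a'.+1 + n.-1 == (n + n).-1)%N = false by lia.
  have -> : (a' + b' == (n + n).-1)%N = false by lia.
  have -> : (a'.+1 < n)%N = false by lia.
  by rewrite oppr0 addr0.
move=> ha hb; have [a1|a1] := ltnP a (n + n).-1; first exact: main.
have [b1|b1] := ltnP b (n + n).-1.
  by rewrite jformC main // -jformC.
have -> : a = b by lia.
by rewrite !(jform_alt two0).
Qed.

Lemma kmx_sympl : kmx^T *m Jsp L n *m kmx = Jsp L n.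
Proof.
apply/matrixP => a b; rewrite jform_mx !col_kmx kcol_form ?ltn_ord //.
by rewrite jform_dlt ?ltn_ord // mxE.
Qed.

(** Preserving the form gives det^2 = 1, so integrality alone makes the matrix invertible over
    O_L. *)
Lemma kmx_GLO : GLO v kmx.
Proof.
split; first exact: kmx_int.
have dJ : \det (Jsp L n) != 0 by rewrite -unitfE -unitmxE Jsp_unit.
have := congr1 determinant kmx_sympl; rewrite !det_mulmx det_tr mulrAC -[RHS]mul1r.
move/(mulIf dJ) => dd; have dk : \det kmx != 0.
  by apply/eqP => h; move: dd; rewrite h mul0r => /eqP; rewrite eq_sym oner_eq0.
split=> //; have := congr1 v dd; rewrite (vM bs) // (v1 bs).
by move: (v _) => z; lia.
Qed.

Lemma kmx_inGSp : inGSp kmx.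
Proof.
split; first exact: GLO_unit kmx_GLO.
by exists 1; rewrite oner_neq0 scale1r kmx_sympl.
Qed.

Definition modelmx := kmx *m pimx pi mu.

Lemma modelmx_cartan : in_cartan v pi (@inGSp L n) modelmx mu.
Proof.
exists kmx, 1%:M; split; first exact: kmx_inGSp.
split; first exact/(GLO_Kmx bs)/kmx_GLO.
split; last by split; [apply/(GLO_Kmx bs)/(GLO1 bs) | rewrite mulmx1].
split; first exact: unitmx1.
by exists 1; rewrite oner_neq0 trmx1 mul1mx mulmx1 scale1r.
Qed.

Lemma modelmx_form x y :
  jf (frob sigma modelmx x) (frob sigma modelmx y) = pi ^ c * sigma (jf x y).
Proof.
apply: jform_frob.
rewrite /modelmx trmx_mul mulmxA -(mulmxA _ kmx^T) -(mulmxA _ _ kmx) kmx_sympl.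
rewrite /pimx tr_diag_mx; apply/matrixP => i j.
rewrite mul_mx_diag mxE mul_diag_mx !mxE; case: eqP => [e|]; last by rewrite !(mulr0, mul0r).
rewrite mulrAC -expfzDr ?(pi_neq0 bs) // -(muc i); congr (pi ^ (_ + mu _) * _).
by apply: val_inj => /=; have := ltn_ord i; lia.
Qed.

Lemma frob_model (j : nat) : (j < n + n)%N ->
  frob sigma modelmx (dlt j) = pi ^ muz j *: kcol j.
Proof.
move=> hj; rewrite -[j]/(nat_of_ord (Ordinal hj)) dltE muzE /frob map_delta_mx -colE.
rewrite -col_kmx; apply/matrixP => i k.
by rewrite mxE /modelmx /pimx mul_mx_diag !mxE mulrC.
Qed.

Local Notation phiB := (frob sigma modelmx).
Let e0 := dlt n.

Lemma hsumS k : hsum k.+1 = hsum k + muz (n + k).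
Proof. by rewrite /hsum big_ord_recr. Qed.

Lemma iter_model k : (k < n)%N -> iter k phiB e0 = pi ^ hsum k *: dlt (n + k).
Proof.
elim: k => [|k IH] hk; first by rewrite /hsum big_ord0 expr0z scale1r addn0.
rewrite iterS IH ?(ltnW hk) // frobZ (sigma_piz bs) frob_model; last by lia.
rewrite scalerA -expfzDr ?(pi_neq0 bs) // -hsumS /kcol.
have -> : (n + k == 0)%N = false by lia.
have -> : (n + k < n)%N = false by lia.
have -> : (n + k < (n + n).-1)%N by lia.
by rewrite addnS.
Qed.

Lemma selfdual_low j : (j <= n)%N -> P`_(n - j) = pi ^ (c * j%:Z) * P`_(n + j).
Proof.
move=> hj; case: sdP => _ /(_ (n - j)%N); have -> : (n + n - (n - j) = n + j)%N by lia.
move=> /(_ (ltac:(lia))) h; have h0 : (pi ^ c) ^+ (n - j) != 0 by rewrite expf_neq0 ?(piz_neq0 bs).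
apply: (mulfI h0); rewrite h mulrA; congr (_ * _).
by rewrite !exprnP !exprz_exp -expfzDr ?(pi_neq0 bs) // -mulrDr -PoszD subnK.
Qed.

Lemma lead_coef_P : P`_(n + n) = 1.
Proof. by move/monicP: mP; rewrite lead_coefE sP. Qed.

Lemma fixp_drop k : fixp sigma (drop_poly k P).
Proof. by apply/polyP => i; rewrite coef_map /= !coef_drop_poly fixp_coef. Qed.

Lemma pact_drop k : pact phiB (drop_poly k P) e0 =
  phiB (pact phiB (drop_poly k.+1 P) e0) + P`_k *: e0.
Proof.
have -> : drop_poly k P = 'X * drop_poly k.+1 P + (P`_k)%:P.
  apply/polyP => -[|i]; rewrite coefD coefXM coefC !coef_drop_poly /= ?add0r ?addr0 //.
  by rewrite addnS addSn.
by rewrite pactD pactC (pactXM (frobD sigma modelmx) (frobZ sigma modelmx) _ (fixp_drop _)).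
Qed.

(** Horner's scheme for [P] at the cyclic vector. The free entries of the first half of the columns
    cancel the lower coefficients of [P], because self-duality expresses these through the upper
    ones. *)
Lemma pact_dual j : (j < n)%N -> pact phiB (drop_poly (n - j) P) e0 =
  - (pi ^ (hsum n + c * j%:Z - hsum j) *: dlt (n.-1 - j)).
Proof.
elim: j => [|j IH] hj.
  rewrite subn0 (@pact_bound _ _ _ n.+1); last by rewrite size_drop_poly sP; lia.
  rewrite big_ord_recr /= coef_drop_poly lead_coef_P scale1r.
  have -> : iter n phiB e0 = phiB (iter n.-1 phiB e0) by rewrite -iterS prednK.
  rewrite iter_model; last by lia.
  rewrite frobZ (sigma_piz bs) frob_model; last by lia.
  rewrite scalerA -expfzDr ?(pi_neq0 bs) // -hsumS (prednK n0) /kcol.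
  have -> : (n + n.-1 == 0)%N = false by lia.
  have -> : (n + n.-1 < n)%N = false by lia.
  have -> : (n + n.-1 < (n + n).-1)%N = false by lia.
  rewrite mulr0 addr0 [hsum 0]big_ord0 subr0 subn0 scalerDr scalerN addrCA scaler_sumr -big_split /=.
  rewrite big1 ?addr0 // => i _; rewrite coef_drop_poly iter_model // !scalerA -scalerDl addnC.
  rewrite /alpha mulrN mulrCA -expfzDr ?(pi_neq0 bs) // [_ + (_ - _)]addrC subrK subrr scale0r //.
have hj' := ltnW hj; rewrite pact_drop; have -> : (n - j.+1).+1 = (n - j)%N by lia.
rewrite IH // (phiN (frobZ sigma modelmx)) frobZ (sigma_piz bs) frob_model; last by lia.
rewrite scalerA -expfzDr ?(pi_neq0 bs) //.
have mE : muz (n.-1 - j) = c - muz (n + j).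
  have := @muz_rev (n + j)%N; have -> : ((n + n).-1 - (n + j) = n.-1 - j)%N by lia.
  by move=> <-; [rewrite addrC addKr | lia].
rewrite mE /kcol; have -> : (n.-1 - j == 0)%N = false by lia.
have -> : (n.-1 - j < n)%N by lia.
have -> : (n - (n.-1 - j) = j.+1)%N by lia.
have -> : ((n.-1 - j).-1 = n.-1 - j.+1)%N by lia.
rewrite scalerBr scalerA opprB selfdual_low // -/e0.
have -> : hsum n + c * j%:Z - hsum j + (c - muz (n + j)) = hsum n + c * j.+1%:Z - hsum j.+1.
  by rewrite hsumS; lia.
rewrite addrAC -scalerDl.
have -> : pi ^ (hsum n + c * j.+1%:Z - hsum j.+1) * alpha j.+1 + pi ^ (c * j.+1%:Z) * P`_(n + j.+1) = 0.
  rewrite /alpha mulrN mulrCA -expfzDr ?(pi_neq0 bs) //.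
  have -> : hsum n + c * j.+1%:Z - hsum j.+1 + (hsum j.+1 - hsum n) = c * j.+1%:Z by lia.
  by rewrite mulrC addNr.
by rewrite scale0r add0r.
Qed.

Lemma pact_model : pact phiB P e0 = 0.
Proof.
rewrite -[P]drop_poly0l pact_drop; have := @pact_dual n.-1; have -> : (n - n.-1 = 1)%N by lia.
move=> ->; last by lia.
rewrite (phiN (frobZ sigma modelmx)) frobZ (sigma_piz bs) subnn frob_model; last by lia.
rewrite /kcol eqxx scalerA -expfzDr ?(pi_neq0 bs) //.
have := selfdual_low (leqnn n); rewrite subnn lead_coef_P mulr1 ?drop_poly0l => ->.
have mE : muz 0 = c - muz (n + n.-1).
  have := @muz_rev (n + n.-1)%N; have -> : ((n + n).-1 - (n + n.-1) = 0)%N by lia.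
  by move=> <-; [rewrite addrC addKr | lia].
have -> : hsum n + c * n.-1%:Z - hsum n.-1 + muz 0 = c * n%:Z.
  have := hsumS n.-1; rewrite (prednK n0) mE => ->; have := prednK n0; nia.
by rewrite addNr.
Qed.

(** The iterates of [e0] give the second half of the standard basis up to powers of [pi], and the
    partial Horner values give the first half. *)
Lemma orbmx_model_unit : orbmx sigma modelmx e0 \in unitmx.
Proof.
apply: orbmx_unit; set W := <<_>>%VS.
have mW Q : pact phiB Q e0 \in W.
  exact: (orb_pact (frobD sigma modelmx) (frobZ sigma modelmx) mP sP pact_model).
apply/vspaceP => x; rewrite memvf (matrix_sum_delta x); apply: memv_suml => i _.
rewrite big_ord1; apply: memvZ; rewrite -dltE; have [hi|hi] := ltnP i n.
  have hj : (n.-1 - i < n)%N by lia.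
  have := mW (drop_poly (n - (n.-1 - i)) P); rewrite pact_dual //.
  have -> : (n.-1 - (n.-1 - i) = i)%N by lia.
  by rewrite memvN rpredZeq (negbTE (piz_neq0 bs _)).
have hj : (i - n < n)%N by have := ltn_ord i; lia.
have := mW 'X^(i - n); rewrite pactXn iter_model // subnKC //.
by rewrite rpredZeq (negbTE (piz_neq0 bs _)).
Qed.

End GSpModel.

(** * Comparison of pairings on two isocrystals *)

Section Matching.
Variables (L : fieldType) (v : L -> int) (sigma : {rmorphism L -> L}).
Variables (p f : nat) (pi : L).
Hypothesis bs : breve_setting v sigma p f pi.

Lemma eigen_iter (vT : vectType L) (phi : vT -> vT)
    (phiZ : forall a x, phi (a *: x) = sigma a *: phi x) s A x k :
  sigma A = A -> iter s phi x = A *: x -> iter (k * s) phi x = A ^+ k *: x.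
Proof.
move=> sA hx; elim: k => [|k IH]; first by rewrite mul0n expr0 scale1r.
have sAk : sigma (A ^+ k) = A ^+ k by rewrite rmorphXn /= sA.
by rewrite mulSn iterD IH (iter_phiZ phiZ) (iter_sigma_fix _ sAk) hx scalerA exprSr.
Qed.

Variables (vT vT' : vectType L) (phi : vT -> vT) (phi' : vT' -> vT').
Hypothesis phiZ : forall a x, phi (a *: x) = sigma a *: phi x.
Hypothesis phiZ' : forall a x, phi' (a *: x) = sigma a *: phi' x.
Variables (form : vT -> vT -> L) (form' : vT' -> vT' -> L) (c : int).
Hypothesis formZl : forall a x z, form (a *: x) z = a * form x z.
Hypothesis formZl' : forall a x z, form' (a *: x) z = a * form' x z.
Hypothesis form_phi : forall x y, form (phi x) (phi y) = pi ^ c * sigma (form x y).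
Hypothesis form_phi' : forall x y, form' (phi' x) (phi' y) = pi ^ c * sigma (form' x y).

(** The eigenvalue equation extends the [s] given values to all left indices. The similitude
    relation reduces the case j <= i to j = 0, where [sigma] acts trivially on the values; adding j
    s to i reaches the other cases. *)
Lemma match_ext s A kap x y X Y : (0 < s)%N -> A != 0 -> sigma A = A -> sigma kap = kap ->
  iter s phi x = A *: x -> iter s phi' X = A *: X ->
  (forall j, sigma (form' (iter j phi' X) Y) = form' (iter j phi' X) Y) ->
  (forall j, (j < s)%N -> form (iter j phi x) y = kap * form' (iter j phi' X) Y) ->
  forall i j, form (iter i phi x) (iter j phi y) = kap * form' (iter i phi' X) (iter j phi' Y).
Proof.
move=> s0 A0 sA sk hx hX fX base.
have sAk k : sigma (A ^+ k) = A ^+ k by rewrite rmorphXn /= sA.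
have ex k i : iter (i + k * s) phi x = A ^+ k *: iter i phi x.
  by rewrite iterD (eigen_iter phiZ _ sA hx) (iter_phiZ phiZ) iter_sigma_fix.
have eX k i : iter (i + k * s) phi' X = A ^+ k *: iter i phi' X.
  by rewrite iterD (eigen_iter phiZ' _ sA hX) (iter_phiZ phiZ') iter_sigma_fix.
have all0 i : form (iter i phi x) y = kap * form' (iter i phi' X) Y.
  rewrite (divn_eq i s) addnC ex eX formZl formZl' base ?ltn_pmod //; exact: mulrCA.
have fk i : sigma (kap * form' (iter i phi' X) Y) = kap * form' (iter i phi' X) Y.
  by rewrite rmorphM /= sk fX.
have ge i j : (j <= i)%N -> form (iter i phi x) (iter j phi y) =
    kap * form' (iter i phi' X) (iter j phi' Y).
  move=> ji; rewrite -(subnKC ji) !iterD (form_iter bs form_phi) (form_iter bs form_phi').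
  by rewrite all0 iter_sigma_fix // iter_sigma_fix // mulrCA.
move=> i j; have hij : (j <= i + j * s)%N by rewrite -[X in (X <= _)%N]add0n leq_add // leq_pmulr.
have := ge _ _ hij; rewrite ex eX formZl formZl' mulrCA; apply: mulfI.
by rewrite expf_neq0.
Qed.

End Matching.

Section FixedVectors.
Variables (L : fieldType) (sigma : {rmorphism L -> L}).

Definition fixv m (x : 'cV[L]_m) : Prop := map_mx sigma x = x.

Lemma fixv_iter m (B : 'M[L]_m) k x : map_mx sigma B = B -> fixv x -> fixv (iter k (frob sigma B) x).
Proof.
move=> fB fx; elim: k => //= k IH; rewrite /fixv /frob map_mxM fB IH.
by rewrite IH.
Qed.

Lemma fixv_pact m (B : 'M[L]_m) (Q : {poly L}) x : map_mx sigma B = B -> fixp sigma Q ->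
  fixv x -> fixv (pact (frob sigma B) Q x).
Proof.
move=> fB fQ fx; rewrite /fixv /pact raddf_sum; apply: eq_bigr => i _ /=.
by rewrite map_mxZ /= (fixp_coef _ fQ) (fixv_iter i fB fx).
Qed.

Lemma jform_fix n (x y : 'cV[L]_(n + n)) : fixv x -> fixv y -> sigma (jform x y) = jform x y.
Proof.
move=> fx fy; rewrite /jform.
have sJ : map_mx sigma (Jsp L n) = Jsp L n.
  apply/matrixP => i j; rewrite !mxE; case: ifP => _; last by rewrite rmorph0.
  by case: ifP => _; rewrite ?rmorphN rmorph1.
have E : map_mx sigma (x^T *m Jsp L n *m y) = x^T *m Jsp L n *m y.
  by rewrite !map_mxM sJ -map_trmx fx fy.
by rewrite -[in RHS]E [RHS]mxE.
Qed.

Lemma fixv_dlt n k : fixv (dlt L n k).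
Proof. by apply/matrixP => i j; rewrite !mxE rmorph_nat. Qed.

(** The model is defined over F; hence the pairings of its F-rational vectors are fixed by [sigma],
    as [match_ext] requires. *)
Lemma fix_modelmx (v : L -> int) p f (pi : L) (n : nat) (mu : 'I_(n + n) -> int) (P : {poly L}) :
  breve_setting v sigma p f pi -> fixp sigma P ->
  map_mx sigma (modelmx pi mu P) = modelmx pi mu P.
Proof.
move=> bs fP; have fal i : sigma (alpha pi mu P i) = alpha pi mu P i.
  by rewrite /alpha rmorphN rmorphM /= fixp_coef // (sigma_piz bs).
rewrite /modelmx map_mxM; congr (_ *m _); last first.
  by rewrite /pimx map_diag_mx; congr diag_mx; apply/matrixP => i j; rewrite !mxE (sigma_piz bs).
have fd k : map_mx sigma (dlt L n k) = dlt L n k by apply: fixv_dlt.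
have fk k : map_mx sigma (kcol pi mu P k) = kcol pi mu P k.
  rewrite /kcol; case: ifP => // _; case: ifP => _.
    by rewrite map_mxB map_mxZ /= !fd fal.
  case: ifP => // _; rewrite map_mxD map_mxN fd raddf_sum; congr (_ + _).
  by apply: eq_bigr => i _ /=; rewrite map_mxZ fal fd.
apply/matrixP => i j; rewrite !mxE -[in RHS](fk j) mxE //.
Qed.

End FixedVectors.

(** * The self-dual polynomial of a symplectic isocrystal *)

Section SymplecticPolynomial.
Variables (L : fieldType) (v : L -> int) (sigma : {rmorphism L -> L}).
Variables (p f : nat) (pi : L).
Hypothesis bs : breve_setting v sigma p f pi.
Variables (vT : vectType L) (phi : vT -> vT).
Hypothesis phiD : forall x y, phi (x + y) = phi x + phi y.
Hypothesis phiZ : forall a x, phi (a *: x) = sigma a *: phi x.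
Variables (form : vT -> vT -> L) (c : int).
Variables (H : seq (rat * vT * vT)) (zs : seq (rat * vT)).
Hypothesis Hh : forall h, h \in H -> hyper pi phi form c h.
Hypothesis zs1 : (size zs <= 1)%N.
Hypothesis Hz : forall z, z \in zs -> [/\ slopevec pi phi z.1 z.2, den z.1 = 2 & numq z.1 = c].

(** One cell for each simple piece: two for a hyperbolic pair, the second marked [true], and one for
    a plane. *)
Definition cells : finType := ('I_(size H) * bool + 'I_(size zs))%type.
Implicit Types a b : cells.

Definition hcell (i : 'I_(size H)) : rat * vT * vT := tnth (in_tuple H) i.
Definition zcell (k : 'I_(size zs)) : rat * vT := tnth (in_tuple zs) k.

Definition lamI (a : cells) : rat := match a with
  | inl (i, t) => if t then c%:~R - (hcell i).1.1 else (hcell i).1.1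
  | inr k => (zcell k).1 end.

Definition vecI (a : cells) : vT := match a with
  | inl (i, t) => if t then (hcell i).2 else (hcell i).1.2
  | inr k => (zcell k).2 end.

(* Pairwise distinct exponents, opposite on dual cells. *)
Definition expI (a : cells) : int := match a with
  | inl (i, t) => if t then - (i.+1)%:Z else (i.+1)%:Z
  | inr _ => 0 end.

Definition dualI (a : cells) : cells := match a with
  | inl (i, t) => inl (i, ~~ t) | inr k => inr k end.

(** Only the plane carries the sign, as required by [selfdual_plane]. *)
Definition eigI (a : cells) : L :=
  twc p pi (if a is inr _ then true else false) (expI a) (numq (lamI a)).

Definition polyI (a : cells) : {poly L} := 'X^(den (lamI a)) - (eigI a)%:P.

Lemma expI_inj : injective expI.
Proof.
move=> [[i t]|k] [[i' t']|k'] /=; try by [case: t | case: t'].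
- case: t; case: t' => //=; try lia.
    by move/oppr_inj => -[e]; congr (inl (_, _)); apply: val_inj.
  by move=> -[e]; congr (inl (_, _)); apply: val_inj.
- by move=> _; congr inr; apply: val_inj; move: (ltn_ord k) (ltn_ord k') => /=; lia.
Qed.

Lemma expI_dual a : expI (dualI a) = - expI a.
Proof. by case: a => [[i []]|k] //=; rewrite ?opprK ?oppr0. Qed.

Lemma eigI_neq0 a : eigI a != 0. Proof. exact: (twc_neq0 bs). Qed.

Lemma sigma_eigI a : sigma (eigI a) = eigI a. Proof. exact: (sigma_twc bs). Qed.

Lemma slopevec_vecI a : slopevec pi phi (lamI a) (vecI a).
Proof.
case: a => [[i t]|k] /=; last by case: (Hz (mem_tnth k (in_tuple zs))).
by case: (Hh (mem_tnth i (in_tuple H))); case: t.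
Qed.

Lemma lamI_dual a : lamI a + lamI (dualI a) = c%:~R.
Proof.
case: a => [[i []]|k] /=; first by rewrite subrK.
  by rewrite addrC subrK.
have [_ d2 nc] := Hz (mem_tnth k (in_tuple zs)).
have := ratE (zcell k).1; rewrite d2 nc => <-; rewrite mulr_natr mulr2n //.
Qed.

Lemma den_dual a : den (lamI (dualI a)) = den (lamI a).
Proof. by rewrite -(den_intB c (lamI a)) -(lamI_dual a) addrC addKr. Qed.

Lemma eigI_dual i t : eigI (inl (i, t)) * eigI (inl (i, ~~ t)) =
  pi ^ (c * (den (lamI (inl (i, t))))%:Z).
Proof.
have [u0 _] := p1_unit bs; set a := inl (i, t).
have nn : numq (lamI a) + numq (lamI (dualI a)) = c * (den (lamI a))%:Z.
  apply/eqP; rewrite -(eqr_int rat) intrD intrM -pmulrn -!ratE den_dual -mulrDl.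
  by rewrite lamI_dual.
rewrite -nn -[inl (i, ~~ t)]/(dualI a) /eigI /twc expI_dual.
rewrite [(-1) ^+ _ * _]mul1r [X in _ * (X * _)]mul1r.
by rewrite mulrACA -expfzDr // addrN expr0z mul1r -expfzDr ?(pi_neq0 bs).
Qed.

(** By [twc_dual] the slopes add up to [c], so the denominators agree and the exponents of 1 + p are
    opposite; distinctness of exponents identifies the cell. *)
Lemma eigI_pair a b : eigI a ^+ den (lamI b) * eigI b ^+ den (lamI a) =
  pi ^ (c * ((den (lamI a))%:Z * (den (lamI b))%:Z)) -> b = dualI a.
Proof.
move/(twc_dual bs) => [ll ee]; have db : den (lamI b) = den (lamI a).
  by rewrite -(den_intB c (lamI a)) -ll addrC addKr.
apply: expI_inj; rewrite expI_dual; have := den_gt0 (lamI a); move: ee; rewrite db.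
nia.
Qed.

Lemma coprime_polyI a b : a != b -> coprimep (polyI a) (polyI b).
Proof.
move=> ab; apply: coprimep_XnsubC; apply: contra ab => /eqP/(twc_inj bs)[_ e].
exact/eqP/expI_inj.
Qed.

Lemma fixp_polyI a : fixp sigma (polyI a).
Proof. exact/fixpXnsubC/sigma_eigI. Qed.

Lemma big_cells (R : Type) (idx : R) (op : Monoid.com_law idx) (F : cells -> R) :
  \big[op/idx]_a F a = op (\big[op/idx]_(i < size H) op (F (inl (i, true))) (F (inl (i, false))))
    (\big[op/idx]_(k < size zs) F (inr k)).
Proof.
rewrite big_sumType; congr (op _ _).
rewrite (eq_bigr (fun q => F (inl (q.1, q.2)))) => [|[i t] _] //.
rewrite -(pair_bigA _ (fun i t => F (inl (i, t)))) /=; apply: eq_bigr => i _.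
by rewrite big_bool.
Qed.

Lemma sum_cells (R : nmodType) (F : rat -> R) :
  \sum_(x <- comps c H ++ zs) F x.1 = \sum_a F (lamI a).
Proof.
rewrite big_cat big_cells /=; congr (_ + _); last by rewrite big_tnth.
rewrite /comps big_flatten big_map big_tnth; apply: eq_bigr => i _.
by rewrite !big_cons big_nil /= [X in _ + X]addr0 addrC.
Qed.

Hypothesis sz : size (orbits phi (comps c H ++ zs)) = \dim {:vT}.

Lemma gauss_polyI : gauss_bound v (\dim {:vT}) (\prod_a polyI a)
   (fun t => \sum_(x <- orbits phi (comps c H ++ zs)) Num.max 0 (t - x.1))
   (\sum_(x <- orbits phi (comps c H ++ zs)) x.1).
Proof.
have [h1 h2 h3 h4] := gauss_bound_prod bs (index_enum cells)
  (fun a => gauss_bound_XnsubC bs (eigI_neq0 a) (v_twc bs _ _ _)).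
have szE : \dim {:vT} = (\sum_a den (lamI a))%N.
  by rewrite -sz size_orbits (sum_cells den).
split=> //; rewrite ?szE //.
  by rewrite (sum_orbits phi _ id) (sum_cells (fun s => (den s)%:R * s)).
move=> t j hj; rewrite (sum_orbits phi _ (fun s => Num.max 0 (t - s))).
by rewrite (sum_cells (fun s => (den s)%:R * Num.max 0 (t - s))); apply: h4.
Qed.

Lemma selfdual_polyI n : \dim {:vT} = (n + n)%N -> selfdual (pi ^ c) n (\prod_a polyI a).
Proof.
move=> dn; have sumE : (n + n = \sum_a den (lamI a))%N.
  by rewrite -dn -sz size_orbits (sum_cells den).
have nE : n = (\sum_(i < size H) den (hcell i).1.1 + \sum_(k < size zs) 1)%N.
  have E : (\sum_a den (lamI a) = \sum_(i < size H) den (hcell i).1.1 * 2 + \sum_(k < size zs) 2)%N.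
    rewrite big_cells /=; congr (_ + _)%N; last first.
      by apply: eq_bigr => k _; case: (Hz (mem_tnth k (in_tuple zs))).
    by apply: eq_bigr => i _; rewrite den_intB addnn muln2.
  move: E; rewrite -sumE -big_distrl /= !sum_nat_const !card_ord; lia.
rewrite nE big_cells /=; apply: selfdualM.
  apply: selfdual_prod => i; rewrite mulrC /polyI /= den_intB; apply: selfdual_pair; first exact: den_gt0.
  by have := eigI_dual i false; rewrite exprnP exprz_exp.
apply: selfdual_prod => k; rewrite /polyI /eigI /=.
have [_ d2 nc] := Hz (mem_tnth k (in_tuple zs)); rewrite d2 nc /twc expr1 expr0z mulr1 mulN1r.
by rewrite polyCN opprK; apply: selfdual_plane.
Qed.

End SymplecticPolynomial.

(** * A vector with prescribed Gram matrix *)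

Section SymplecticVector.
Variables (L : fieldType) (v : L -> int) (sigma : {rmorphism L -> L}).
Variables (p f : nat) (pi : L).
Hypothesis bs : breve_setting v sigma p f pi.
Variables (n : nat) (phi : 'cV[L]_(n + n) -> 'cV[L]_(n + n)).
Hypothesis n0 : (0 < n)%N.
Hypothesis phiD : forall x y, phi (x + y) = phi x + phi y.
Hypothesis phiZ : forall a x, phi (a *: x) = sigma a *: phi x.
Variables (form : 'cV[L]_(n + n) -> 'cV[L]_(n + n) -> L) (c : int).
Hypothesis formDl : forall x y z, form (x + y) z = form x z + form y z.
Hypothesis formZl : forall a x z, form (a *: x) z = a * form x z.
Hypothesis formDr : forall x y z, form x (y + z) = form x y + form x z.
Hypothesis formZr : forall a x z, form x (a *: z) = a * form x z.
Hypothesis form_alt : forall x, form x x = 0.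
Hypothesis form_phi : forall x y, form (phi x) (phi y) = pi ^ c * sigma (form x y).
Variables (H : seq (rat * 'cV[L]_(n + n) * 'cV[L]_(n + n))) (zs : seq (rat * 'cV[L]_(n + n))).
Hypothesis Hh : forall h, h \in H -> hyper pi phi form c h.
Hypothesis Hp : pworth phi form H.
Hypothesis zs1 : (size zs <= 1)%N.
Hypothesis Hz : forall z, z \in zs -> [/\ slopevec pi phi z.1 z.2, form z.2 (phi z.2) != 0 &
   forall h, h \in H -> orth phi form h.1.2 z.2 /\ orth phi form h.2 z.2].
Hypothesis sz : size (orbits phi (comps c H ++ zs)) = (n + n)%N.

Local Notation cells := (cells H zs).
Local Notation polyI := (@polyI L p pi _ c H zs).
Local Notation eigI := (@eigI L p pi _ c H zs).
Local Notation lamI := (@lamI L _ c H zs).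
Local Notation vecI := (@vecI L _ H zs).
Local Notation PI := (\prod_(a : cells) polyI a).

Variable mu : 'I_(n + n) -> int.
Hypothesis muc : forall i, mu i + mu (rev_ord i) = c.

Lemma plane_slope z : z \in zs -> [/\ slopevec pi phi z.1 z.2, den z.1 = 2 & numq z.1 = c].
Proof.
move=> hz; have [h1 h2 _] := Hz hz; split=> //.
  by have [] := anisotropic_slope bs phiZ formZl formZr form_alt form_phi h1 h2.
by have [] := anisotropic_slope bs phiZ formZl formZr form_alt form_phi h1 h2.
Qed.

Lemma vecI_orth (a b : cells) : b != dualI a -> orth phi form (vecI a) (vecI b).
Proof.
have oC := @orthC _ _ phi form formDl formDr form_alt.
have hin (i : 'I_(size H)) : hcell i \in H by apply: mem_tnth.
have zin (k : 'I_(size zs)) : zcell k \in zs by apply: mem_tnth.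
case: a b => [[i t]|k] [[i' t']|k'] /= ne.
- have [e|ii] := eqVneq i i'; last first.
    have hn (j : 'I_(size H)) : hcell j = nth (0, 0, 0) H j by rewrite /hcell (tnth_nth (0, 0, 0)).
    have [] := Hp (ltn_ord i) (ltn_ord i') ii; rewrite -!hn.
    by case: t {ne}; case: t'.
  have [_ _ o1 o2 _] := Hh (hin i); move: ne; rewrite -e.
  by case: t; case: t' => //=; rewrite eqxx.
- by have [_ _ /(_ _ (hin i))[o1 o2]] := Hz (zin k'); case: t {ne}.
- have [_ _ /(_ _ (hin i'))[o1 o2]] := Hz (zin k); case: t' {ne}; exact: oC.
- case/eqP: ne; congr inr; apply: val_inj => /=.
  have := leq_trans (ltn_ord k) zs1; have := leq_trans (ltn_ord k') zs1.
  by rewrite !ltnS !leqn0 => /eqP-> /eqP->.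
Qed.

Hypothesis bP : forall j, (j < n + n)%N -> PI`_j != 0 ->
  \sum_(i < n + n | (j <= i)%N) mu i <= v PI`_j.

Local Notation B := (modelmx pi mu PI).
Local Notation phiB := (frob sigma B).
Local Notation jf := (@jform L n).
Let e0 := dlt L n n.

Lemma cell_poly_facts : [/\ PI \is monic, size PI = (n + n).+1, fixp sigma PI & selfdual (pi ^ c) n PI].
Proof.
have sz' : size (orbits phi (comps c H ++ zs)) = \dim {: 'cV[L]_(n + n)} by rewrite dim_cV.
have := gauss_polyI bs sz'; rewrite dim_cV => -[h1 h2 _ _]; split=> //.
  by apply: fixp_prod => a _; apply: (fixp_polyI bs).
by apply: (selfdual_polyI bs zs1 plane_slope sz'); rewrite dim_cV.
Qed.

(** The cyclic vector of the model is split along the cells, and each component is matched by a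
    vector in the corresponding piece of V so that all pairings agree up to one factor [kap]. *)
Lemma match_cyclic_vector : exists x kap, [/\ kap != 0, pact phi PI x = 0 &
  forall i j, form (iter i phi x) (iter j phi x) = kap * jf (iter i phiB e0) (iter j phiB e0)].
Proof.
have [mP sP fP sdP] := cell_poly_facts.
have two0 : (2%:R : L) != 0 by apply: (natr_neq0 bs).
have fB : map_mx sigma B = B by apply: (fix_modelmx mu bs fP).
have BD := frobD sigma B; have BZ := frobZ sigma B.
have jphi x y : jf (phiB x) (phiB y) = pi ^ c * sigma (jf x y).
  exact: (modelmx_form bs n0 muc mP sP).
have palt := pact_model bs n0 muc mP sP fP sdP.
have fpol (a : cells) : fixp sigma (polyI a) by apply: (fixp_polyI bs).
have cpol (a b : cells) : a != b -> coprimep (polyI a) (polyI b).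
  exact: (coprime_polyI bs c zs1).
have [Q [fQ kQ sQ]] := primary_decomposition BD BZ fpol cpol palt.
pose X (a : cells) := pact phiB (Q a) e0.
have eX a : iter (den (lamI a)) phiB (X a) = eigI a *: X a by apply/pact_XnsubC/kQ.
have fX i a : fixv sigma (iter i phiB (X a)).
  by apply: fixv_iter => //; apply: fixv_pact => //; apply: fixv_dlt.
have sA (a : cells) : sigma (eigI a) = eigI a by apply: (sigma_eigI bs).
have A0 (a : cells) : eigI a != 0 by apply: (eigI_neq0 bs).
have eXi i a : iter (den (lamI a)) phiB (iter i phiB (X a)) = eigI a *: iter i phiB (X a).
  by rewrite iter_phiC eX (iter_phiZ BZ) iter_sigma_fix.
(* The pairing of two eigencomponents is fixed by [sigma]; if non-zero, the similitude relation
   forces the equation of [eigI_pair] between the eigenvalues. *)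
have Borth (a b : cells) i j : b != dualI a -> jf (iter i phiB (X a)) (iter j phiB (X b)) = 0.
  move=> ab; apply/eqP/negPn/negP => nz; case/eqP: ab; apply: (eigI_pair bs zs1).
  have := form_iter bs jphi (den (lamI b) * den (lamI a)) (iter i phiB (X a)) (iter j phiB (X b)).
  rewrite (eigen_iter BZ _ (sA a) (eXi i a)) mulnC (eigen_iter BZ _ (sA b) (eXi j b)).
  rewrite jformZl jformZr iter_sigma_fix; last by apply: jform_fix; apply: fX.
  by rewrite mulrA => /(mulIf nz) E; apply: etrans E _; congr (pi ^ _); rewrite PoszM.
have [w hw] : exists w, forall a : cells, w a != 0 /\
    iter (den (lamI a)) phi (w a *: vecI a) = eigI a *: (w a *: vecI a).
  apply: (choose_fun (R := fun (a : cells) w => w != 0 /\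
    iter (den (lamI a)) phi (w *: vecI a) = eigI a *: (w *: vecI a))) => a.
  have [w] := twist_vec bs phiZ (if a is inr _ then true else false) (expI a)
    (slopevec_vecI Hh plane_slope a).
  by exists w.
pose z (k : 'I_(size zs)) := w (inr k) *: vecI (inr k).
have itE j : iter j phiB e0 = \sum_a iter j phiB (X a).
  by rewrite -(iter_phi_sum BD BZ) sQ.
have uE := orbmx_model_unit bs n0 muc mP sP fP sdP.
have spanE (y0 : 'cV[L]_(n + n)) :
    y0 = \sum_(k < n + n) (invmx (orbmx sigma B e0) *m y0) k 0 *: iter k phiB e0.
  rewrite -{1}[y0](mulKVmx uE); apply/matrixP => i j; rewrite ord1 [LHS]mxE summxE.
  by apply: eq_bigr => k _; rewrite [orbmx _ _ _ _ _]mxE [RHS]mxE mulrC.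
(* Were this value zero, the plane component would be orthogonal to the whole orbit of [e0], hence
   zero, and the cofactor [R], of degree below 2n, would kill the cyclic vector. *)
have Znz k : jf (X (inr k)) (phiB (X (inr k))) != 0.
  apply/eqP => Z0; have [_ d2 _] := plane_slope (mem_tnth k (in_tuple zs)).
  have hZ j : jf (X (inr k)) (iter j phiB e0) = 0.
    rewrite itE jform_sumr big1 // => b _; have [->|nb] := eqVneq b (inr k); last first.
      exact: (Borth (inr k) b 0%N j nb).
    rewrite (divn_eq j (den (lamI (inr k)))) addnC iterD (eigen_iter BZ _ (sA _) (eX _)).
    rewrite (iter_phiZ BZ) iter_sigma_fix; last by rewrite rmorphXn /= sA.
    rewrite jformZr; have := ltn_pmod j (den_gt0 (lamI (inr k))); rewrite {2}[den _]d2.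
    case: (j %% _)%N => [|[|//]] _ /=; first by rewrite (jform_alt two0) mulr0.
    by rewrite Z0 mulr0.
  have X0 : X (inr k) = 0.
    apply: jform_nd => y0; rewrite (spanE y0) jform_sumr big1 // => j _.
    by rewrite jformZr hZ mulr0.
  pose R := \prod_(b : cells | b != inr k) polyI b.
  have PE : PI = polyI (inr k) * R by rewrite (bigD1 (inr k)).
  have R0 : R != 0.
    by apply/eqP => R0; move: sP; rewrite PE R0 mulr0 size_poly0.
  have fR : fixp sigma R by apply: fixp_prod => b _; apply: fpol.
  have pR : pact phiB R e0 = 0.
    have -> : pact phiB R e0 = \sum_b pact phiB R (X b) by rewrite -(pact_sumr BD BZ) sQ.
    apply: big1 => b _; have [->|nb] := eqVneq b (inr k); first by rewrite X0 (pact0r BZ).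
    have [R' ->] : {R' | R = R' * polyI b}.
      by eexists; rewrite /R (bigD1 b) //= mulrC.
    rewrite (pactM BD BZ _ _ (fpol b)) kQ; exact: (pact0r BZ).
  have sR : (size R <= n + n)%N.
    have := sP; rewrite PE size_mul //; last first.
      by apply/eqP => h; move: sP; rewrite PE h mul0r size_poly0.
    rewrite size_XnsubC ?den_gt0 //; move: (den_gt0 (lamI (inr k))).
    move: (den _) (size (polyseq R)) => d r; lia.
  case/eqP: R0; apply/polyP => i; rewrite coef0; have [hi|hi] := ltnP i (n + n); last first.
    by rewrite nth_default // (leq_trans sR).
  have E0 : orbmx sigma B e0 *m (\col_(i < n + n) R`_i) = 0.
    move: pR; rewrite (pact_bound _ _ sR) => E; apply/matrixP => l m.
    rewrite ord1 -E summxE [LHS]mxE.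
    by apply: eq_bigr => q _; rewrite [orbmx _ _ _ _ _]mxE [RHS]mxE [X in _ * X]mxE mulrC.
  have := congr1 (fun z : 'cV[L]_(n + n) => z (Ordinal hi) 0) (can_inj (mulKmx uE) (etrans E0 (esym (mulmx0 _ _)))).
  by rewrite !mxE.
(* The ratio of the two invariants of the plane, or 1 without a plane. It lies in F: with eigenvalue
   -pi^c the invariant of [z k0] is fixed by [sigma], like that of the model. *)
have [kap [kap0 sk kapE]] : exists kap, [/\ kap != 0, sigma kap = kap &
    forall k, form (z k) (phi (z k)) = kap * jf (X (inr k)) (phiB (X (inr k)))].
  case: (posnP (size zs)) => [s0|s0].
    by exists 1; rewrite oner_neq0 rmorph1; split=> // k; have := leq_trans (ltn_ord k) (eq_leq s0).
  pose k0 := Ordinal s0; exists (form (z k0) (phi (z k0)) / jf (X (inr k0)) (phiB (X (inr k0)))).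
  have [_ fz _] := Hz (mem_tnth k0 (in_tuple zs)); have [wz ez] := hw (inr k0).
  have tz : form (z k0) (phi (z k0)) != 0.
    by rewrite /z phiZ formZl formZr !mulf_neq0 // fmorph_eq0.
  split; first by rewrite mulf_neq0 ?invr_eq0.
    rewrite fmorph_div; congr (_ / _); last by apply: jform_fix; [apply: (fX 0%N) | apply: (fX 1%N)].
    apply: (mulfI (piz_neq0 bs c)); rewrite -form_phi.
    have [_ d2 nc] := plane_slope (mem_tnth k0 (in_tuple zs)).
    move: ez; rewrite /lamI /= d2 /= -/(z k0) => ->.
    rewrite formZr (form_antisym formDl formDr form_alt) /eigI /twc /= nc expr1 expr0z mulr1; ring.
  move=> k; have -> : k = k0 by apply: val_inj => /=; have := leq_trans (ltn_ord k) zs1; rewrite ltnS leqn0 => /eqP.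
  by rewrite divfK.
(* The partner in each hyperbolic pair is chosen to have the pairings of the model with the already
   rescaled first vector, times [kap]. *)
have [y hy] : exists y : 'I_(size H) -> 'cV[L]_(n + n), forall i,
    y i \in <<orb phi (den (c%:~R - (hcell i).1.1)) (hcell i).2>>%VS /\
    forall j, (j < den (hcell i).1.1)%N -> form (iter j phi (w (inl (i, false)) *: vecI (inl (i, false)))) (y i)
      = kap * jf (iter j phiB (X (inl (i, false)))) (X (inl (i, true))).
  apply: (choose_fun (R := fun i y =>
    y \in <<orb phi (den (c%:~R - (hcell i).1.1)) (hcell i).2>>%VS /\
    forall j, (j < den (hcell i).1.1)%N -> form (iter j phi (w (inl (i, false)) *: vecI (inl (i, false)))) y
      = kap * jf (iter j phiB (X (inl (i, false)))) (X (inl (i, true))))) => i.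
  have [y yD yE] := ex_dual_vector bs phiD phiZ formDl formZl formDr formZr form_alt form_phi
    (fun j => (iter j sigma (w (inl (i, false))))^-1 *
       (kap * jf (iter j phiB (X (inl (i, false)))) (X (inl (i, true)))))
    (Hh (mem_tnth i (in_tuple H))).
  exists y; split=> // j hj; rewrite (iter_phiZ phiZ) formZl yE // mulrA divff ?mul1r //.
  by rewrite iter_sigma_eq0; case: (hw (inl (i, false))).
pose x (a : cells) : 'cV[L]_(n + n) :=
  if a is inl (i, true) then y i else w a *: vecI a.
have fjf a b j : sigma (jf (iter j phiB (X a)) (X b)) = jf (iter j phiB (X a)) (X b).
  by apply: jform_fix; [apply: fX | apply: (fX 0%N)].
have pair1 i k l : form (iter k phi (x (inl (i, false)))) (iter l phi (x (inl (i, true)))) =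
    kap * jf (iter k phiB (X (inl (i, false)))) (iter l phiB (X (inl (i, true)))).
  have [_ e1] := hw (inl (i, false)); have [_ e2] := hy i.
  exact: (match_ext bs phiZ BZ formZl (@jformZl L n) form_phi jphi (den_gt0 _) (A0 _) (sA _) sk
    e1 (eX _) (fjf _ _) e2).
(* The partner was prescribed only by pairings, yet it satisfies the dual eigenvalue equation: the
   defect pairs to zero with the orbit of the first vector, so [pairing_nondeg] kills it. *)
have ex a : iter (den (lamI a)) phi (x a) = eigI a *: x a.
  case: a => [[i t]|k]; last by case: (hw (inr k)).
  case: t; last by case: (hw (inl (i, false))).
  have [hx1 hx2 _ _ nxy] := Hh (mem_tnth i (in_tuple H)); have [yD _] := hy i.
  apply/eqP; rewrite -subr_eq0; apply/eqP.
  apply: (pairing_nondeg bs phiD phiZ formDl formZl formDr formZr form_alt form_phi hx1 hx2 nxy).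
    apply: memvB; last exact: memvZ.
    exact: (stable_iter _ (stable_orb phiD phiZ hx2) yD).
  move=> k; have [w0 _] := hw (inl (i, false)).
  have w0' : iter k sigma (w (inl (i, false))) != 0 by rewrite iter_sigma_eq0.
  apply: (mulfI w0'); rewrite mulr0 -formZl -(iter_phiZ phiZ) -scaleN1r formDr !formZr.
  have := pair1 i k (den (lamI (inl (i, true)))); rewrite eX jformZr => ->.
  by have := pair1 i k 0%N => /= ->; ring.
have xmem a k : iter k phi (x a) \in <<orb phi (den (lamI a)) (vecI a)>>%VS.
  have st := stable_orb phiD phiZ (slopevec_vecI Hh plane_slope a).
  apply: stable_iter st _; case: a => [[i t]|l]; last first.
    exact/memvZ/(mem_orb_iter phi _ (den_gt0 _)).
  case: t; first by case: (hy i).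
  exact/memvZ/(mem_orb_iter phi _ (den_gt0 _)).
have pairs (a b : cells) k l : form (iter k phi (x a)) (iter l phi (x b)) =
    kap * jf (iter k phiB (X a)) (iter l phiB (X b)).
  have [->|nb] := eqVneq b (dualI a); last first.
    rewrite Borth // mulr0.
    exact: (orth_span formDl formZl formDr formZr form_alt (vecI_orth nb) (xmem a k) (xmem b l)).
  case: a => [[i []]|q]; [| exact: pair1 |].
    by rewrite (form_antisym formDl formDr form_alt) jformC mulrN; congr (- _); apply: pair1.
  have [_ e1] := hw (inr q); have [_ d2 _] := plane_slope (mem_tnth q (in_tuple zs)).
  apply: (match_ext bs phiZ BZ formZl (@jformZl L n) form_phi jphi (den_gt0 _) (A0 _) (sA _) sk
    (* The plane has two iterates: the value at j = 0 vanishes by alternation, and the one at j = 1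
       was used to define [kap]. *)
    e1 (eX _) (fjf _ _)) => j; rewrite {1}[den _]d2.
  case: j => [|[|//]] _ /=; first by rewrite form_alt (jform_alt two0) mulr0.
  by rewrite (form_antisym formDl formDr form_alt) kapE jformC mulrN opprK.
exists (\sum_a x a), kap; split=> //.
  have kx a : pact phi (polyI a) (x a) = 0 by apply/pact_XnsubC.
  by have [] := crt_component phiD phiZ fpol cpol kx.
move=> i j; rewrite !(iter_phi_sum phiD phiZ) !itE.
rewrite (form_suml formDl formZl) jform_suml mulr_sumr; apply: eq_bigr => a _.
rewrite (form_sumr formDl formZl formDr form_alt) jform_sumr mulr_sumr.
by apply: eq_bigr => b _; apply: pairs.
Qed.

End SymplecticVector.

(** * The similitude group: normalisation and conclusion *)

Theorem hodge_newton_GSp (L : fieldType) (v : L -> int) (sigma : {rmorphism L -> L})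
    (p f : nat) (pi : L) (n : nat) (b : 'M[L]_(n + n)) (nu : 'I_(n + n) -> rat)
    (mu : 'I_(n + n) -> int) :
  breve_setting v sigma p f pi -> (0 < n)%N -> inGSp b -> newton_point v sigma pi b nu ->
  cochar_GSp mu -> dom_le nu mu ->
  exists g : 'M[L]_(n + n), inGSp g /\
    in_cartan v pi (@inGSp L n) (invmx g *m b *m map_mx sigma g) mu.
Proof.
move=> bs n0 [ub [c0 [c00 bJ]]] [dnu [P0 [uP [b'0 bK]]]] coch dle.
have two0 : (2%:R : L) != 0 by apply: (natr_neq0 bs).
(* The similitude factor is pi^c times the unit [u]. Scaling the form by a [w] with sigma(w) = u w
   absorbs the unit. *)
pose c := v c0; pose u := c0 * pi ^ (- c).
have u0 : u != 0 by rewrite mulf_neq0 // (piz_neq0 bs).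
have vu : v u = 0 by rewrite (vM bs) ?(piz_neq0 bs) // (v_piz bs) subrr.
have [w w0 wE] := lang_scalar bs (isT : (0 < 1)%N) u0 vu; rewrite /= in wE.
pose form (x y : 'cV[L]_(n + n)) := w * jform x y; set phi := frob sigma b.
have phiD := frobD sigma b; have phiZ := frobZ sigma b.
have formDl x y z : form (x + y) z = form x z + form y z by rewrite /form jformDl mulrDr.
have formZl a x z : form (a *: x) z = a * form x z by rewrite /form jformZl mulrCA.
have formDr x y z : form x (y + z) = form x y + form x z by rewrite /form jformDr mulrDr.
have formZr a x z : form x (a *: z) = a * form x z by rewrite /form jformZr mulrCA.
have form_alt x : form x x = 0 by rewrite /form (jform_alt two0) mulr0.
have form_nd x : (forall y, form x y = 0) -> x = 0.
  move=> h; apply: jform_nd => y; apply: (mulfI w0); rewrite mulr0; exact: h.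
have form_phi x y : form (phi x) (phi y) = pi ^ c * sigma (form x y).
  rewrite /form (jform_frob sigma bJ) rmorphM /= wE /u.
  have -> : pi ^ c * (c0 * pi ^ (- c) * w * sigma (jform x y)) =
    pi ^ c * pi ^ (- c) * (w * (c0 * sigma (jform x y))) by ring.
  by rewrite -expfzDr ?(pi_neq0 bs) // subrr expr0z mul1r.
have HS := slope_spanned_newton bs uP erefl b'0 bK.
have [H [zs [[Hh Hp zs1 Hz] [full sz]]]] := symplectic_decomposition bs phiD phiZ
  formDl formZl formDr formZr form_alt form_nd form_phi HS.
have hC a : a \in comps c H ++ zs -> slopevec pi phi a.1 a.2.
  by rewrite mem_cat => /orP[/(hyper_slope Hh)|/Hz[]].
have sumE (F : rat -> rat) :
    \sum_(x <- orbits phi (comps c H ++ zs)) F x.1 = \sum_i F (nu i).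
  apply: (slope_basis_sum bs uP erefl b'0 bK) => //; last by rewrite sz dim_cV.
  exact: (slopevec_orbits bs phiZ hC).
have sz' := sz; rewrite dim_cV in sz'.
pose PI := \prod_(a : cells H zs) polyI p pi c a.
have gb := gauss_polyI bs sz; rewrite dim_cV -/PI in gb.
have gb' : gauss_bound v (n + n) PI (fun t => \sum_i Num.max 0 (t - nu i)) (\sum_i nu i).
  have [h1 h2 h3 h4] := gb; split=> //; first by rewrite (sumE id) in h3.
  by move=> t j hj; rewrite -(sumE (fun s => Num.max 0 (t - s))); apply: h4.
have bP := newton_hodge_bound gb' dnu dle.
have [mP sP fP sdP] := cell_poly_facts bs phiZ formZl formZr form_alt form_phi zs1 Hz sz'.
(* Self-duality at index 0 gives P_0 = pi^(cn), so [mu] has total cn; the constant sum of opposite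
   entries of [mu] must then be [c]. *)
have muc i : mu i + mu (rev_ord i) = c.
  have [_ _ [_ vP0] _] := gb'; have := (proj2 sdP) 0%N isT.
  rewrite expr0 mul1r subn0; have -> : PI`_(n + n) = 1 by move/monicP: mP; rewrite lead_coefE sP.
  rewrite mulr1 => P0E; move: vP0; rewrite P0E (vX bs) ?(piz_neq0 bs) // (v_piz bs).
  rewrite (proj2 dle) -rmorph_sum => /intr_inj E.
  have E2 : \sum_j (mu j + mu (rev_ord j)) = (mu i + mu (rev_ord i)) * (n + n)%:Z.
    rewrite (eq_bigr (fun=> mu i + mu (rev_ord i))) => [|j _]; last exact: coch.
    by rewrite sumr_const card_ord -mulr_natr natz.
  have Er : \sum_j mu (rev_ord j) = \sum_j mu j by rewrite [RHS](reindex_inj rev_ord_inj).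
  move: E2; rewrite big_split /= Er -E.
  move: (mu i + _) => d; nia.
have [x [kap [kap0 hx gram]]] := match_cyclic_vector bs n0 phiD phiZ formDl formZl formDr
  formZr form_alt form_phi Hh Hp zs1 Hz sz' muc.
pose B := modelmx pi mu PI; pose e0 := dlt L n n.
have uB := orbmx_model_unit bs n0 muc mP sP fP sdP; rewrite -/B -/e0 in uB.
have colE m (M : 'M[L]_m) y k : col k (orbmx sigma M y) = iter k (frob sigma M) y.
  by apply/matrixP => i j; rewrite ord1 !mxE.
have GE : w *: ((orbmx sigma b x)^T *m Jsp L n *m orbmx sigma b x) =
    kap *: ((orbmx sigma B e0)^T *m Jsp L n *m orbmx sigma B e0).
  by apply/matrixP => i j; rewrite [LHS]mxE [RHS]mxE !jform_mx !colE; apply: gram.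
(* The orbit of [x] is a basis because its Gram matrix is a non-zero multiple of the non-degenerate
   one of the model. *)
have ux : orbmx sigma b x \in unitmx.
  have := congr1 determinant GE; rewrite !detZ !det_mulmx det_tr => E.
  rewrite unitmxE unitfE; apply/eqP => d0; move: E; rewrite d0 mulr0 mulr0 => /esym/eqP.
  have dB : \det (orbmx sigma B e0) != 0 by rewrite -unitfE -unitmxE.
  have dJ : \det (Jsp L n) != 0 by rewrite -unitfE -unitmxE Jsp_unit.
  by rewrite !mulf_eq0 expf_eq0 (negbTE kap0) andbF det_tr (negbTE dB) (negbTE dJ).
have [ug gE] := cyclic_conj mP sP hx (pact_model bs n0 muc mP sP fP sdP) ux uB.
exists (orbmx sigma b x *m invmx (orbmx sigma B e0)); split; last first.
  by rewrite gE; apply: (modelmx_cartan bs n0 mP sP bP).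
(* Proportional Gram matrices make the base change between the two orbits a similitude, with the
   factor of proportionality as its multiplier. *)
split=> //; exists (kap / w); split; first by rewrite mulf_neq0 ?invr_eq0.
rewrite trmx_mul -!mulmxA (mulmxA (Jsp L n)) (mulmxA _^T (_ *m _)) (mulmxA _^T (Jsp L n)).
have -> : (orbmx sigma b x)^T *m Jsp L n *m orbmx sigma b x =
    (kap / w) *: ((orbmx sigma B e0)^T *m Jsp L n *m orbmx sigma B e0).
  by rewrite mulrC -scalerA -GE scalerA mulVf // scale1r.
rewrite -scalemxAl -scalemxAr; congr (_ *: _).
by rewrite mulmxK // mulmxA -trmx_mul mulmxV // trmx1 mul1mx.
Qed.

Theorem theorem4p11 (L : fieldType) (v : L -> int) (sigma : {rmorphism L -> L})
    (p f : nat) (pi : L) :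
  breve_setting v sigma p f pi ->
  (* G = GL_n *)
  (forall (n : nat) (b : 'M[L]_n) (nu : 'I_n -> rat) (mu : 'I_n -> int),
     (0 < n)%N -> inGL b ->
     newton_point v sigma pi b nu ->
     dominant_int mu -> dom_le nu mu ->
     exists g : 'M[L]_n, inGL g /\
       in_cartan v pi (@inGL L n) (invmx g *m b *m map_mx sigma g) mu) /\
  (* G = GSp_2n *)
  (forall (n : nat) (b : 'M[L]_(n + n)) (nu : 'I_(n + n) -> rat)
          (mu : 'I_(n + n) -> int),
     (0 < n)%N -> inGSp b ->
     newton_point v sigma pi b nu ->
     cochar_GSp mu -> dominant_int mu -> dom_le nu mu ->
     exists g : 'M[L]_(n + n), inGSp g /\
       in_cartan v pi (@inGSp L n) (invmx g *m b *m map_mx sigma g) mu).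
Proof.
move=> bs; split=> n b nu mu n0 hb hnu.
  by move=> _; apply: hodge_newton_GL bs n0 hnu.
by move=> coch _; apply: hodge_newton_GSp bs n0 hb hnu coch.
Qed.
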